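(* Let $\alpha\in\mathbb{R}$, $\omega>\omega_\alpha$, $\tilde\omega>0$. For any $\beta \ge 0$, there is no vector and regular minimizer for $c_\beta$.
   Context: Functions are complex-valued on $\mathbb{R}^2$ and $\|\cdot\|_p$ is the $L^p(\mathbb{R}^2)$ norm. For $\lambda>0$, $\mathcal{G}_\lambda$ is the Green's function of $-\Delta+\lambda$ on $\mathbb{R}^2$, i.e. the $L^2$ solution of $(-\Delta+\lambda)\mathcal{G}_\lambda=\delta_0$. Put $\theta_\lambda:=\frac{\log(\sqrt{\lambda}/2)+\gamma}{2\pi}$ ($\gamma$ the Euler–Mascheroni constant) and $\omega_\alpha:=4e^{-4\pi\alpha-2\gamma}$, so $\alpha+\theta_\lambda>0$ for $\lambda>\omega_\alpha$. Let $$H^1_\alpha(\mathbb{R}^2):=\{u\in L^2(\mathbb{R}^2): \exists\, q\in\mathbb{C},\ \lambda>0 \text{ with } \phi_\lambda:=u-q\mathcal{G}_\lambda\in H^1(\mathbb{R}^2)\};$$ the charge $q=q(u)$ is uniquely determined by $u$ and independent of $\lambda$. For $\omega>\omega_\alpha$ and $u=\phi_\lambda+q\mathcal{G}_\lambda\in H^1_\alpha(\mathbb{R}^2)$, $$\langle(-\Delta_\alpha+\omega)u,u\rangle:=\|\nabla\phi_\lambda\|_2^2+\lambda\|\phi_\lambda\|_2^2+(\omega-\lambda)\|u\|_2^2+(\alpha+\theta_\lambda)|q|^2,$$ which does not depend on $\lambda$ (one fixes $\omega_\alpha<\lambda\le\omega$). Let $\mathbb{H}_\alpha:=H^1_\alpha(\mathbb{R}^2)\times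 H^1(\mathbb{R}^2)$ and, for $(u,v)\in\mathbb{H}_\alpha$, $$I_\beta(u,v):=\tfrac12\big(\langle(-\Delta_\alpha+\omega)u,u\rangle+\|\nabla v\|_2^2+\tilde\omega\|v\|_2^2\big)-\tfrac14(\|u\|_4^4+\|v\|_4^4)-\tfrac\beta2\int_{\mathbb{R}^2}|uv|^2,$$ $$G_\beta(u,v):=\langle(-\Delta_\alpha+\omega)u,u\rangle+\|\nabla v\|_2^2+\tilde\omega\|v\|_2^2-(\|u\|_4^4+\|v\|_4^4)-2\beta\int_{\mathbb{R}^2}|uv|^2,$$ $\mathcal{N}_\beta:=\{(u,v)\in\mathbb{H}_\alpha\setminus\{(0,0)\}: G_\beta(u,v)=0\}$, $c_\beta:=\inf_{\mathcal{N}_\beta}I_\beta$. A minimizer for $c_\beta$ is $(u,v)\in\mathcal N_\beta$ with $I_\beta(u,v)=c_\beta$. A pair $(u,v)$ is vector if $u\ne0$ and $v\neq0$; it is regular if $q(u)=0$. *)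

(* Defs.v *)
From mathcomp Require Import all_boot all_order all_algebra.
From mathcomp Require Import all_classical all_reals all_analysis.
From mathcomp Require Import complex.
Set Implicit Arguments.
Unset Strict Implicit.
Unset Printing Implicit Defensive.
Import Order.TTheory GRing.Theory Num.Theory.
Import numFieldNormedType.Exports.
Local Open Scope classical_set_scope.
Local Open Scope ring_scope.
Local Open Scope complex_scope.

(* Elements of the function spaces below are represented by honest measurable
   functions on the plane; two representatives are identified when they agree
   almost everywhere. *)

(* [measurableTypeR R] is R with its Borel sets, the domain of
   [lebesgue_measure]; the type is convertible to [R * R], which carries the
   topology and the directional derivatives. *)
Notation plane R := (measurableTypeR R * measurableTypeR R)%type.
Notation mu2 R := (@lebesgue_measure R \x @lebesgue_measure R)%E.

Section Analysis.
Context {R : realType}.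
Implicit Types (u v g : plane R -> R[i]) (psi : R * R -> R) (e : R * R).

Definition cabs u : plane R -> R := fun x => ComplexField.Normc.normc (u x).

Definition cmeasurable u :=
  measurable_fun setT (fun x => complex.Re (u x) : measurableTypeR R) /\
  measurable_fun setT (fun x => complex.Im (u x) : measurableTypeR R).

Definition lebesgue_space (p : R) : set (plane R -> R[i]) :=
  [set u | cmeasurable u /\ finite_norm (mu2 R) p%:E (cabs u)].

(* Junk value 0 when the norm is infinite. *)
Definition lnorm (p : R) u : R := fine ('N[mu2 R]_(p%:E) [EFin \o cabs u])%E.

Definition cintegral u : R[i] :=
  (\int[mu2 R]_x complex.Re (u x)) +i* (\int[mu2 R]_x complex.Im (u x)).

Definition ae_zero u := {ae mu2 R, forall x, u x = 0}.

Definition e1 : R * R := (1, 0).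
Definition e2 : R * R := (0, 1).

Fixpoint Cn (n : nat) psi : Prop :=
  continuous psi /\
  if n is m.+1 then
    [/\ forall x, derivable psi x e1, forall x, derivable psi x e2,
        Cn m ('D_e1 psi) & Cn m ('D_e2 psi)]
  else True.

(* Real-valued test functions suffice for complex-valued distributions, by
   linearity. *)
Definition test_function psi :=
  (forall n, Cn n psi) /\ compact (closure [set x | psi x != 0]).

Definition laplacian psi : R * R -> R :=
  fun x => 'D_e1 ('D_e1 psi) x + 'D_e2 ('D_e2 psi) x.

Definition is_weak_derivative e u g :=
  forall psi, test_function psi ->
    cintegral (fun x => u x * ('D_e psi x)%:C) =
    - cintegral (fun x => g x * (psi x)%:C).

Definition L2_weak_derivatives e u : set (plane R -> R[i]) :=
  [set g | lebesgue_space 2 g /\ is_weak_derivative e u g].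

Definition H1 : set (plane R -> R[i]) :=
  [set u | [/\ lebesgue_space 2 u, L2_weak_derivatives e1 u !=set0
             & L2_weak_derivatives e2 u !=set0]].

(* The weak derivative (unique up to null sets); junk value 0 when there is
   none in L^2. *)
Definition weak_derivative e u : plane R -> R[i] :=
  xget (fun=> 0) (L2_weak_derivatives e u).

Definition grad_norm2 u : R :=
  lnorm 2 (weak_derivative e1 u) ^+ 2 + lnorm 2 (weak_derivative e2 u) ^+ 2.

(* (- Laplacian + lambda) g = delta_0 in the sense of distributions. *)
Definition is_green (lambda : R) g :=
  lebesgue_space 2 g /\
  forall psi, test_function psi ->
    cintegral (fun x => g x * (- laplacian psi x + lambda * psi x)%:C) =
    (psi (0, 0))%:C.

Definition green (lambda : R) : plane R -> R[i] :=
  xget (fun=> 0) [set g | is_green lambda g].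

Definition charges u : set R[i] :=
  [set q | exists2 lambda : R, 0 < lambda &
           H1 (fun x => u x - q * green lambda x)].

Definition H1_alpha : set (plane R -> R[i]) :=
  [set u | lebesgue_space 2 u /\ charges u !=set0].

(* The charge is unique for u in [H1_alpha]; junk value 0 outside. *)
Definition charge u : R[i] := xget 0 (charges u).

Definition regular_part (lambda : R) u : plane R -> R[i] :=
  fun x => u x - charge u * green lambda x.

End Analysis.

Section Functionals.
Context {R : realType}.
Implicit Types (alpha omega omegat beta lambda : R) (u v : plane R -> R[i]).

Definition euler_gamma : R :=
  limn (fun n : nat => (\sum_(1 <= k < n.+1) k%:R^-1) - ln n%:R).

Definition theta lambda : R :=
  (ln (Num.sqrt lambda / 2) + euler_gamma) / (2 * pi).

Definition omega_crit alpha : R :=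
  4 * expR (- 4 * pi * alpha - 2 * euler_gamma).

(* Quadratic form of - Delta_alpha + omega, evaluated through the
   decomposition u = phi_lambda + q G_lambda. *)
Definition qform alpha omega lambda u : R :=
  grad_norm2 (regular_part lambda u)
  + lambda * lnorm 2 (regular_part lambda u) ^+ 2
  + (omega - lambda) * lnorm 2 u ^+ 2
  + (alpha + theta lambda) * ComplexField.Normc.normc (charge u) ^+ 2.

Definition coupling u v : R := \int[mu2 R]_x (cabs (u \* v) x ^+ 2).

Definition action alpha omega omegat beta lambda u v : R :=
  2^-1 * (qform alpha omega lambda u
          + grad_norm2 v + omegat * lnorm 2 v ^+ 2)
  - 4^-1 * (lnorm 4 u ^+ 4 + lnorm 4 v ^+ 4)
  - beta / 2 * coupling u v.

Definition nehari_functional alpha omega omegat beta lambda u v : R :=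
  qform alpha omega lambda u + grad_norm2 v + omegat * lnorm 2 v ^+ 2
  - (lnorm 4 u ^+ 4 + lnorm 4 v ^+ 4) - 2 * beta * coupling u v.

Definition nehari alpha omega omegat beta lambda :
    set ((plane R -> R[i]) * (plane R -> R[i])) :=
  [set uv | [/\ H1_alpha uv.1, H1 uv.2, ~ (ae_zero uv.1 /\ ae_zero uv.2)
              & nehari_functional alpha omega omegat beta lambda uv.1 uv.2
                = 0]].

Definition nehari_level alpha omega omegat beta lambda : \bar R :=
  ereal_inf [set (action alpha omega omegat beta lambda uv.1 uv.2)%:E
            | uv in nehari alpha omega omegat beta lambda].

Definition minimizer alpha omega omegat beta lambda u v :=
  nehari alpha omega omegat beta lambda (u, v) /\
  (action alpha omega omegat beta lambda u v)%:E
    = nehari_level alpha omega omegat beta lambda.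

Definition vector_pair u v := ~ ae_zero u /\ ~ ae_zero v.

Definition regular_pair u v := charge u = 0.

End Functionals.

(* Main.v *)
Require Import Defs.
From HB Require Import structures.
From mathcomp Require Import all_boot all_order all_algebra.
From mathcomp Require Import all_classical all_reals all_analysis.
From mathcomp Require Import measurable_realfun.
From mathcomp Require Import complex ring lra.
Set Implicit Arguments.
Unset Strict Implicit.
Unset Printing Implicit Defensive.
Import Order.TTheory GRing.Theory Num.Theory.
Import numFieldNormedType.Exports.
Local Open Scope classical_set_scope.
Local Open Scope ring_scope.

(* Suppose (u, v) is a minimizer with u regular, and let Q be its quadratic part,
   so that the level is Q / 4. Scaling gives, for every competitor with quadratic
   part Q' > 0 and quartic part P' > 0, that Q / 4 <= Q'^2 / (4 P'). Taking moduli
   does not increase the Dirichlet energy (a nonexpansive map does not increase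
   difference quotients), so |u| and |v| may be compared with; applied to their
   truncations, the inequality also yields |u|, |v| in L^4.

   Now give |u| a small charge s > 0. Let K > 0 be an explicit parametrix,
   (- Delta + omega) K = delta_0 - rho with rho >= 0: it replaces the Green's
   function, from which it differs by an H^1 function obtained by minimising a
   quadratic form. The pair (|u| + s K, |v|) has quadratic part at most Q + O(s^2),
   because the linear term - 2 s <rho, |u|> is nonpositive, and quartic part at least
   Q + 4 s A with A = \int |u|^3 K > 0. This contradicts the inequality for small s. *)

(** * Square-integrable functions and minimisation of quadratic forms *)

(** The Nehari identity alone gives no integrability: [lnorm] and the real-valued integrals return 0
    when infinite, so the quartic terms of (u, v) might be default values. The inequality on the
    level is therefore used first on bounded truncations, whose fourth powers it bounds uniformly;
    this takes the place of a Sobolev embedding. A charge is free at first order because the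
    quadratic form only differentiates the regular part: the singular part of K enters through a
    constant times s^2, and the cross term with |u| is what (- Delta + omega) K leaves off the
    origin, namely - rho. The quartic part does move at first order, by the integral of |u|^3 K.
    Both signs rely on |u| >= 0, K > 0 and rho >= 0, hence the moduli and the demand on rho. [green]
    is picked by choice from its distributional equation and comes with no formula, no sign and no
    L^4 bound. An explicit kernel supplies these, and a maximum principle gives the uniqueness that
    ties it to [green]. The total mass of the point source of the kernel is never computed:
    linearity shows that it exists, and the maximum principle that it is positive. *)

Lemma norm_le_of_sqr_le (R : realDomainType) (a b : R) :
  0 <= b -> a ^+ 2 <= b ^+ 2 -> `|a| <= b.
Proof. by move=> b0; rewrite -(real_normK (num_real a)) ler_pXn2r// nnegrE. Qed.

Section square_integrable.
Context d (T : measurableType d) (R : realType).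
Context (mu : {measure set T -> \bar R}).
Implicit Types f g h : T -> R.

Definition L2 f :=
  measurable_fun setT f /\ mu.-integrable setT (EFin \o (fun x => f x ^+ 2)).

Definition ip f g := \int[mu]_x (f x * g x).

Lemma ipE f g : ip f g = \int[mu]_x (f x * g x).
Proof. by []. Qed.

Lemma L2_integrableM f g : L2 f -> L2 g ->
  mu.-integrable setT (EFin \o (fun x => f x * g x)).
Proof.
move=> [mf f2] [mg g2].
apply: (@le_integrable _ _ _ mu setT measurableT _
  ((fun x => (f x ^+ 2)%:E + (g x ^+ 2)%:E)%E)).
- by apply/measurable_EFinP; exact: measurable_funM.
- move=> x _ /=; rewrite lee_fin.
  rewrite [leRHS]ger0_norm ?addr_ge0 ?sqr_ge0// ler_norml; apply/andP; split; nra.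
- exact: integrableD.
Qed.

Lemma L2_le f g : measurable_fun setT f -> (forall x, `|f x| <= `|g x|) ->
  L2 g -> L2 f.
Proof.
move=> mf fg [mg g2]; split => //.
apply: le_integrable g2 => //.
  by apply/measurable_EFinP; exact: measurable_funX.
move=> x _ /=; rewrite lee_fin !normrX lerXn2r ?nnegrE ?normr_ge0//.
Qed.

Lemma L2D f g : L2 f -> L2 g -> L2 (fun x => f x + g x).
Proof.
move=> Lf Lg; have fg := L2_integrableM Lf Lg.
case: Lf Lg => [mf f2] [mg g2]; split; first exact: measurable_funD.
have := integrableD measurableT (integrableD measurableT f2 (integrableD measurableT fg fg)) g2.
apply: eq_integrable => // x _ /=; rewrite -!EFinD; congr EFin; ring.
Qed.

Lemma L2Z (a : R) f : L2 f -> L2 (fun x => a * f x).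
Proof.
move=> [mf f2]; split; first exact: measurable_funM.
have := integrableZl measurableT (a ^+ 2) f2.
apply: eq_integrable => // x _ /=; rewrite -!EFinM; congr EFin; ring.
Qed.

Lemma L2N f : L2 f -> L2 (fun x => - f x).
Proof. by move=> /(L2Z (-1)); under eq_fun do rewrite mulN1r. Qed.

Lemma L2B f g : L2 f -> L2 g -> L2 (fun x => f x - g x).
Proof. by move=> Lf /L2N; exact: L2D. Qed.

Lemma L20 : L2 (fun=> 0).
Proof.
split; first exact: measurable_cst.
by have := @integrable0 _ T R mu setT; apply: eq_integrable => // x _ /=; rewrite expr0n.
Qed.

Lemma ipC f g : ip f g = ip g f.
Proof. by apply: eq_Rintegral => x _; rewrite mulrC. Qed.

Lemma ipDl f g h : L2 f -> L2 g -> L2 h ->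
  ip (fun x => f x + g x) h = ip f h + ip g h.
Proof.
move=> Lf Lg Lh; rewrite /ip -RintegralD//; try exact: L2_integrableM.
by apply: eq_Rintegral => x _; rewrite mulrDl.
Qed.

Lemma ipZl (a : R) f g : L2 f -> L2 g -> ip (fun x => a * f x) g = a * ip f g.
Proof.
move=> Lf Lg; rewrite /ip -RintegralZl//; try exact: L2_integrableM.
by apply: eq_Rintegral => x _; rewrite mulrA.
Qed.

Lemma ipNl f g : L2 f -> L2 g -> ip (fun x => - f x) g = - ip f g.
Proof.
by move=> Lf Lg; under eq_fun do rewrite -mulN1r; rewrite ipZl// mulN1r.
Qed.

Lemma ipBl f g h : L2 f -> L2 g -> L2 h ->
  ip (fun x => f x - g x) h = ip f h - ip g h.
Proof. by move=> Lf Lg Lh; rewrite ipDl ?ipNl//; exact: L2N. Qed.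

Lemma ipDr f g h : L2 f -> L2 g -> L2 h ->
  ip h (fun x => f x + g x) = ip h f + ip h g.
Proof. by move=> *; rewrite ipC ipDl// ![ip _ h]ipC. Qed.

Lemma ipZr (a : R) f g : L2 f -> L2 g -> ip g (fun x => a * f x) = a * ip g f.
Proof. by move=> *; rewrite ipC ipZl// [ip _ g]ipC. Qed.

Lemma ipNr f g : L2 f -> L2 g -> ip g (fun x => - f x) = - ip g f.
Proof. by move=> *; rewrite ipC ipNl// [ip _ g]ipC. Qed.

Lemma ip_ge0 f : 0 <= ip f f.
Proof. by apply: Rintegral_ge0 => x _; rewrite -expr2 sqr_ge0. Qed.

Lemma EFin_ip f : L2 f -> ((ip f f)%:E = \int[mu]_x ((f x ^+ 2)%:E))%E.
Proof.
move=> [mf f2]; rewrite /ip /Rintegral fineK; first by apply: eq_integral => x _; rewrite expr2.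
have := integrable_fin_num measurableT f2.
by congr (_ \is a fin_num); apply: eq_integral => x _ /=; rewrite expr2.
Qed.

Lemma ip_sqrD f g : L2 f -> L2 g ->
  ip (fun x => f x + g x) (fun x => f x + g x) = ip f f + 2 * ip f g + ip g g.
Proof.
move=> Lf Lg; rewrite ipDl//; last exact: L2D.
rewrite !ipDr// (ipC g f); ring.
Qed.

Lemma ip_sqrZ (a : R) f : L2 f ->
  ip (fun x => a * f x) (fun x => a * f x) = a ^+ 2 * ip f f.
Proof. by move=> Lf; rewrite ipZl ?ipZr//; [ring|exact: L2Z]. Qed.

Lemma ip_sqrB f g : L2 f -> L2 g ->
  ip (fun x => f x - g x) (fun x => f x - g x) = ip f f - 2 * ip f g + ip g g.
Proof.
move=> Lf Lg; rewrite (ip_sqrD Lf (L2N Lg)) ipNl// ?ipNr//; first by ring.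
exact: L2N.
Qed.

(** Expands the square of [a f - b g] at a = <g, g>, b = <f, g>. *)
Lemma cauchy_schwarz f g : L2 f -> L2 g -> ip f g ^+ 2 <= ip f f * ip g g.
Proof.
move=> Lf Lg.
have H (a b : R) : 0 <= a ^+ 2 * ip f f - 2 * (a * b) * ip f g + b ^+ 2 * ip g g.
  have := ip_ge0 (fun x => a * f x - b * g x).
  rewrite ip_sqrB; [|exact: L2Z|exact: L2Z].
  rewrite !ip_sqrZ// ipZl//; last exact: L2Z.
  rewrite ipZr//; congr (_ <= _); ring.
have [g0|g0] := eqVneq (ip g g) 0.
  (* With <g, g> = 0 the expression is affine in b, and this choice of (a, b) turns it into - <f,
     g>^2. *)
  have H1 := H (ip f g) ((ip f f + 1) / 2); rewrite g0 mulr0 addr0 in H1 *.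
  have f0 := ip_ge0 f.
  have : 0 <= ip f g ^+ 2 * (ip f f - (ip f f + 1)) by move: H1; congr (_ <= _); field.
  nra.
have gp : 0 < ip g g by rewrite lt_neqAle eq_sym g0 ip_ge0.
have H1 := H (ip g g) (ip f g).
have : 0 <= ip g g * (ip f f * ip g g - ip f g ^+ 2) by move: H1; congr (_ <= _); ring.
by rewrite pmulr_rge0// subr_ge0.
Qed.

Lemma ip_le f g : L2 g -> measurable_fun setT f -> (forall x, `|f x| <= `|g x|) ->
  ip f f <= ip g g.
Proof.
move=> Lg mf fg; have Lf := L2_le mf fg Lg.
apply: le_Rintegral => //; try exact: L2_integrableM.
move=> x _; rewrite -!expr2 -(real_normK (num_real (f x))) -(real_normK (num_real (g x))).
by rewrite lerXn2r ?nnegrE.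
Qed.

End square_integrable.

Lemma sum_half_le2 (R : realType) n : \sum_(0 <= k < n) (2^-1 : R) ^+ k <= 2.
Proof.
suff -> : \sum_(0 <= k < n) (2^-1 : R) ^+ k = 2 - 2 * 2^-1 ^+ n.
  by rewrite gerBl mulr_ge0// exprn_ge0.
elim: n => [|n ih]; first by rewrite big_nil expr0; ring.
by rewrite big_nat_recr//= ih exprS; field.
Qed.

(* AM-GM: [|d| <= 2^-k + 2^k d^2], so the assumption makes the increments summable. *)
Lemma cvg_of_weighted_increments (R : realType) (a : R^nat) :
  (\sum_(0 <= k <oo) (2 ^+ k * (a k.+1 - a k) ^+ 2)%:E < +oo)%E -> cvgn a.
Proof.
move=> hoo.
have h0 k : 0 <= 2 ^+ k * (a k.+1 - a k) ^+ 2 by rewrite mulr_ge0 ?sqr_ge0// exprn_ge0.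
have [S hS] : exists S : R, forall n, \sum_(0 <= k < n) 2 ^+ k * (a k.+1 - a k) ^+ 2 <= S.
  exists (fine (\sum_(0 <= k <oo) (2 ^+ k * (a k.+1 - a k) ^+ 2)%:E)%E) => n.
  have ge0 : (0 <= \sum_(0 <= k <oo) (2 ^+ k * (a k.+1 - a k) ^+ 2)%:E)%E.
    by apply: nneseries_ge0 => k _ _; rewrite lee_fin.
  rewrite -lee_fin fineK ?ge0_fin_numE// -sumEFin.
  by apply: nneseries_lim_ge => k _ _; rewrite lee_fin.
suff : cvgn (series (telescope a)).
  move=> /(is_cvgD (is_cvg_cst (a 0%N))).
  suff -> : (fun=> a 0%N) + series (telescope a) = a by [].
  by apply/funext => n; rewrite [RHS]eq_sum_telescope.
apply: normed_cvg; apply: nondecreasing_is_cvgn.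
  by apply/nondecreasing_seqP => n; rewrite /= [leRHS]seriesSr lerDl.
exists (2 + S) => _ [n _ <-]; rewrite /series/=.
apply: le_trans (lerD (sum_half_le2 R n) (hS n)).
rewrite -big_split/=; apply: ler_sum => k _; rewrite /telescope/=.
have p0 : 0 < (2 : R) ^+ k by rewrite exprn_gt0.
rewrite -(real_normK (num_real (a k.+1 - a k))) exprVn.
set d := `|_|; set p := _ ^+ k in p0 *.
have -> : p^-1 + p * d ^+ 2 = d + (p * (d - p^-1 / 2) ^+ 2 + 3 / 4 * p^-1).
  by field; rewrite gt_eqF.
have := mulr_ge0 (ltW p0) (sqr_ge0 (d - p^-1 / 2)).
by have : 0 < p^-1; [rewrite invr_gt0|move: (p^-1) (p * _) => b c; lra].
Qed.

(** * Completeness of the space of square-integrable functions *)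

Section completeness.
Context d (T : measurableType d) (R : realType).
Context (mu : {measure set T -> \bar R}).
Local Notation ip := (ip mu).
Local Notation L2 := (L2 mu).

(** A fast subsequence converges almost everywhere because its weighted squared increments have an
    integrable sum; Fatou's lemma then bounds the distance from every late term to the limit. *)
Lemma L2_complete (f_ : nat -> T -> R) : (forall n, L2 (f_ n)) ->
  (forall e, 0 < e -> exists N, forall m n, (N <= m)%N -> (N <= n)%N ->
    ip (fun x => f_ m x - f_ n x) (fun x => f_ m x - f_ n x) <= e) ->
  exists2 f, L2 f &
    forall e, 0 < e -> exists N, forall n, (N <= n)%N ->
      ip (fun x => f_ n x - f x) (fun x => f_ n x - f x) <= e.
Proof.
move=> Lf fC.
(* Squared gaps of 4^-j against the weights 2^j of [cvg_of_weighted_increments] leave a geometric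
   series of ratio 1/2. *)
have pos j : 0 < (4^-1 : R) ^+ j by rewrite exprn_gt0.
have [N_ hN] := choice (fun j => fC _ (pos j)).
(* Summing all thresholds makes the indices monotone; the extra j forces [k_ j] to be at least j,
   which the Fatou step needs. *)
pose k_ j := (j + \sum_(i < j.+1) N_ i)%N.
have kN j : (N_ j <= k_ j)%N by rewrite /k_ big_ord_recr/= addnA leq_addl.
have kS j : (k_ j <= k_ j.+1)%N by rewrite leq_add// [leqRHS]big_ord_recr leq_addr.
pose a j := f_ (k_ j).
have La j : L2 (a j) by exact: Lf.
have ma j : measurable_fun setT (a j) by case: (La j).
pose h j x := (2 ^+ j * (a j.+1 x - a j x) ^+ 2)%:E.
have h0 j x : (0 <= h j x)%E by rewrite lee_fin mulr_ge0 ?sqr_ge0// exprn_ge0.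
have mh j : measurable_fun setT (h j).
  by apply/measurable_EFinP; apply: measurable_funM => //; apply: measurable_funX; exact: measurable_funB.
have inth : (\int[mu]_x \sum_(0 <= j <oo) h j x < +oo)%E.
  rewrite integral_nneseries//.
  apply: (@le_lt_trans _ _ 2%:E); last exact: ltry.
  apply: lime_le; first by apply: is_cvg_nneseries => n _ _; exact: integral_ge0.
  apply: nearW => n; apply: le_trans (_ : (\sum_(0 <= k < n) (2^-1 ^+ k)%:E <= _)%E); last first.
    by rewrite sumEFin lee_fin sum_half_le2.
  apply: lee_sum => j _.
  rewrite /h; under eq_integral do rewrite EFinM.
  rewrite ge0_integralZl_EFin//=; last 2 first.
    by move=> x _; rewrite lee_fin sqr_ge0.
    by apply/measurable_EFinP; apply: measurable_funX; exact: measurable_funB.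
  rewrite -EFin_ip; last exact: L2B.
  rewrite -EFinM lee_fin.
  have := hN j (k_ j.+1) (k_ j) (leq_trans (kN j) (kS j)) (kN j).
  move=> /(ler_wpM2l (exprn_ge0 j (ler0n R 2))) /le_trans; apply.
  by rewrite -exprMn (_ : 2 * 4^-1 = 2^-1 :> R)//; field.
have mH : measurable_fun setT (fun x => \sum_(0 <= j <oo) h j x)%E.
  exact: ge0_emeasurable_sum.
have cvga : {ae mu, forall x, cvgn (fun j => a j x)}.
  have : mu.-integrable setT (fun x => \sum_(0 <= j <oo) h j x)%E.
    apply/integrableP; split => //.
    under eq_integral do rewrite gee0_abs ?nneseries_ge0//.
    exact: inth.
  move=> /(integrable_ae measurableT); apply: filterS => x /(_ I) fin.
  by apply: cvg_of_weighted_increments; rewrite ltey_eq fin.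
(* The upper limit is measurable whether or not the sequence converges, and equals the limit where
   it does. *)
pose f x := fine (limn_esup (fun j => (a j x)%:E)).
have mf : measurable_fun setT f.
  apply: measurableT_comp => //; apply: measurable_fun_limn_esup => j.
  exact/measurable_EFinP.
have af : {ae mu, forall x, (fun j => a j x) @ \oo --> f x}.
  apply: filterS cvga => x cx.
  suff -> : f x = limn (fun j => a j x) by [].
  have c : (fun j => (a j x)%:E) @ \oo --> (limn (fun j => a j x))%:E.
    by apply: cvg_EFin => //; exact: nearW.
  by rewrite /f is_cvg_limn_esupE ?(cvg_lim _ c)//; exact: cvgP c.
have key e N : (forall m n, (N <= m)%N -> (N <= n)%N ->
    ip (fun x => f_ m x - f_ n x) (fun x => f_ m x - f_ n x) <= e) ->
    forall n, (N <= n)%N -> (\int[mu]_x ((f_ n x - f x) ^+ 2)%:E <= e%:E)%E.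
  move=> He n Nn.
  have mfn : measurable_fun setT (f_ n) by case: (Lf n).
  pose g j x := ((f_ n x - a j x) ^+ 2)%:E.
  have mg j : measurable_fun setT (g j).
    by apply/measurable_EFinP; apply: measurable_funX; exact: measurable_funB.
  have -> : (\int[mu]_x ((f_ n x - f x) ^+ 2)%:E = \int[mu]_x limn_einf (g^~ x))%E.
    apply: ae_eq_integral => //.
    - by apply/measurable_EFinP; apply: measurable_funX; exact: measurable_funB.
    - rewrite /limn_einf; apply: measurableT_comp => //.
      by apply: measurable_fun_limn_esup => j; apply: measurableT_comp => //.
    - apply: filterS af => x ax _.
      have gc : g^~ x @ \oo --> ((f_ n x - f x) ^+ 2)%:E.
        apply/cvg_EFin; first exact: nearW.
        by apply: cvgM; apply: cvgB => //; exact: cvg_cst.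
      by rewrite is_cvg_limn_einfE ?(cvg_lim _ gc)//; exact: cvgP gc.
  apply: le_trans (fatou _ measurableT mg _) _ => //.
    by move=> j x _; rewrite lee_fin sqr_ge0.
  rewrite limn_einf_lim; apply: lime_le; first exact: is_cvg_einfs.
  apply: nearW => j.
  apply: le_trans (_ : (\int[mu]_x g (j + N)%N x <= _)%E).
    by apply: ereal_inf_lbound; exists (j + N)%N => //=; rewrite leq_addr.
  rewrite -EFin_ip; last exact: L2B.
  rewrite lee_fin He//; rewrite /k_.
  by rewrite -addnA addnCA leq_addr.
have L2f : L2 f.
  have [N HN] := fC 1 ltr01.
  have mfN : measurable_fun setT (f_ N) by case: (Lf N).
  have : L2 (fun x => f_ N x - f x).
    split; first exact: measurable_funB.
    apply/integrableP; split.
      by apply/measurable_EFinP; apply: measurable_funX; exact: measurable_funB.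
    apply: le_lt_trans (ltry 1); apply: le_trans (key _ _ HN N (leqnn _)).
    by under eq_integral do rewrite /= ger0_norm ?sqr_ge0//.
  by move=> /(L2B (Lf N)); under eq_fun do rewrite subKr.
exists f => // e e0; have [N HN] := fC e e0; exists N => n Nn.
by rewrite -lee_fin EFin_ip; [exact: key HN n Nn|exact: L2B].
Qed.

End completeness.

(** * Riesz representation by minimising sequences *)

Lemma discriminant_le (R : realFieldType) (a b D : R) : 0 < a -> 0 <= b ->
  (forall t, 0 <= a + 2 * t * D + t ^+ 2 * b) -> D ^+ 2 <= a * b.
Proof.
move=> a0 b0 q; have [y0|y0] := eqVneq b 0.
  rewrite y0 mulr0; have [->|D0] := eqVneq D 0; first by rewrite expr0n.
  (* For b = 0 the expression is affine in t, and this t gives it the negative value - a - 2. *)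
  have := q (- (a + 1) / D); rewrite y0 mulr0.
  have -> : 2 * (- (a + 1) / D) * D = - 2 * (a + 1) by field.
  lra.
have yp : 0 < b by rewrite lt_neqAle eq_sym y0.
have := q (- D / b).
have -> : a + 2 * (- D / b) * D + (- D / b) ^+ 2 * b = (a * b - D ^+ 2) / b by field.
by rewrite pmulr_lge0 ?invr_gt0// subr_ge0.
Qed.

Section riesz.
Context (R : realType) (V : lmodType R) (S : set V).
Context (B : V -> V -> R) (l : V -> R) (C : R).
Hypotheses (C0 : 0 <= C) (S0 : S 0) (SD : forall x y, S x -> S y -> S (x + y))
  (SZ : forall a x, S x -> S (a *: x)).
Hypotheses (BC : forall x y, S x -> S y -> B x y = B y x)
  (BD : forall x y z, S x -> S y -> S z -> B (x + y) z = B x z + B y z)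
  (BZ : forall a x y, S x -> S y -> B (a *: x) y = a * B x y)
  (B_ge0 : forall x, S x -> 0 <= B x x).
Hypotheses (lD : forall x y, S x -> S y -> l (x + y) = l x + l y)
  (lZ : forall a x, S x -> l (a *: x) = a * l x)
  (lB : forall x, S x -> l x ^+ 2 <= C * B x x).

(* A minimizing sequence of [B x x - 2 l x] is Cauchy by the parallelogram
   identity. *)
Lemma riesz_sequence : exists x_ : nat -> V, [/\ forall n, S (x_ n),
  forall e, 0 < e -> exists N, forall m n, (N <= m)%N -> (N <= n)%N ->
    B (x_ m - x_ n) (x_ m - x_ n) <= e &
  forall y, S y -> (fun n => B (x_ n) y) @ \oo --> l y].
Proof.
pose J x := B x x - 2 * l x.
have BDr x y z : S x -> S y -> S z -> B z (x + y) = B z x + B z y.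
  by move=> Sx Sy Sz; rewrite BC ?BD// 1?(BC _ Sz) 1?(BC _ Sz)//; exact: SD.
have BZr a x y : S x -> S y -> B y (a *: x) = a * B y x.
  by move=> Sx Sy; rewrite BC ?BZ// 1?(BC _ Sy)//; exact: SZ.
have Jexp a b x y : S x -> S y -> J (a *: x + b *: y) =
    a ^+ 2 * B x x + 2 * (a * b) * B x y + b ^+ 2 * B y y - 2 * a * l x - 2 * b * l y.
  move=> Sx Sy; have [Sa Sb] := (SZ a Sx, SZ b Sy).
  rewrite /J BD ?BDr ?BZ ?BZr ?lD ?lZ//; try exact: SD.
  by rewrite (BC Sy Sx); ring.
(* Follows from (2 l x)^2 <= 4 C B x x <= (B x x + C)^2. *)
have Jlb x : S x -> - C <= J x.
  move=> Sx; rewrite /J; have := lB Sx; have := B_ge0 Sx.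
  move: (B x x) (l x) => b t b0 tb.
  have : (2 * t) ^+ 2 <= (b + C) ^+ 2 by have := sqr_ge0 (b - C); nra.
  by move=> /(norm_le_of_sqr_le (addr_ge0 b0 C0)); rewrite ler_norml => /andP[_ ?]; lra.
pose A := [set J x | x in S].
have Ai : has_inf A.
  by split; [exists (J 0); exists 0|exists (- C) => _ [x Sx <-]; exact: Jlb].
have n0 n : (0 : R) < n.+1%:R^-1 by rewrite invr_gt0.
have ex n : exists x, S x /\ J x <= inf A + n.+1%:R^-1.
  have [_ [x Sx <-] hx] := @inf_adherent _ A n.+1%:R^-1 (n0 n) Ai.
  by exists x; split => //; exact: ltW.
have [x_ hx] := choice ex.
have Jinf x : S x -> inf A <= J x by move=> Sx; apply: ge_inf; [case: Ai|exists x].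
exists x_; split => [n|e e0|y Sy]; first by case: (hx n).
- have [N hN] : exists N : nat, N.+1%:R^-1 < e / 4.
    by exists (Num.truncn (e / 4)^-1); rewrite invf_plt ?posrE ?divr_gt0// truncnS_gt.
  exists N => m n Nm Nn.
  have [[Sm Jm] [Sn Jn]] := (hx m, hx n).
  have Jmid := Jinf _ (SD (SZ 2^-1 Sm) (SZ 2^-1 Sn)).
  rewrite Jexp// in Jmid.
  have m1 : m.+1%:R^-1 <= N.+1%:R^-1 :> R by rewrite lef_pV2 ?posrE// ler_nat ltnS.
  have n1 : n.+1%:R^-1 <= N.+1%:R^-1 :> R by rewrite lef_pV2 ?posrE// ler_nat ltnS.
  have -> : B (x_ m - x_ n) (x_ m - x_ n) = B (x_ m) (x_ m) - 2 * B (x_ m) (x_ n) + B (x_ n) (x_ n).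
    rewrite -scaleN1r; have Sn' := SZ (-1) Sn.
    rewrite BD ?BDr ?BZ ?BZr//; try exact: SD.
    by rewrite (BC Sn Sm); ring.
  move: Jm Jn Jmid m1 n1 hN; rewrite /J.
  have -> : 2^-1 ^+ 2 = 4^-1 :> R by field.
  have -> : 2 * (2^-1 / 2) = 2^-1 :> R by field.
  have -> : 2 / 2 = 1 :> R by field.
  move: (m.+1%:R^-1) (n.+1%:R^-1) (N.+1%:R^-1) => a b c; lra.
(* [x_ n] minimises J up to 1/(n+1) along every line [x_ n + t y]; the discriminant of that
   quadratic in t controls the error in the Euler equation. *)
- have Bb n : (B (x_ n) y - l y) ^+ 2 <= n.+1%:R^-1 * B y y.
    have [Sn Jn] := hx n.
    have q t : 0 <= n.+1%:R^-1 + 2 * t * (B (x_ n) y - l y) + t ^+ 2 * B y y.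
      have := Jinf _ (SD (SZ 1 Sn) (SZ t Sy)); rewrite Jexp//; move: Jn.
      rewrite /J expr1n mul1r mulr1; move: (n.+1%:R^-1) => a; lra.
    exact: discriminant_le (n0 n) (B_ge0 Sy) q.
  apply/cvgrPdist_le => e e0.
  have e2 : 0 < e ^+ 2 / (B y y + 1) by rewrite divr_gt0 ?exprn_gt0 ?ltr_wpDl ?B_ge0.
  have [N hN] : exists N : nat, N.+1%:R^-1 < e ^+ 2 / (B y y + 1).
    by exists (Num.truncn (e ^+ 2 / (B y y + 1))^-1); rewrite invf_plt ?posrE// truncnS_gt.
  exists N => // n /= Nn.
  have n1 : n.+1%:R^-1 <= N.+1%:R^-1 :> R by rewrite lef_pV2 ?posrE// ler_nat ltnS.
  rewrite distrC; apply: norm_le_of_sqr_le (ltW e0) _; apply: le_trans (Bb n) _.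
  have By := B_ge0 Sy.
  have : n.+1%:R^-1 <= e ^+ 2 / (B y y + 1) by rewrite (le_trans n1)// ltW.
  move: (n0 n); move: (n.+1%:R^-1) => a a0; rewrite ler_pdivlMr ?ltr_wpDl//; nra.
Qed.

End riesz.

(** * Test functions *)

Section smooth_line.
Context {R : realType}.
Implicit Types (f g : R -> R) (a b c x : R).

(** One-variable counterpart of [Cn], with the derivative given as a witness, so that explicit
    derivatives can be supplied and tensored. *)
Fixpoint Dn (n : nat) f : Prop :=
  if n is m.+1 then exists2 g, (forall x : R, is_derive x 1 f (g x)) & Dn m g
  else continuous f.

Lemma is_derive1_continuous f g : (forall x : R, is_derive x 1 f (g x)) -> continuous f.
Proof. by move=> fg x; apply: differentiable_continuous; apply/derivable1_diffP; have [] := fg x. Qed.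

Lemma Dn_continuous n f : Dn n f -> continuous f.
Proof. by case: n => [//|n] [g fg _]; exact: is_derive1_continuous fg. Qed.

Lemma DnS n f : Dn n.+1 f -> Dn n f.
Proof.
elim: n f => [|n ih] f; first exact: Dn_continuous.
by case=> g fg gn; exists g => //; exact: ih.
Qed.

Lemma DnD n f g : Dn n f -> Dn n g -> Dn n (fun x => f x + g x).
Proof.
elim: n f g => [|n ih] f g; first by move=> cf cg x; apply: cvgD; [exact: cf|exact: cg].
move=> [f' ff fn] [g' gg gn]; exists (fun x => f' x + g' x); last exact: ih.
by move=> x; have := is_deriveD (ff x) (gg x).
Qed.

Lemma Dn_cst n (c : R) : Dn n (fun=> c).
Proof.
elim: n c => [|n ih] c; first exact: cst_continuous.
by exists (fun=> 0) => // x; exact: is_derive_cst.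
Qed.

Lemma DnM n f g : Dn n f -> Dn n g -> Dn n (fun x => f x * g x).
Proof.
elim: n f g => [|n ih] f g; first by move=> cf cg x; apply: cvgM; [exact: cf|exact: cg].
move=> fS gS; have [f' ff fn] := fS; have [g' gg gn] := gS.
exists (fun x => f x * g' x + g x * f' x).
  by move=> x; have := is_deriveM (ff x) (gg x).
by apply: DnD; apply: ih => //; exact: DnS.
Qed.

Lemma Dn_affine n f (c d : R) : Dn n f -> Dn n (fun x => f (c * x + d)).
Proof.
elim: n f => [|n ih] f.
  move=> cf x; apply: (@continuous_comp _ _ _ (fun x => c * x + d) f); last exact: cf.
  by apply: cvgD; [apply: cvgM; [exact: cvg_cst|exact: cvg_id]|exact: cvg_cst].
move=> [f' ff fn]; exists (fun x => f' (c * x + d) * c); last first.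
  by apply: DnM; [exact: ih|exact: Dn_cst].
move=> x; apply: (@is_derive1_comp _ f (fun x => c * x + d)) => //.
have := is_deriveD (is_deriveM (is_derive_cst c x 1) (is_derive_id x 1)) (is_derive_cst d x 1).
by rewrite /= scaler0 !addr0 [c *: 1]mulr1.
Qed.

(** The index k makes the family stable under differentiation: the derivative of [flat k] is
    [flat k.+2 - k flat k.+1], so smoothness of the usual exp (- 1/x) is a plain induction. *)
Definition flat (k : nat) (x : R) : R :=
  if 0 < x then x^-1 ^+ k * expR (- x^-1) else 0.

Lemma flat_ge0 k x : 0 <= flat k x.
Proof.
rewrite /flat; case: ifPn => // x0.
by rewrite mulr_ge0 ?expR_ge0// exprn_ge0// invr_ge0 ltW.
Qed.

Lemma flat_eq0 k x : x <= 0 -> flat k x = 0.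
Proof. by rewrite /flat ltNge => ->. Qed.

Lemma flat_gt0 k x : 0 < x -> 0 < flat k x.
Proof. by move=> x0; rewrite /flat x0 mulr_gt0 ?expR_gt0// exprn_gt0// invr_gt0. Qed.

(** The term of order k+1 of the series of exp (1/x) already beats x^-(k+1). One spare power of x
    remains, hence continuity at the origin for every k. *)
Lemma flat_le k x : flat k x <= k.+1`!%:R * `|x|.
Proof.
rewrite /flat; case: ifPn => x0; last by rewrite mulr_ge0.
have xi : 0 < x^-1 by rewrite invr_gt0.
have := expR_ge1Dxn k (ltW xi).
have f0 : (0 : R) < k.+1`!%:R by rewrite ltr0n fact_gt0.
have e0 := expR_gt0 x^-1.
rewrite expRN ler_pdivrMr// gtr0_norm// => h.
have {}h : x^-1 ^+ k.+1 <= k.+1`!%:R * expR x^-1.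
  by rewrite mulrC -ler_pdivrMr//; apply: le_trans h; rewrite lerDr.
have -> : x^-1 ^+ k = x * x^-1 ^+ k.+1 by rewrite exprS mulVKf// gt_eqF.
by rewrite [_ * x]mulrC -mulrA ler_pM2l.
Qed.

Lemma flat_continuous0 k : {for 0, continuous (flat k)}.
Proof.
apply/cvgrPdist_le => e e0.
have f0 : (0 : R) < k.+1`!%:R by rewrite ltr0n fact_gt0.
near=> x; rewrite [flat k 0]/flat ltxx sub0r normrN ger0_norm ?flat_ge0//.
apply: le_trans (flat_le k x) _; rewrite mulrC -ler_pdivlMr//.
near: x; have := @cvgr0_norm_le _ _ _ (nbhs (0 : R)) _ id (@cvg_id _ (nbhs (0 : R))).
by apply; rewrite divr_gt0.
Unshelve. all: by end_near. Qed.

Lemma is_derive_flat k x : is_derive x 1 (flat k) (flat k.+2 x - k%:R * flat k.+1 x).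
Proof.
have [x0|x0|->] := ltgtP x 0.
- rewrite /flat (lt_gtF x0) mulr0 subr0.
  have := is_derive_cst (0 : R) x (1 : R); apply: near_eq_is_derive.
  near=> y; rewrite ltNge ltW//=; near: y; exact: lt_nbhsl.
- have dV : is_derive x 1 (fun y : R => y^-1) (- x ^- 2).
    have := @is_deriveV _ id x 1 1 (lt0r_neq0 x0) (is_derive_id x 1).
    by rewrite [_ *: 1]mulr1.
  have dE : is_derive x 1 (fun y : R => expR (- y^-1)) (expR (- x^-1) * x ^- 2).
    apply: (@is_derive1_comp _ expR (fun y : R => - y^-1)).
    have := is_deriveN dV; by rewrite opprK.
  have := is_deriveM (is_deriveX k dV) dE.
  move=> /(@near_eq_is_derive _ _ _ _ (flat k)); rewrite [flat k.+2 x]/flat [flat k.+1 x]/flat x0.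
  have -> : x^-1 ^+ k.+2 * expR (- x^-1) - k%:R * (x^-1 ^+ k.+1 * expR (- x^-1)) =
     x^-1 ^+ k *: (expR (- x^-1) * x ^- 2) + expR (- x^-1) *: ((k%:R * x^-1 ^+ k.-1) *: - x ^- 2).
    rewrite /GRing.scale/= -exprVn; set E := expR _; move: E (x^-1) => E y.
    by case: k => [|k]; rewrite /= ?exprS; ring.
  rewrite exprfctE; apply; near=> y; rewrite /flat ifT//; near: y; exact: lt_nbhsr.
(* At the origin [flat k z = z * flat k.+1 z], so [flat k.+1] is a slope function, continuous there
   with value 0. *)
- rewrite /flat ltxx mulr0 subr0; apply/is_derive1_caratheodory.
  exists (flat k.+1); split => [z||]; first last.
  + by rewrite /flat ltxx.
  + exact: flat_continuous0.
  + rewrite /flat ltxx !subr0; case: ifPn => z0; last by rewrite mul0r.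
    by rewrite exprS; field; exact: lt0r_neq0.
Unshelve. all: by end_near. Qed.

Lemma Dn_flat n k : Dn n (flat k).
Proof.
elim: n k => [|n ih] k.
  exact: is_derive1_continuous (is_derive_flat k).
exists (fun x => flat k.+2 x + - k%:R * flat k.+1 x).
  by move=> x; have := is_derive_flat k x; rewrite mulNr.
by apply: DnD => //; apply: DnM => //; exact: Dn_cst.
Qed.

(* Smooth, supported in [[a, b]], and increasing with [c] to the indicator of ]a, b[. *)
Definition smooth_indic (a b c : R) (x : R) : R :=
  flat 0 (c * (x - a)) * flat 0 (c * (b - x)).

Lemma Dn_smooth_indic n a b c : Dn n (smooth_indic a b c).
Proof.
rewrite (_ : smooth_indic a b c =
    fun x => flat 0 (c * x + - (c * a)) * flat 0 (- c * x + c * b)).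
  by apply: DnM; apply: (@Dn_affine n (flat 0)); exact: Dn_flat.
by apply/funext => x; congr (flat _ _ * flat _ _); ring.
Qed.

Lemma smooth_indic_ge0 a b c x : 0 <= smooth_indic a b c x.
Proof. by rewrite mulr_ge0 ?flat_ge0. Qed.

Lemma flat0_le1 x : flat 0 x <= 1.
Proof.
rewrite /flat; case: ifPn => // x0.
by rewrite expr0 mul1r -expR0 ler_expR oppr_le0 invr_ge0 ltW.
Qed.

Lemma smooth_indic_le1 a b c x : smooth_indic a b c x <= 1.
Proof. by rewrite -[leRHS]mulr1 ler_pM ?flat_ge0 ?flat0_le1. Qed.

Lemma smooth_indic_neq0 a b c x : 0 < c -> smooth_indic a b c x != 0 -> a < x < b.
Proof.
move=> c0; apply: contraNT; rewrite negb_and -!leNgt => /orP[h|h].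
  by rewrite /smooth_indic flat_eq0 ?mul0r// pmulr_rle0// subr_le0.
by rewrite /smooth_indic [X in _ * X]flat_eq0 ?mulr0// pmulr_rle0// subr_le0.
Qed.

Lemma smooth_indic_gt0 a b c x : 0 < c -> a < x < b -> 0 < smooth_indic a b c x.
Proof. by move=> c0 /andP[ax xb]; rewrite mulr_gt0 ?flat_gt0// mulr_gt0// subr_gt0. Qed.

Lemma cvg_flat0 x : 0 < x -> (fun n : nat => flat 0 (n%:R * x)) @ \oo --> (1 : R).
Proof.
move=> x0.
apply/cvgrPdist_le => e e0; near=> n.
have n0 : 0 < n%:R * x by rewrite mulr_gt0// ltr0n; near: n; exact: nbhs_infty_gt.
rewrite ger0_norm ?subr_ge0 ?flat0_le1// /flat n0 expr0 mul1r lerBlDr.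
apply: le_trans (lerD (lexx e) (expR_ge1Dx _)).
rewrite addrCA lerDl subr_ge0 invfM ler_pdivrMr// -ler_pdivrMl//.
near: n; exists (Num.truncn (e^-1 * x^-1)).+1 => // n/=; rewrite -(ler_nat R) => h.
have n1 : (0 : R) < n%:R by apply: lt_le_trans h; rewrite ltr0n.
by rewrite ler_pdivrMr// mulrC -ler_pdivrMr// (le_trans _ h)// ltW// truncnS_gt.
Unshelve. all: by end_near. Qed.

Lemma cvg_smooth_indic a b x : (fun n : nat => smooth_indic a b n%:R x) @ \oo --> (\1_`]a, b[%classic x : R).
Proof.
have H c : (fun n : nat => flat 0 (n%:R * c)) @ \oo --> ((0 < c)%R%:R : R).
  have [c0|c0] := ltP 0 c; first exact: cvg_flat0.
  rewrite [X in X @ _](_ : _ = fun=> 0); first exact: cvg_cst.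
  by apply/funext => n; rewrite /flat ltNge mulr_ge0_le0//.
have -> : (\1_`]a, b[%classic x : R) = (0 < x - a)%R%:R * (0 < b - x)%R%:R.
  by rewrite !subr_gt0 indicE mem_setE in_itv/= -natrM mulnb.
exact: (cvgM (H (x - a)) (H (b - x))).
Qed.

End smooth_line.

Section test_functions.
Context {R : realType}.
Implicit Types (psi phi : R * R -> R) (e x z : R * R) (B t : R).

Lemma adde1E x t : x + t *: e1 = (x.1 + t, x.2).
Proof. by case: x => a b; congr pair; rewrite /= /GRing.scale/= ?mulr1 ?mulr0 ?addr0. Qed.

Lemma adde2E x t : x + t *: e2 = (x.1, x.2 + t).
Proof. by case: x => a b; congr pair; rewrite /= /GRing.scale/= ?mulr1 ?mulr0 ?addr0. Qed.

Opaque e1 e2.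

Lemma derive_lineE e psi x t :
  (fun h : R => h^-1 *: ((psi \o shift (x + t *: e)) (h *: e) - psi (x + t *: e))) =
  (fun h : R => h^-1 *: (((fun s : R => psi (x + s *: e)) \o shift t) (h *: 1) - psi (x + t *: e))).
Proof.
apply/funext => h /=; congr (_ *: (psi _ - _)).
by rewrite /shift/= [h *: 1]mulr1 scalerDl addrCA.
Qed.

(** Restriction to a line gives access to the one-variable chain rule and mean value theorem. *)
Lemma is_derive_lineP e psi x t d :
  is_derive (x + t *: e) e psi d <-> is_derive t 1 (fun s : R => psi (x + s *: e)) d.
Proof.
by split=> -[h1 h2]; split; move: h1 h2; rewrite /derivable /derive derive_lineE.
Qed.

Lemma is_derive_line0 e psi x d :
  is_derive x e psi d <-> is_derive (0 : R) 1 (fun s : R => psi (x + s *: e)) d.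
Proof. by rewrite -is_derive_lineP scale0r addr0. Qed.

Lemma Cn0P psi : Cn 0 psi <-> continuous psi.
Proof. by split => [[]|]. Qed.

Lemma CnSP n psi : Cn n.+1 psi <-> [/\ continuous psi,
  forall x, derivable psi x e1, forall x, derivable psi x e2,
  Cn n ('D_e1 psi) & Cn n ('D_e2 psi)].
Proof.
split=> [[c [d1 d2 C1 C2]]|[c d1 d2 C1 C2]]; first exact: (And5 c d1 d2 C1 C2).
exact: (conj c (And4 d1 d2 C1 C2)).
Qed.

Lemma Cn_continuous n psi : Cn n psi -> continuous psi.
Proof. by case: n => [|n] []. Qed.

Lemma derive_add e psi phi : (forall x, derivable psi x e) -> (forall x, derivable phi x e) ->
  'D_e (fun x => psi x + phi x) = (fun x => 'D_e psi x + 'D_e phi x).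
Proof. by move=> h1 h2; apply/funext => x; have := @deriveD _ _ _ psi phi x e (h1 x) (h2 x). Qed.

Lemma derive_scale e (c : R) psi : (forall x, derivable psi x e) ->
  'D_e (fun x => c * psi x) = (fun x => c * 'D_e psi x).
Proof. by move=> h; apply/funext => x; have := @deriveZ _ _ _ psi c x e (h x). Qed.

Lemma CnD n psi phi : Cn n psi -> Cn n phi -> Cn n (fun x => psi x + phi x).
Proof.
elim: n psi phi => [|n ih] psi phi.
  by move=> /Cn0P c /Cn0P c'; apply/Cn0P => x; apply: cvgD; [exact: c|exact: c'].
move=> /CnSP[c d1 d2 C1 C2] /CnSP[c' d1' d2' C1' C2']; apply/CnSP; split.
- by move=> x; apply: cvgD; [exact: c|exact: c'].
- by move=> x; apply: (@derivableD _ _ _ psi phi).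
- by move=> x; apply: (@derivableD _ _ _ psi phi).
- by rewrite derive_add; [exact: (ih _ _ C1 C1')|..].
- by rewrite derive_add; [exact: (ih _ _ C2 C2')|..].
Qed.

Lemma CnZ n (a : R) psi : Cn n psi -> Cn n (fun x => a * psi x).
Proof.
elim: n psi => [|n ih] psi.
  by move=> /Cn0P c; apply/Cn0P => x; apply: cvgM; [exact: cvg_cst|exact: c].
move=> /CnSP[c d1 d2 C1 C2]; apply/CnSP; split.
- by move=> x; apply: cvgM; [exact: cvg_cst|exact: c].
- by move=> x; apply: (@derivableZ _ _ _ psi a).
- by move=> x; apply: (@derivableZ _ _ _ psi a).
- by rewrite derive_scale; [exact: (ih _ C1)|..].
- by rewrite derive_scale; [exact: (ih _ C2)|..].
Qed.

Lemma derive_shift_lineE psi e z x :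
  (fun h : R => h^-1 *: (((fun x => psi (x + z)) \o shift x) (h *: e) - psi (x + z))) =
  (fun h : R => h^-1 *: ((psi \o shift (x + z)) (h *: e) - psi (x + z))).
Proof. by apply/funext => h /=; rewrite /shift/= addrA. Qed.

Lemma derivable_shift psi e z x :
  derivable psi (x + z) e -> derivable (fun x => psi (x + z)) x e.
Proof. by rewrite /derivable derive_shift_lineE. Qed.

Lemma derive_shiftE psi e z :
  'D_e (fun x => psi (x + z)) = (fun x => 'D_e psi (x + z)).
Proof. by apply/funext => x; rewrite /derive derive_shift_lineE. Qed.

Lemma continuous_shift psi z : continuous psi -> continuous (fun x => psi (x + z)).
Proof.
move=> c x; apply: (@continuous_comp _ _ _ (fun x => x + z) psi); last exact: c.
by apply: cvgD; [exact: cvg_id|exact: cvg_cst].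
Qed.

Lemma Cn_shift n psi z : Cn n psi -> Cn n (fun x => psi (x + z)).
Proof.
elim: n psi => [|n ih] psi; first by move=> /Cn0P c; apply/Cn0P; exact: continuous_shift.
move=> /CnSP[c d1 d2 C1 C2]; apply/CnSP; split; first exact: continuous_shift.
- by move=> x; exact: derivable_shift.
- by move=> x; exact: derivable_shift.
- by rewrite derive_shiftE; exact: (ih _ C1).
- by rewrite derive_shiftE; exact: (ih _ C2).
Qed.

Lemma is_derive_tensor1 (a a' b : R -> R) x : is_derive x.1 1 a (a' x.1) ->
  is_derive x e1 (fun y => a y.1 * b y.2) (a' x.1 * b x.2).
Proof.
move=> h; apply/is_derive_line0.
rewrite (_ : (fun s : R => _) = (fun s => b x.2 * a (1 * s + x.1))); last first.
  apply/funext => s; by rewrite adde1E/= mul1r mulrC addrC.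
have ha : is_derive (0 : R) 1 (fun s : R => a (1 * s + x.1)) (a' x.1).
  rewrite -[a' x.1]mulr1; apply: (@is_derive1_comp _ a (fun s => 1 * s + x.1)).
    by rewrite mulr0 add0r.
  have := is_deriveD (is_deriveM (is_derive_cst (1 : R) (0 : R) 1) (is_derive_id (0 : R) 1)) (is_derive_cst x.1 (0 : R) 1).
  by rewrite /= scaler0 !addr0 [1 *: 1]mulr1.
by have := is_deriveZ (b x.2) ha; rewrite /GRing.scale/= mulrC.
Qed.

Lemma is_derive_tensor2 (a b b' : R -> R) x : is_derive x.2 1 b (b' x.2) ->
  is_derive x e2 (fun y => a y.1 * b y.2) (a x.1 * b' x.2).
Proof.
move=> h; apply/is_derive_line0.
rewrite (_ : (fun s : R => _) = (fun s => a x.1 * b (1 * s + x.2))); last first.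
  apply/funext => s; by rewrite adde2E/= mul1r addrC.
have hb : is_derive (0 : R) 1 (fun s : R => b (1 * s + x.2)) (b' x.2).
  rewrite -[b' x.2]mulr1; apply: (@is_derive1_comp _ b (fun s => 1 * s + x.2)).
    by rewrite mulr0 add0r.
  have := is_deriveD (is_deriveM (is_derive_cst (1 : R) (0 : R) 1) (is_derive_id (0 : R) 1)) (is_derive_cst x.2 (0 : R) 1).
  by rewrite /= scaler0 !addr0 [1 *: 1]mulr1.
by have := is_deriveZ (a x.1) hb.
Qed.

Lemma continuous_tensor (a b : R -> R) : continuous a -> continuous b ->
  continuous (fun x : R * R => a x.1 * b x.2).
Proof.
move=> ca cb x; apply: cvgM.
- by apply: (@continuous_comp _ _ _ (fst : R * R -> R) a); [exact: cvg_fst|exact: ca].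
- by apply: (@continuous_comp _ _ _ (snd : R * R -> R) b); [exact: cvg_snd|exact: cb].
Qed.

Lemma Cn_tensor n (a b : R -> R) : Dn n a -> Dn n b -> Cn n (fun x => a x.1 * b x.2).
Proof.
elim: n a b => [|n ih] a b.
  by move=> ca cb; apply/Cn0P; exact: continuous_tensor.
move=> aS bS; have cab := continuous_tensor (Dn_continuous aS) (Dn_continuous bS).
have [a' da an] := aS; have [b' db bn] := bS.
have D1 x := is_derive_tensor1 b (da x.1).
have D2 x := is_derive_tensor2 a (db x.2).
apply/CnSP; split.
- exact: cab.
- by move=> x; have [] := D1 x.
- by move=> x; have [] := D2 x.
- rewrite (_ : 'D_e1 _ = fun x => a' x.1 * b x.2); first by apply: ih => //; exact: DnS.
  by apply/funext => x; have [] := D1 x.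
- rewrite (_ : 'D_e2 _ = fun x => a x.1 * b' x.2); first by apply: ih => //; exact: DnS.
  by apply/funext => x; have [] := D2 x.
Qed.

Definition supported_in B psi := forall x, psi x != 0 -> `|x.1| <= B /\ `|x.2| <= B.

Lemma closure_supported_in B psi : supported_in B psi ->
  closure [set x | psi x != 0] `<=` `[- B, B]%classic `*` `[- B, B]%classic.
Proof.
move=> sB; have cl : closed (`[- B, B]%classic `*` `[- B, B]%classic : set (R * R)).
  apply: compact_closed; first exact: norm_hausdorff.
  by apply: compact_setX; exact: segment_compact.
rewrite [X in _ `<=` X]((closure_id _).1 cl).
apply: closure_subset => x /= /sB[]; rewrite !ler_norml => h1 h2.
by split; rewrite /= in_itv.
Qed.

(** Compactness of the support is traded for a centred square containing it, which is easier to
    carry through sums, shifts and tensor products. *)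
Lemma test_functionP psi : test_function psi <->
  (forall n, Cn n psi) /\ exists B, supported_in B psi.
Proof.
split=> -[Cp]; last first.
  move=> [B sB]; split => //.
  apply: (subclosed_compact _ _ (closure_supported_in sB)); first exact: closed_closure.
  by apply: compact_setX; exact: segment_compact.
move=> cpt; split => //.
have [M [Mr hM]] := compact_bounded cpt.
exists (M + 1) => x x0.
have := hM (M + 1) _ x (@subset_closure _ [set x | psi x != 0] x x0); rewrite ltrDl ltr01 => /(_ erefl).
by rewrite /= [`|x|]ProdNormedZmodule.prod_normE ge_max => /andP[].
Qed.

Lemma test_continuous psi : test_function psi -> continuous psi.
Proof. by move=> [/(_ 0%N)/Cn_continuous]. Qed.

Lemma test_derivable1 psi x : test_function psi -> derivable psi x e1.
Proof. by move=> [/(_ 1%N)/CnSP[]]. Qed.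

Lemma test_derivable2 psi x : test_function psi -> derivable psi x e2.
Proof. by move=> [/(_ 1%N)/CnSP[]]. Qed.

Lemma supported_in_derive B e psi : supported_in B psi -> supported_in B ('D_e psi).
Proof.
move=> sB x Dx; suff : closure [set x | psi x != 0] x.
  move=> /(closure_supported_in sB) [/=]; rewrite !in_itv/= => h1 h2.
  by rewrite !ler_norml.
apply: contrapT => nx; move/negP: Dx; apply.
have h : \forall y \near x, psi y = 0.
  have : (~` closure [set x | psi x != 0]) x by [].
  rewrite -interiorC => hx; near=> y.
  apply: contrapT => /eqP y0.
  by have : (~` [set x | psi x != 0]) y by near: y; exact: hx.
by rewrite (near_eq_derive e h) derive_cst.
Unshelve. all: by end_near. Qed.

Lemma test_D1 psi : test_function psi -> test_function ('D_e1 psi).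
Proof.
move=> /test_functionP[C [B sB]]; apply/test_functionP; split.
  by move=> n; have /CnSP[] := C n.+1.
by exists B; exact: supported_in_derive.
Qed.

Lemma test_D2 psi : test_function psi -> test_function ('D_e2 psi).
Proof.
move=> /test_functionP[C [B sB]]; apply/test_functionP; split.
  by move=> n; have /CnSP[] := C n.+1.
by exists B; exact: supported_in_derive.
Qed.

Lemma test_add psi phi : test_function psi -> test_function phi ->
  test_function (fun x => psi x + phi x).
Proof.
move=> /test_functionP[C [B sB]] /test_functionP[C' [B' sB']]; apply/test_functionP; split.
  by move=> n; exact: CnD.
exists (Num.max B B') => x; have [p0|p0] := eqVneq (psi x) 0.
  rewrite p0 add0r => /sB'[]; rewrite !le_max => -> ->.
  by rewrite !orbT.
by move: p0 => /sB[]; rewrite !le_max => -> ->.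
Qed.

Lemma test_scale (a : R) psi : test_function psi -> test_function (fun x => a * psi x).
Proof.
move=> /test_functionP[C [B sB]]; apply/test_functionP; split.
  by move=> n; exact: CnZ.
by exists B => x; rewrite mulf_eq0 negb_or => /andP[_ /sB].
Qed.

Lemma test0 : test_function (fun=> 0 : R).
Proof.
apply/test_functionP; split; last by exists 0 => x; rewrite eqxx.
move=> n; have := @Cn_tensor n (fun=> 0) (fun=> 0) (Dn_cst _ _) (Dn_cst _ _).
by under eq_fun do rewrite mulr0.
Qed.

Lemma test_shift psi z : test_function psi -> test_function (fun x => psi (x + z)).
Proof.
move=> /test_functionP[C [B sB]]; apply/test_functionP; split.
  by move=> n; exact: Cn_shift.
exists (B + (`|z.1| + `|z.2|)) => x /sB[/= h1 h2]; split.
- rewrite -[x.1](addrK z.1) (le_trans (ler_normB _ _))// lerD// lerDl//.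
- rewrite -[x.2](addrK z.2) (le_trans (ler_normB _ _))// lerD// lerDr//.
Qed.

Lemma test_tensor (a b : R -> R) B : (forall n, Dn n a) -> (forall n, Dn n b) ->
  (forall s, a s != 0 -> `|s| <= B) -> (forall s, b s != 0 -> `|s| <= B) ->
  test_function (fun x => a x.1 * b x.2).
Proof.
move=> Ca Cb sa sb; apply/test_functionP; split; first by move=> n; exact: Cn_tensor.
by exists B => x; rewrite mulf_eq0 negb_or => /andP[/sa ? /sb].
Qed.

Lemma test_bounded psi : test_function psi -> exists2 M, 0 <= M & forall x, `|psi x| <= M.
Proof.
move=> tpsi; have /test_functionP[C [B sB]] := tpsi.
have [M [Mr hM]] := compact_bounded (continuous_compact
  (continuous_subspaceT (test_continuous tpsi))
  (compact_setX (@segment_compact R (- B) B) (@segment_compact R (- B) B))).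
exists (Num.max 0 (M + 1)) => [|x]; first by rewrite le_max lexx.
have [->|p0] := eqVneq (psi x) 0; first by rewrite normr0 le_max lexx.
rewrite le_max; apply/orP; right; apply: (hM (M + 1)); first by rewrite ltrDl.
exists x => //; have [h1 h2] := sB x p0.
by split; rewrite /= in_itv/= -ler_norml.
Qed.

End test_functions.

(** * Lebesgue measure on the plane *)

Opaque e1 e2.

Section plane_measure.
Context {R : realType}.
Local Notation mu := (mu2 R).
Local Notation leb := (@lebesgue_measure R).
Implicit Types (f g : plane R -> R) (psi : R * R -> R) (z : R * R).

Definition obox (a b c d : R) : set (plane R) := `]a, b[%classic `*` `]c, d[%classic.

Lemma measurable_obox a b c d : measurable (obox a b c d).
Proof. by apply: measurableX; exact: measurable_itv. Qed.

(** Connects the topology of the plane with the product sigma-algebra: an open set is the countable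
    union of the rational boxes it contains, the other boxes being replaced by the empty set. *)
Lemma open_plane_measurable (U : set (R * R)) : open U -> measurable (U : set (plane R)).
Proof.
move=> oU.
pose F (a b c d : rat) : set (plane R) :=
  if `[< obox (ratr a) (ratr b) (ratr c) (ratr d) `<=` U >]
  then obox (ratr a) (ratr b) (ratr c) (ratr d) else set0.
have -> : (U : set (plane R)) = \bigcup_a \bigcup_b \bigcup_c \bigcup_d F a b c d.
  apply/seteqP; split => [[x y] Uxy|[x y] [a _ [b _ [c _ [d _]]]]]; last first.
    by rewrite /F; case: ifPn => // /asboolP; apply.
  have /nbhs_ballP[e /= e0 xyU] : nbhs (x, y) U by exact: open_nbhs_nbhs.
  have rat_around (t : R) : exists p : rat * rat,
      [/\ t - e < ratr p.1, ratr p.1 < t, t < ratr p.2 & ratr p.2 < t + e].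
    have [|a /[!in_itv]/= /andP[a1 a2]] := @rat_in_itvoo R (t - e) t; first lra.
    have [|b /[!in_itv]/= /andP[b1 b2]] := @rat_in_itvoo R t (t + e); first lra.
    by exists (a, b).
  have [[a b]/= [a1 a2 b1 b2]] := rat_around x.
  have [[c d]/= [c1 c2 d1 d2]] := rat_around y.
  exists a => //; exists b => //; exists c => //; exists d => //.
  rewrite /F ifT; first by split; rewrite /= in_itv/= ?a2 ?b1 ?c2 ?d1.
  apply/asboolP => -[x' y'] [/=]; rewrite !in_itv/= => /andP[h1 h2] /andP[h3 h4].
  by apply: xyU; split; rewrite /ball/= ltr_norml; apply/andP; split; lra.
rewrite /F; do 4 (apply: bigcupT_measurable_rat => ?).
by case: ifPn => // _; exact: measurable_obox.
Qed.

Lemma continuous_measurable_plane psi : continuous psi ->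
  measurable_fun setT (psi : plane R -> R).
Proof.
move=> /continuousP cp; apply: (measurability _ (RGenOpens.measurableE R)).
move=> _ [_ [a [b ->]] <-]; rewrite setTI; apply: open_plane_measurable.
exact/cp/interval_open.
Qed.

(** Bounded boxes are used because the measures compared in [fundamental_lemma] are only known to be
    finite on them; strips are recovered as countable unions. *)
Lemma obox_generates (A : set (plane R)) : measurable A ->
  <<s [set X | exists a b c d, X = obox a b c d] >> A.
Proof.
set G := [set X | _].
have Gx n (a b : R) : <<s G >> (`]a, b[%classic `*` `]- n%:R, n%:R[%classic).
  by apply: sub_sigma_algebra; exists a, b, (- n%:R), n%:R.
have Gy n (a b : R) : <<s G >> (`]- n%:R, n%:R[%classic `*` `]a, b[%classic).
  by apply: sub_sigma_algebra; exists (- n%:R), n%:R, a, b.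
have cov : \bigcup_(n : nat) (`]- n%:R, n%:R[%classic : set R) = setT.
  apply/seteqP; split => // x _; exists (Num.truncn `|x|).+1 => //=.
  by rewrite in_itv/= -ltr_norml truncnS_gt.
have m1 : measurable_fun [set: g_sigma_algebraType G] (fst : _ -> R).
  apply: (measurability _ (RGenOpens.measurableE R)).
  move=> _ [_ [a [b ->]] <-]; rewrite setTI.
  have -> : fst @^-1` `]a, b[%classic =
      \bigcup_n (`]a, b[%classic `*` `]- n%:R, n%:R[%classic) :> set (R * R).
    rewrite -setX_bigcupr cov; apply/seteqP; split => x //=; tauto.
  by apply: bigcupT_measurable => n; exact: Gx.
have m2 : measurable_fun [set: g_sigma_algebraType G] (snd : _ -> R).
  apply: (measurability _ (RGenOpens.measurableE R)).
  move=> _ [_ [a [b ->]] <-]; rewrite setTI.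
  have -> : snd @^-1` `]a, b[%classic =
      \bigcup_n (`]- n%:R, n%:R[%classic `*` `]a, b[%classic) :> set (R * R).
    rewrite -setX_bigcupl cov; apply/seteqP; split => x //=; tauto.
  by apply: bigcupT_measurable => n; exact: Gy.
apply: smallest_sub; first exact: smallest_sigma_algebra.
move=> X [|] [B mB <-].
- exact: m1.
- exact: m2.
Qed.

End plane_measure.

(** * Measures given by a density *)

Section density.
Context d (T : measurableType d) (R : realType) (mu : {measure set T -> \bar R}).
Context (f : T -> \bar R) (mf : measurable_fun setT f) (f0 : forall x, (0 <= f x)%E).

(** Packaged below as a measure, so that uniqueness on a generating family applies to integrals over
    sets. *)
Definition density (A : set T) : \bar R := \int[mu]_(x in A) f x.

Let density0 : density set0 = 0%E.
Proof. by rewrite /density integral_set0. Qed.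

Let density_ge0 A : (0 <= density A)%E.
Proof. exact: integral_ge0. Qed.

Let density_sigma_additive : semi_sigma_additive density.
Proof.
move=> F mF tF mUF; rewrite /density ge0_integral_bigcup//.
  by apply: is_cvg_nneseries => n _ _; exact: integral_ge0.
exact: measurable_funS mf.
Qed.

HB.instance Definition _ := isMeasure.Build _ _ _ density
  density0 density_ge0 density_sigma_additive.

Definition density_measure : {measure set T -> \bar R} := density.

End density.

(** * Translation invariance of the plane measure *)

Section translation.
Context {R : realType}.
Local Notation mu := (mu2 R).
Local Notation leb := (@lebesgue_measure R).

Lemma measurable_addr (c : R) : measurable_fun setT (fun x : measurableTypeR R => (x + c : measurableTypeR R)).
Proof. by apply: measurable_funD. Qed.

Lemma lebesgue_measure_shift (c : R) (A : set (measurableTypeR R)) : measurable A ->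
  leb ((fun x : measurableTypeR R => (x + c : measurableTypeR R)) @^-1` A) = leb A.
Proof.
move=> mA; apply/esym.
have := @lebesgue_measure_unique R (measure_function_pushforward__canonical__measure_function_Measure leb (measurable_addr c)) _ A mA.
apply => X /ocitvP[->|[[a b] /= ab ->]]; first by rewrite !measure0.
rewrite /= /pushforward.
rewrite (_ : _ @^-1` _ = `]a - c, b - c]%classic); last first.
  by apply/seteqP; split => x /=; rewrite !in_itv/= ltrBlDr lerBrDr.
by rewrite !lebesgue_measure_itv/= !lte_fin ltrD2r ab -!EFinB; congr EFin; ring.
Qed.

Definition shiftp (z : R * R) (x : plane R) : plane R := (x.1 + z.1, x.2 + z.2).

Lemma measurable_shift (z : R * R) : measurable_fun setT (shiftp z).
Proof.
apply/measurable_fun_pairP; split => /=.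
- by apply: (measurableT_comp (measurable_addr z.1)); exact: measurable_fst.
- by apply: (measurableT_comp (measurable_addr z.2)); exact: measurable_snd.
Qed.

(** The pushforward by a shift agrees with the product measure on rectangles, by invariance on each
    factor; uniqueness of the product measure concludes. *)
Lemma mu2_shift (z : R * R) (A : set (plane R)) : measurable A ->
  mu (shiftp z @^-1` A) = mu A.
Proof.
move=> mA; apply/esym.
apply: (@product_measure_unique _ _ _ _ R leb leb (measure_function_pushforward__canonical__measure_function_Measure mu (measurable_shift z))) => // X Y mX mY.
rewrite /= /pushforward.
rewrite (_ : _ @^-1` _ = ((fun x : measurableTypeR R => (x + z.1 : measurableTypeR R)) @^-1` X) `*` ((fun x : measurableTypeR R => (x + z.2 : measurableTypeR R)) @^-1` Y))//.
pose A1 : set (measurableTypeR R) := (fun x : measurableTypeR R => (x + z.1 : measurableTypeR R)) @^-1` X.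
pose A2 : set (measurableTypeR R) := (fun x : measurableTypeR R => (x + z.2 : measurableTypeR R)) @^-1` Y.
transitivity (leb A1 * leb A2)%E; last by congr (_ * _)%E; exact: lebesgue_measure_shift.
apply: product_measure1E.
- by have := measurable_addr z.1 measurableT mX; rewrite setTI.
- by have := measurable_addr z.2 measurableT mY; rewrite setTI.
Qed.

Definition shiftf (z : R * R) (f : plane R -> R) : plane R -> R :=
  fun x => f (shiftp z x).

Lemma measurable_shiftf z f : measurable_fun setT f -> measurable_fun setT (shiftf z f).
Proof. by move=> mf; exact: (measurableT_comp mf (measurable_shift z)). Qed.

Lemma ge0_integral_shift (z : R * R) (f : plane R -> \bar R) : measurable_fun setT f ->
  (forall x, 0 <= f x)%E ->
  (\int[mu]_x f (shiftp z x) = \int[mu]_x f x)%E.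
Proof.
move=> mf f0.
have := ge0_integral_pushforward (measurable_shift z) mu measurableT mf (in1W f0).
rewrite preimage_setT => <-.
apply: eq_measure_integral; first exact: measurable_shift.
by move=> mS A mA _; exact: mu2_shift.
Qed.

Lemma L2_shift z f : L2 mu f -> L2 mu (shiftf z f).
Proof.
move=> [mf f2]; split; first exact: measurable_shiftf.
apply/integrableP; split.
  by apply/measurable_EFinP; apply: measurable_funX; exact: measurable_shiftf.
case/integrableP : f2 => mf2; rewrite -(ge0_integral_shift z)//.
by apply: measurableT_comp.
Qed.

Lemma Rintegral_shift z f : measurable_fun setT f -> mu.-integrable setT (EFin \o f) ->
  \int[mu]_x shiftf z f x = \int[mu]_x f x.
Proof.
move=> mf intf; rewrite /Rintegral; congr fine.
rewrite [LHS]integralE [RHS]integralE; congr (_ - _)%E.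
- rewrite -[RHS](ge0_integral_shift z)//; first by apply: eq_integral => x _; rewrite !(funeposE, funenegE).
  by apply: measurable_funepos; exact/measurable_EFinP.
- rewrite -[RHS](ge0_integral_shift z)//; first by apply: eq_integral => x _; rewrite !(funeposE, funenegE).
  by apply: measurable_funeneg; exact/measurable_EFinP.
Qed.

Lemma ip_shift z f g : L2 mu f -> L2 mu g -> ip mu (shiftf z f) (shiftf z g) = ip mu f g.
Proof.
move=> Lf Lg; apply: (@Rintegral_shift z (fun x => f x * g x)).
  by case: Lf Lg => [mf _] [mg _]; exact: measurable_funM.
exact: L2_integrableM.
Qed.

End translation.

(** * Fundamental lemma of the calculus of variations *)

Section fundamental_lemma.
Context {R : realType}.
Local Notation mu := (mu2 R).
Implicit Types (f g : plane R -> R) (psi : R * R -> R) (z : R * R).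

Lemma mu2_obox (a b c d : R) : (mu (obox a b c d) < +oo)%E.
Proof.
have fin (x y : R) : lebesgue_measure (`]x, y[%classic : set R) \is a fin_num.
  by rewrite lebesgue_measure_itv/=; case: ifP => _; rewrite ?fin_num0 -?EFinB.
have -> : mu (obox a b c d) = (lebesgue_measure (`]a, b[%classic : set R) *
    lebesgue_measure (`]c, d[%classic : set R))%E.
  by apply: product_measure1E; exact: measurable_itv.
by rewrite ltey_eq fin_numM.
Qed.

Lemma integrable_indic_box (a b c d : R) :
  mu.-integrable setT (EFin \o \1_(obox a b c d)).
Proof.
have mD := measurable_obox a b c d; apply/integrableP; split.
  by apply/measurable_EFinP; exact: measurable_indic.
under eq_integral do rewrite /= ger0_norm//.
by rewrite integral_indic// setIT mu2_obox.
Qed.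

Lemma supported_L2 psi B M : measurable_fun setT (psi : plane R -> R) ->
  supported_in B psi -> (forall x, `|psi x| <= M) -> L2 mu psi.
Proof.
move=> mpsi sB bM; split => //.
pose D : set (plane R) := obox (- B - 1) (B + 1) (- B - 1) (B + 1).
have mD : measurable D := measurable_obox _ _ _ _.
have M0 : 0 <= M := le_trans (normr_ge0 _) (bM (0, 0)).
apply: (@le_integrable _ _ _ mu setT measurableT _ (fun x => (M ^+ 2 * \1_D x)%:E)).
- by apply/measurable_EFinP; exact: measurable_funX.
- move=> x _ /=; rewrite lee_fin [leRHS]ger0_norm ?mulr_ge0 ?sqr_ge0// normrX.
  have [->|p0] := eqVneq (psi x) 0; first by rewrite normr0 expr0n/= mulr_ge0 ?sqr_ge0.
  have [] := sB x p0; rewrite !ler_norml => /andP[h1 h2] /andP[h3 h4].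
  rewrite indicE mem_set ?mulr1; last by split; rewrite /= in_itv/=; apply/andP; split; lra.
  by rewrite lerXn2r ?nnegrE.
- exact: (integrableZl measurableT (M ^+ 2) (integrable_indic_box _ _ _ _)).
Qed.

Lemma test_measurable psi : test_function psi -> measurable_fun setT (psi : plane R -> R).
Proof. by move=> /test_continuous; exact: continuous_measurable_plane. Qed.

Lemma test_L2 psi : test_function psi -> L2 mu psi.
Proof.
move=> tp; have /test_functionP[_ [B sB]] := tp; have [M _ bM] := test_bounded tp.
exact: supported_L2 (test_measurable tp) sB bM.
Qed.

Lemma test_smooth_box (a b c d : R) (n : nat) :
  test_function (fun x : R * R => smooth_indic a b n.+1%:R x.1 * smooth_indic c d n.+1%:R x.2).
Proof.
have n0 : (0 : R) < n.+1%:R by [].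
apply: (@test_tensor _ _ _ (`|a| + `|b| + `|c| + `|d|)) => [m|m|s|s]; try exact: Dn_smooth_indic.
- move=> /(smooth_indic_neq0 n0)/andP[h1 h2]; rewrite ler_norml.
  have := ler_norm a; have := ler_normr (- a) 0.
  have := ler_norm (- a); have := ler_norm b; have := ler_norm (- b); rewrite !normrN.
  have := normr_ge0 c; have := normr_ge0 d => *; apply/andP; split; lra.
- move=> /(smooth_indic_neq0 n0)/andP[h1 h2]; rewrite ler_norml.
  have := ler_norm c; have := ler_norm (- c); have := ler_norm d; have := ler_norm (- d); rewrite !normrN.
  have := normr_ge0 a; have := normr_ge0 b => *; apply/andP; split; lra.
Qed.

Lemma L2_integrable_box g (a b c d : R) : L2 mu g -> mu.-integrable (obox a b c d) (EFin \o g).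
Proof.
move=> Lg; have mD := measurable_obox a b c d.
have LI : L2 mu \1_(obox a b c d).
  split; first exact: measurable_indic.
  have := integrable_indic_box a b c d.
  apply: eq_integrable => // x _ /=.
  by rewrite indicE; case: (_ \in _); rewrite ?expr1n ?expr0n.
apply/(integrable_mkcond _ mD).
have := L2_integrableM Lg LI; apply: eq_integrable => // x _ /=.
rewrite patchE indicE; case: ifPn => /=; rewrite ?mulr1 ?mulr0//.
Qed.

(** Products of [smooth_indic] are test functions that converge to the indicator of the open box,
    and |g| on the box dominates. *)
Lemma Rintegral_box_eq0 g (a b c d : R) : L2 mu g ->
  (forall psi, test_function psi -> ip mu g psi = 0) ->
  (\int[mu]_(x in obox a b c d) (g x)%:E = 0)%E.
Proof.
move=> Lg gt0; have mD := measurable_obox a b c d.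
have intg := L2_integrable_box a b c d Lg.
have mg : measurable_fun setT g by case: Lg.
pose t n (x : plane R) : R := smooth_indic a b n.+1%:R x.1 * smooth_indic c d n.+1%:R x.2.
have tt n : test_function (t n) := test_smooth_box a b c d n.
pose h n (x : plane R) := (g x * t n x)%:E.
have hc x : (fun n => h n x) @ \oo --> ((EFin \o g) \_ (obox a b c d)) x.
  have tc : (fun n => t n x) @ \oo --> (\1_(obox a b c d) x : R).
    have -> : (\1_(obox a b c d) x : R) = \1_`]a, b[%classic x.1 * \1_`]c, d[%classic x.2.
      by rewrite !indicE -natrM mulnb; congr (_%:R); rewrite /obox in_setX.
    apply: cvgM.
      by have := @cvg_smooth_indic _ a b x.1; rewrite -cvg_shiftS.
    by have := @cvg_smooth_indic _ c d x.2; rewrite -cvg_shiftS.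
  have -> : ((EFin \o g) \_ (obox a b c d)) x = (g x * \1_(obox a b c d) x)%:E.
    by rewrite patchE indicE; case: ifPn => _ /=; rewrite ?mulr1 ?mulr0.
  by apply: cvg_EFin; [exact: nearW|apply: cvgM => //; exact: cvg_cst].
have mh n : measurable_fun setT (h n).
  by apply/measurable_EFinP; apply: measurable_funM => //; exact: test_measurable.
have mr : measurable_fun setT ((EFin \o g) \_ (obox a b c d)).
  by apply/(measurable_restrictT _ mD); apply: measurable_funTS; exact/measurable_EFinP.
have ir : mu.-integrable setT (abse \o ((EFin \o g) \_ (obox a b c d))).
  by apply: integrable_abse; exact/(integrable_mkcond _ mD).
have dom : {ae mu, forall x n, setT x ->
    (`|h n x| <= (abse \o ((EFin \o g) \_ (obox a b c d))) x)%E}.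
  apply: aeW => x n _ /=; rewrite /h patchE; case: ifPn => xD /=.
    have t0 : 0 <= t n x by rewrite mulr_ge0 ?smooth_indic_ge0.
    rewrite lee_fin normrM ler_piMr// (ger0_norm t0).
    by rewrite -[leRHS]mulr1 ler_pM ?smooth_indic_ge0 ?smooth_indic_le1.
  rewrite lee_fin normr0 (_ : t n x = 0) ?mulr0 ?normr0//.
  apply/eqP; move: xD; apply: contraNT; rewrite mulf_eq0 negb_or => /andP[h1 h2].
  rewrite inE; split; rewrite /= in_itv/=.
    by apply: smooth_indic_neq0 h1.
  by apply: smooth_indic_neq0 h2.
have [_ _] := dominated_convergence measurableT mh mr (aeW _ (fun x _ => hc x)) ir dom.
rewrite -integral_mkcond => hlim.
have h0 n : (\int[mu]_x h n x = 0)%E.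
  have := gt0 _ (tt n); rewrite /ip /Rintegral => e0.
  have := L2_integrableM Lg (test_L2 (tt n)) => /(integrable_fin_num measurableT) fin.
  by rewrite -[LHS]fineK// e0.
suff : (\int[mu]_(x in obox a b c d) (EFin \o g) x)%E = 0%E by [].
rewrite -(cvg_lim (@ereal_hausdorff R) hlim) (_ : [sequence _]_n = fun=> 0%E); first exact: lim_cst.
by apply/funext => n; exact: h0.
Qed.

(** The positive and negative parts of g are densities of two measures that agree on boxes, hence on
    all measurable sets; so the two parts coincide almost everywhere on each box of an
    exhaustion. *)
Lemma fundamental_lemma g : L2 mu g ->
  (forall psi, test_function psi -> ip mu g psi = 0) -> {ae mu, forall x, g x = 0}.
Proof.
move=> Lg gt0; have mg : measurable_fun setT g by case: Lg.
have mE : measurable_fun setT (EFin \o g) by exact/measurable_EFinP.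
pose gp := (EFin \o g)^\+%E; pose gn := (EFin \o g)^\-%E.
have mgp : measurable_fun setT gp by exact: measurable_funepos.
have mgn : measurable_fun setT gn by exact: measurable_funeneg.
have gp0 x : (0 <= gp x)%E by exact: funepos_ge0.
have gn0 x : (0 <= gn x)%E by exact: funeneg_ge0.
have boxE a b c d : (\int[mu]_(x in obox a b c d) gp x = \int[mu]_(x in obox a b c d) gn x)%E.
  have := Rintegral_box_eq0 a b c d Lg gt0.
  have intg := L2_integrable_box a b c d Lg.
  rewrite integralE => /eqP; rewrite sube_eq ?add0e; first by move=> /eqP.
    exact: (integrable_pos_fin_num (measurable_obox a b c d) intg).
  by rewrite fin_num_adde_defl//; exact: (integrable_neg_fin_num (measurable_obox a b c d) intg).
have boxfin a b c d : (\int[mu]_(x in obox a b c d) gp x < +oo)%E.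
  have intg := L2_integrable_box a b c d Lg.
  by rewrite ltey_eq (integrable_pos_fin_num (measurable_obox a b c d) intg).
have allE A : measurable A -> (density mu gp A = density mu gn A)%E.
  move=> mA.
  pose G := [set X : set (plane R) | exists a b c d, X = obox a b c d].
  apply: (@g_sigma_algebra_measure_unique _ R (plane R) G _ (fun k => obox (- k%:R) k%:R (- k%:R) k%:R) _ _
     (density_measure mu mgp gp0)
     (density_measure mu mgn gn0)) => //.
  - by move=> _ [a [b [c [d ->]]]]; exact: measurable_obox.
  - by move=> k; do 4 eexists.
  - apply/seteqP; split => // -[x y] _; exists (Num.truncn (`|x| + `|y|)).+1 => //.
    have h := truncnS_gt (`|x| + `|y|); split; rewrite /= in_itv/= -ltr_norml; apply: le_lt_trans h.
      by rewrite lerDl.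
    by rewrite lerDr.
  - move=> _ _ [a [b [c [d ->]]]] [a' [b' [c' [d' ->]]]].
    exists (Num.max a a'), (Num.min b b'), (Num.max c c'), (Num.min d d').
    rewrite /obox -setXI; congr (_ `*` _); apply/seteqP; split => x /=; rewrite !in_itv/= gt_max lt_min.
    + by move=> [/andP[-> ->] /andP[-> ->]].
    + by move=> /andP[/andP[-> ->] /andP[-> ->]].
    + by move=> [/andP[-> ->] /andP[-> ->]].
    + by move=> /andP[/andP[-> ->] /andP[-> ->]].
  - by move=> _ [a [b [c [d ->]]]]; exact: boxE.
  - by move=> k; exact: boxfin.
  - exact: obox_generates.
have aeN (k : nat) : {ae mu, forall x, obox (- k%:R) k%:R (- k%:R) k%:R x -> g x = 0}.
  have mD := @measurable_obox R (- k%:R) k%:R (- k%:R) k%:R.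
  have : ae_eq mu (obox (- k%:R) k%:R (- k%:R) k%:R) gp gn.
    apply: integral_ae_eq => //.
    - by apply: integrable_funepos => //; exact: L2_integrable_box.
    - exact: measurable_funTS.
    - by move=> E _ mE'; exact: allE.
  apply: filterS => x h /h; rewrite /gp /gn funeposE funenegE /=.
  rewrite -!EFin_max => -[]; have [g0|g0] := leP (g x) 0; have [g1|g1] := leP (- g x) 0; lra.
have := ae_foralln aeN; apply: filterS => x h.
apply: (h (Num.truncn (`|x.1| + `|x.2|)).+1).
have h' := truncnS_gt (`|x.1| + `|x.2|); split; rewrite /= in_itv/= -ltr_norml; apply: le_lt_trans h'.
  by rewrite lerDl.
by rewrite lerDr.
Qed.

End fundamental_lemma.

(** * Weak derivatives *)

Lemma ltr_dist_itv (R : realDomainType) (a t : R) : (`|t - a| < 1) = (t \in `]a - 1, a + 1[).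
Proof. by rewrite in_itv/= ltr_distl. Qed.

Lemma is_derive_integral d (T : measurableType d) (R : realType) (mu : {measure set T -> \bar R})
    (f df : R -> T -> R) (a : R) (G : T -> R) :
  (forall t, `|t - a| < 1 -> mu.-integrable setT (EFin \o f t)) ->
  (forall t x, `|t - a| < 1 -> is_derive t 1 (f^~ x) (df t x)) ->
  mu.-integrable setT (EFin \o G) ->
  (forall t x, `|t - a| < 1 -> `|df t x| <= G x) ->
  is_derive a 1 (fun t => \int[mu]_x f t x) (\int[mu]_x df a x).
Proof.
move=> intf derf intG domG.
have Ia : `]a - 1, a + 1[%classic a by rewrite /= -ltr_dist_itv subrr normr0.
have a1 : `|a - a| < 1 by rewrite subrr normr0.
have dfE t x : `|t - a| < 1 -> partial1of2 f t x = df t x.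
  by move=> ta; rewrite /partial1of2 derive1E; have [] := derf t x ta.
have i1 t : `]a - 1, a + 1[%classic t -> mu.-integrable setT (EFin \o f t).
  by rewrite /= -ltr_dist_itv; exact: intf.
have i2 t x : `]a - 1, a + 1[%classic t -> setT x -> derivable (f^~ x) t 1.
  by rewrite /= -ltr_dist_itv => ta _; have [] := derf t x ta.
have i3 x : 0 <= G x by apply: le_trans (domG a x a1).
have i4 t x : `]a - 1, a + 1[%classic t -> setT x -> `|partial1of2 f t x| <= G x.
  by rewrite /= -ltr_dist_itv => ta _; rewrite dfE//; exact: domG.
have D := differentiation_under_integral measurableT Ia i1 i2 i3 intG i4.
apply: DeriveDef.
  exact: (derivable_under_integral measurableT Ia i1 i2 i3 intG i4).
rewrite -derive1E D; apply: eq_Rintegral => x _; exact: dfE.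
Qed.

Lemma is_derive0_opp (R : realType) (F : R -> R) (d : R) :
  is_derive (0 : R) 1 F d -> is_derive (0 : R) 1 (fun t => F (- t)) (- d).
Proof.
move=> dF; rewrite -mulrN1; apply: (@is_derive1_comp _ F -%R); by rewrite oppr0.
Qed.

Section weak_derivatives.
Context {R : realType}.
Local Notation mu := (mu2 R).
Local Notation ip := (ip mu).
Local Notation L2 := (L2 mu).
Implicit Types (f g : plane R -> R) (psi phi : R * R -> R) (z e : R * R).

Definition axis e := e = e1 \/ e = e2.

Lemma axis_test e psi : axis e -> test_function psi -> test_function ('D_e psi).
Proof. by case=> ->; [exact: test_D1|exact: test_D2]. Qed.

Lemma axis_derivable e psi x : axis e -> test_function psi -> derivable psi x e.
Proof. by case=> -> ?; [exact: test_derivable1|exact: test_derivable2]. Qed.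

Lemma axis_dist e x (t : R) : axis e ->
  `|x.1| <= `|(x + t *: e).1| + `|t| /\ `|x.2| <= `|(x + t *: e).2| + `|t|.
Proof.
have H (a b : R) : `|a| <= `|a + b| + `|b|.
  by rewrite -[in leLHS](addrK b a) ler_normB.
by case=> ->; rewrite ?adde1E ?adde2E /=; split; rewrite ?H// lerDl.
Qed.

(** Differentiation under the integral: one box contains the supports of all translates with |t - a|
    < 1, and a multiple of |f| on that box dominates. *)
Lemma is_derive_ip_line e f psi (a : R) : axis e -> L2 f -> test_function psi ->
  is_derive a 1 (fun t : R => ip f (fun x : R * R => psi (x + t *: e)))
    (ip f (fun x : R * R => 'D_e psi (x + a *: e))).
Proof.
move=> ax Lf tp; have tD := axis_test ax tp.
have [M M0 bM] := test_bounded tD.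
have /test_functionP[_ [B sB]] := tD.
have mf : measurable_fun setT f by case: Lf.
pose C := B + `|a| + 2.
pose D : set (plane R) := obox (- C) C (- C) C.
apply: (@is_derive_integral _ _ _ mu (fun t x => f x * psi ((x : R * R) + t *: e))
  (fun t x => f x * 'D_e psi ((x : R * R) + t *: e)) a (fun x => M * `|f x| * \1_D x)).
- by move=> t _; apply: L2_integrableM => //; apply: test_L2; exact: test_shift.
- move=> t x _; rewrite /=.
  have h : is_derive (x + t *: e) e psi ('D_e psi (x + t *: e)).
    by apply: DeriveDef => //; exact: axis_derivable.
  by have := is_deriveZ (f x) ((is_derive_lineP e psi x t _).1 h).
- have mD : measurable D := measurable_obox _ _ _ _.
  have /(integrable_mkcond _ mD) := integrable_norm (L2_integrable_box (- C) C (- C) C Lf).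
  move=> /(integrableZl measurableT M); apply: eq_integrable => // x _.
  by rewrite /= patchE indicE; case: ifPn => _ /=; rewrite ?mulr1 ?mulr0 ?mule0 // -EFinM.
- move=> t x ta; rewrite normrM mulrC -mulrA.
  have [->|p0] := eqVneq ('D_e psi (x + t *: e)) 0.
    by rewrite normr0 mul0r !mulr_ge0.
  have [h1 h2] := sB _ p0; have [k1 k2] := axis_dist x t ax.
  have tb : `|t| < `|a| + 1.
    by rewrite -[t](subrK a) (le_lt_trans (ler_normD _ _))// addrC ltrD2l.
  rewrite indicE mem_set ?mulr1; first by rewrite ler_wpM2r.
  by rewrite /D /C; split; rewrite /= in_itv/= -ltr_norml; lra.
Qed.

Lemma is_derive_le_lipschitz (F : R -> R) (d K : R) : is_derive (0 : R) 1 F d ->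
  (forall t, `|F t - F 0| <= K * `|t|) -> `|d| <= K.
Proof.
move=> [cF dF] FK.
have := cF; rewrite /derivable => /cvg_norm.
rewrite -[lim _]/('D_1 F 0) dF => h.
apply: (cvgr_to_le h); near=> t.
have t0 : t != 0 by near: t; exact: nbhs_dnbhs_neq.
rewrite /= normrZ normfV ler_pdivrMl ?normr_gt0// mulrC.
by have := FK (t *: 1 + 0); rewrite addr0 [t *: 1]mulr1.
Unshelve. all: by end_near. Qed.

Definition wderiv e f g := forall psi, test_function psi ->
  ip f ('D_e psi) = - ip g psi.

Lemma ip_ae f g h : measurable_fun setT f -> measurable_fun setT g -> measurable_fun setT h ->
  {ae mu, forall x, f x = g x} -> ip f h = ip g h.
Proof.
move=> mf mg mh fg; rewrite !ipE /Rintegral; congr fine; apply: ae_eq_integral => //.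
- by apply/measurable_EFinP; exact: measurable_funM.
- by apply/measurable_EFinP; exact: measurable_funM.
- by apply: filterS fg => x fgx _; rewrite fgx.
Qed.

Lemma cvg_L2_ip (f_ : nat -> plane R -> R) f h : (forall n, L2 (f_ n)) -> L2 f -> L2 h ->
  (forall e : R, 0 < e -> exists N, forall n, (N <= n)%N ->
      ip (fun x => f_ n x - f x) (fun x => f_ n x - f x) <= e) ->
  (fun n => ip (f_ n) h) @ \oo --> ip f h.
Proof.
move=> Lf_ Lf Lh fc; apply/cvgrPdist_le => e e0.
have hp : 0 < ip h h + 1 by rewrite ltr_wpDl// ip_ge0.
have [N HN] := fc (e ^+ 2 / (ip h h + 1)) (divr_gt0 (exprn_gt0 2 e0) hp).
exists N => // n /= /HN; rewrite ler_pdivlMr// => h1.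
rewrite distrC -ipBl//; apply: norm_le_of_sqr_le (ltW e0) _.
apply: le_trans (cauchy_schwarz (L2B (Lf_ n) Lf) Lh) _.
apply: le_trans h1; rewrite ler_wpM2l ?ip_ge0// lerDl//.
Qed.

Lemma cvg_L2_ip_sqr (f_ : nat -> plane R -> R) f : (forall n, L2 (f_ n)) -> L2 f ->
  (forall e : R, 0 < e -> exists N, forall n, (N <= n)%N ->
      ip (fun x => f_ n x - f x) (fun x => f_ n x - f x) <= e) ->
  (fun n => ip (f_ n) (f_ n)) @ \oo --> ip f f.
Proof.
move=> Lf_ Lf fc.
have c1 := cvg_L2_ip Lf_ Lf Lf fc.
have c2 : (fun n => ip (fun x => f_ n x - f x) (fun x => f_ n x - f x)) @ \oo --> (0 : R).
  apply/cvgrPdist_le => e e0; have [N HN] := fc e e0; exists N => // n /= /HN.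
  by rewrite sub0r normrN ger0_norm// ip_ge0.
have -> : (fun n => ip (f_ n) (f_ n)) =
   (fun n => ip (fun x => f_ n x - f x) (fun x => f_ n x - f x) + 2 * ip (f_ n) f - ip f f).
  by apply/funext => n; rewrite ip_sqrB//; ring.
suff : (fun n => ip (fun x => f_ n x - f x) (fun x => f_ n x - f x) + 2 * ip (f_ n) f - ip f f)
    @ \oo --> (0 + 2 * ip f f - ip f f).
  by rewrite (_ : 0 + 2 * ip f f - ip f f = ip f f); [|ring].
by apply: cvgB; [apply: cvgD => //; apply: cvgM => //; exact: cvg_cst|exact: cvg_cst].
Qed.

(** The representative is an L^2 limit of test functions, which yields the norm bound: <g, g>^2 is
    the limit of [l (x_ n) ^+ 2], at most C times the limit of <x_n, x_n>, that is C <g, g>. *)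
Lemma riesz_test (l : (R * R -> R) -> R) (C : R) : 0 <= C ->
  (forall psi phi, test_function psi -> test_function phi ->
    l (fun x => psi x + phi x) = l psi + l phi) ->
  (forall a psi, test_function psi -> l (fun x => a * psi x) = a * l psi) ->
  (forall psi, test_function psi -> l psi ^+ 2 <= C * ip psi psi) ->
  exists g, [/\ L2 g, ip g g <= C & forall psi, test_function psi -> ip g psi = l psi].
Proof.
move=> C0 lD lZ lB.
have [x_ [tx xC xl]] := @riesz_sequence R (R * R -> R^o)%type (@test_function R)
  (fun f g => ip f g) l C C0 (test0 : test_function (0 : R * R -> R^o)) (fun f g => @test_add R f g)
  (fun a f => @test_scale R a f) (fun f g _ _ => ipC mu f g)
  (fun f g h tf tg th => ipDl (test_L2 tf) (test_L2 tg) (test_L2 th))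
  (fun a f g tf tg => ipZl a (test_L2 tf) (test_L2 tg))
  (fun f _ => ip_ge0 mu f) lD lZ lB.
have Lx n : L2 (x_ n) := test_L2 (tx n).
have [g Lg xg] := L2_complete Lx xC.
have gl psi : test_function psi -> ip g psi = l psi.
  move=> tp; have := cvg_L2_ip Lx Lg (test_L2 tp) xg.
  by move=> /(cvg_unique (@Rhausdorff R)); apply; exact: xl.
exists g; split => //.
have [g0|gp] := leP (ip g g) 0; first exact: le_trans g0 C0.
have c1 := cvg_L2_ip Lx Lg Lg xg.
have c2 := cvg_L2_ip_sqr Lx Lg xg.
have : ip g g * ip g g <= C * ip g g.
  apply: (@ler_cvg_to _ \oo _ R (fun n => ip (x_ n) g * ip (x_ n) g) (fun n => C * ip (x_ n) (x_ n))).
  - exact: cvgM.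
  - by apply: cvgM => //; exact: cvg_cst.
  - by apply: nearW => n; rewrite -expr2 (ipC _ _ g) gl//; exact: lB.
by rewrite ler_pM2r.
Qed.

(** Plays the part of the density of test functions in L^2: [riesz_test] produces a function with
    the same pairings and the right norm, and the fundamental lemma identifies it with f. *)
Lemma L2_dual_le f (C : R) : 0 <= C -> L2 f ->
  (forall psi, test_function psi -> ip f psi ^+ 2 <= C * ip psi psi) -> ip f f <= C.
Proof.
move=> C0 Lf fB.
have [g [Lg gC gf]] := @riesz_test (fun psi => ip f psi) C C0
  (fun psi phi tp tp' => ipDr (test_L2 tp) (test_L2 tp') Lf)
  (fun a psi tp => ipZr a (test_L2 tp) Lf) fB.
have : {ae mu, forall x, f x - g x = 0}.
  apply: fundamental_lemma; first exact: L2B.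
  by move=> psi tp; rewrite ipBl ?gf ?subrr//; exact: test_L2.
move=> fg; have {}fg : {ae mu, forall x, f x = g x}.
  by apply: filterS fg => x /eqP; rewrite subr_eq0 => /eqP.
have [mf _] := Lf; have [mg _] := Lg.
by rewrite (ip_ae mf mg mf fg) ipC (ip_ae mf mg mg fg).
Qed.

Lemma wderiv_unique e f g g' : L2 g -> L2 g' -> wderiv e f g -> wderiv e f g' ->
  {ae mu, forall x, g x = g' x}.
Proof.
move=> Lg Lg' h h'.
have : {ae mu, forall x, g x - g' x = 0}.
  apply: fundamental_lemma; first exact: L2B.
  move=> psi tp; rewrite ipBl//; last exact: test_L2.
  by have := h psi tp; rewrite h'// => /oppr_inj ->; rewrite subrr.
by apply: filterS => x /eqP; rewrite subr_eq0 => /eqP.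
Qed.

Lemma shift_lineE psi e (t : R) : (fun x : R * R => psi (x + t *: e)) = shiftf (t *: e) psi.
Proof. by []. Qed.

Lemma shiftfK (z : R * R) f : shiftf z (shiftf (- z) f) = f.
Proof.
apply/funext => x; rewrite /shiftf /shiftp/=; congr f; case: x => a b.
by congr pair; rewrite /= addrK.
Qed.

Lemma ip_shiftr (z : R * R) f g : L2 f -> L2 g -> ip f (shiftf z g) = ip (shiftf (- z) f) g.
Proof.
move=> Lf Lg; rewrite -[in LHS](shiftfK z f) ip_shift//.
exact: L2_shift.
Qed.

(** By duality: against psi, the increment of f is an increment of F, the pairing of f with
    translates of psi. The derivative of F is a pairing of - g with such translates, so the mean
    value theorem and Cauchy-Schwarz finish. *)
Lemma difference_quotient_le e f g (h : R) : axis e -> L2 f -> L2 g -> wderiv e f g ->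
  ip (fun x => shiftf (h *: e) f x - f x) (fun x => shiftf (h *: e) f x - f x) <= h ^+ 2 * ip g g.
Proof.
move=> ax Lf Lg fg.
have Lsf := L2_shift (h *: e) Lf.
apply: L2_dual_le; first by rewrite mulr_ge0 ?sqr_ge0 ?ip_ge0.
  exact: L2B.
move=> psi tp; have Lp := test_L2 tp.
rewrite ipBl// -[h *: e]opprK -scaleNr -ip_shiftr//.
pose F (t : R) := ip f (fun x : R * R => psi (x + t *: e)).
have dF (t : R) : is_derive t 1 F (- ip g (shiftf (t *: e) psi)).
  rewrite -[shiftf _ _]shift_lineE -fg; last exact: test_shift.
  by rewrite derive_shiftE; exact: is_derive_ip_line.
have F0 : F 0 = ip f psi by congr ip; apply/funext => x; rewrite scale0r addr0.
rewrite -F0 -[ip f (shiftf _ _)]/(F (- h)).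
have bd c k : (- ip g (shiftf (c *: e) psi) * k) ^+ 2 <= k ^+ 2 * ip g g * ip psi psi.
  rewrite exprMn sqrrN mulrC -mulrA ler_wpM2l ?sqr_ge0//.
  apply: le_trans (cauchy_schwarz Lg (L2_shift _ Lp)) _.
  by rewrite ip_shift.
have cF : continuous F := is_derive1_continuous dF.
have [h0|h0] := leP 0 h.
- have [||c _] := @MVT_segment R F _ (- h) 0 _ (fun x _ => dF x); first by rewrite oppr_le0.
    exact: continuous_subspaceT.
  by move=> E; rewrite -sqrrN opprB E (le_trans (bd c _))// opprK add0r.
- have [||c _ ->] := @MVT_segment R F _ 0 (- h) _ (fun x _ => dF x); first by rewrite oppr_ge0 ltW.
    exact: continuous_subspaceT.
  by rewrite (le_trans (bd c _))// subr0 sqrrN.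
Qed.

(** Moving the shift onto f shows that the pairing of f with translates of psi is Lipschitz at 0
    with constant sqrt (C <psi, psi>). Its derivative at 0 is therefore a bounded functional of psi,
    which [riesz_test] represents. *)
Lemma wderiv_of_difference_quotient e f (C : R) : axis e -> 0 <= C -> L2 f ->
  (forall h : R, ip (fun x => shiftf (h *: e) f x - f x) (fun x => shiftf (h *: e) f x - f x)
     <= h ^+ 2 * C) ->
  exists g, [/\ L2 g, ip g g <= C & wderiv e f g].
Proof.
move=> ax C0 Lf fC.
have [|||g [Lg gC gl]] := @riesz_test (fun psi => - ip f ('D_e psi)) C C0.
- move=> psi phi tp tp'; rewrite derive_add; try by move=> x; exact: axis_derivable.
  by rewrite ipDr ?opprD//; exact: test_L2 (axis_test ax _).
- move=> a psi tp; rewrite derive_scale; last by move=> x; exact: axis_derivable.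
  by rewrite ipZr ?mulrN//; exact: test_L2 (axis_test ax _).
- move=> psi tp; have Lp := test_L2 tp; rewrite sqrrN.
  have := is_derive_ip_line 0 ax Lf tp.
  rewrite (_ : (fun x : R * R => 'D_e psi (x + 0 *: e)) = 'D_e psi); last first.
    by apply/funext => x; rewrite scale0r addr0.
  have Cp : 0 <= C * ip psi psi by rewrite mulr_ge0 ?ip_ge0.
  move=> /(@is_derive_le_lipschitz _ _ (Num.sqrt (C * ip psi psi))) H.
  rewrite -(sqr_sqrtr Cp) -(real_normK (num_real (ip f _))) lerXn2r ?nnegrE ?sqrtr_ge0// H// => t.
  apply: norm_le_of_sqr_le; first by rewrite mulr_ge0 ?sqrtr_ge0.
  rewrite exprMn sqr_sqrtr// real_normK ?num_real//.
  rewrite (_ : (fun x : R * R => psi (x + 0 *: e)) = psi); last first.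
    by apply/funext => x; rewrite scale0r addr0.
  rewrite shift_lineE ip_shiftr// -scaleNr -ipBl//; last exact: L2_shift.
  apply: le_trans (cauchy_schwarz (L2B (L2_shift _ Lf) Lf) Lp) _.
  by rewrite mulrAC ler_wpM2r ?ip_ge0// mulrC (le_trans (fC _))// sqrrN.
- exists g; split => // psi tp; rewrite gl// opprK//.
Qed.

(** Integration by parts as translation invariance: both sides differentiate at t = 0 the same
    function of t, obtained by shifting phi by t or psi by - t. *)
Lemma wderiv_test e psi : axis e -> test_function psi -> wderiv e psi ('D_e psi).
Proof.
move=> ax tp phi tphi.
have [Lp Lphi] := (test_L2 tp, test_L2 tphi).
have at0 (f : R * R -> R) : (fun x : R * R => f (x + (0 : R) *: e)) = f.
  by apply/funext => x; rewrite scale0r addr0.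
have := is_derive_ip_line 0 ax Lp tphi; rewrite (at0 ('D_e phi)).
have := is_derive_ip_line 0 ax Lphi tp; rewrite (at0 ('D_e psi)) => d1 d2.
have d3 : is_derive (0 : R) 1 (fun t : R => ip psi (fun x : R * R => phi (x + t *: e)))
    (- ip phi ('D_e psi)).
  rewrite (_ : (fun t : R => _) = (fun t : R => ip phi (fun x : R * R => psi (x + (- t) *: e)))); last first.
    by apply/funext => t; rewrite shift_lineE ip_shiftr// -scaleNr ipC.
  exact: is_derive0_opp d1.
have [_ <-] := d2; have [_ ->] := d3.
by rewrite ipC.
Qed.

Lemma wderivD e f f' g g' : axis e -> L2 f -> L2 f' -> L2 g -> L2 g' ->
  wderiv e f g -> wderiv e f' g' -> wderiv e (fun x => f x + f' x) (fun x => g x + g' x).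
Proof.
move=> ax Lf Lf' Lg Lg' h h' psi tp; have Lp := test_L2 tp; have LD := test_L2 (axis_test ax tp).
by rewrite !ipDl// h// h'// opprD.
Qed.

Lemma wderivZ e (a : R) f g : axis e -> L2 f -> L2 g ->
  wderiv e f g -> wderiv e (fun x => a * f x) (fun x => a * g x).
Proof.
move=> ax Lf Lg h psi tp; have Lp := test_L2 tp; have LD := test_L2 (axis_test ax tp).
by rewrite !ipZl// h// mulrN.
Qed.

Lemma L2_of_sqr_le f g (h : plane R -> R) : measurable_fun setT h -> L2 f -> L2 g ->
  (forall x, h x ^+ 2 <= f x ^+ 2 + g x ^+ 2) -> L2 h /\ ip h h <= ip f f + ip g g.
Proof.
move=> mc La Lb cab.
have Lc : L2 h.
  apply: (@L2_le _ _ _ mu h (fun x => `|f x| + `|g x|)) => //.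
    move=> x; apply: norm_le_of_sqr_le => //.
    rewrite ger0_norm ?addr_ge0// (le_trans (cab x))// sqrrD !real_normK ?num_real//.
    by rewrite lerD2r lerDl mulrn_wge0// mulr_ge0.
  apply: L2D.
    by apply: (L2_le _ _ La) => [|x]; [apply: measurableT_comp => //; case: La|rewrite normr_id].
  by apply: (L2_le _ _ Lb) => [|x]; [apply: measurableT_comp => //; case: Lb|rewrite normr_id].
split => //; rewrite !ipE -RintegralD//; try exact: L2_integrableM.
apply: le_Rintegral => //.
- exact: L2_integrableM.
- have := integrableD measurableT (L2_integrableM La La) (L2_integrableM Lb Lb).
  by apply: eq_integrable => // x _.
- by move=> x _; rewrite /= -!expr2.
Qed.

(* Works because a nonexpansive map does not increase difference quotients. *)
Lemma wderiv_nonexpansive e (F : R -> R -> R) f1 f2 g1 g2 : axis e ->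
  L2 f1 -> L2 f2 -> L2 g1 -> L2 g2 -> wderiv e f1 g1 -> wderiv e f2 g2 ->
  measurable_fun setT (fun x => F (f1 x) (f2 x)) -> F 0 0 = 0 ->
  (forall a b a' b', (F a b - F a' b') ^+ 2 <= (a - a') ^+ 2 + (b - b') ^+ 2) ->
  L2 (fun x => F (f1 x) (f2 x)) /\
  exists G, [/\ L2 G, ip G G <= ip g1 g1 + ip g2 g2 & wderiv e (fun x => F (f1 x) (f2 x)) G].
Proof.
move=> ax L1 L2' Lg1 Lg2 w1 w2 mF F0 Flip.
have LF : L2 (fun x => F (f1 x) (f2 x)).
  have [] := L2_of_sqr_le mF L1 L2' => // x.
  by have := Flip (f1 x) (f2 x) 0 0; rewrite F0 !subr0.
split => //; apply: wderiv_of_difference_quotient => //; first by rewrite addr_ge0 ?ip_ge0.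
move=> h; rewrite mulrDr.
apply: le_trans (lerD (difference_quotient_le h ax L1 Lg1 w1) (difference_quotient_le h ax L2' Lg2 w2)).
have [||||//] := @L2_of_sqr_le (fun x => shiftf (h *: e) f1 x - f1 x)
  (fun x => shiftf (h *: e) f2 x - f2 x)
  (fun x => shiftf (h *: e) (fun x => F (f1 x) (f2 x)) x - F (f1 x) (f2 x)).
- by apply: measurable_funB => //; exact: (measurable_shiftf _ mF).
- by apply: L2B => //; exact: L2_shift.
- by apply: L2B => //; exact: L2_shift.
- by move=> x; exact: Flip.
Qed.

End weak_derivatives.

(** * Uniqueness for the Helmholtz equation *)

Lemma second_derivative_at_max (R : realType) (f f1 : R -> R) (d : R) :
  (forall t : R, is_derive t 1 f (f1 t)) -> is_derive (0 : R) 1 f1 d ->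
  (forall t, f t <= f 0) -> d <= 0.
Proof.
move=> df df1 fmax.
have f10 : f1 0 = 0.
  have d0 : is_derive (0 : R) 1 f 0.
    apply: (@derive1_at_max _ f (-1) 1); rewrite ?in_itv/= ?ltrN10 ?ltr01//.
  by have [_ <-] := df 0; have [_ ->] := d0.
rewrite leNgt; apply/negP => d0.
have [cF dF] := df1.
have := cF; rewrite /derivable -[cvg _]/(_ --> 'D_1 f1 0) dF f10.
move=> /cvgrPdist_lt /(_ d d0) /nbhs_ballP [e /= e0 H].
have e2 : 0 < e / 2 by rewrite divr_gt0.
have [|c /[!in_itv]/= /andP[c0 ce]] := @MVT R f f1 0 (e / 2) e2 (fun x _ => df x).
  by apply: continuous_subspaceT; exact: is_derive1_continuous df.
have : 0 < f1 c.
  have := H c; rewrite /ball/= sub0r normrN gtr0_norm// => /(_ _ _).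
  have ce' : c < e by lra.
  move=> /(_ ce' (lt0r_neq0 c0)); rewrite subr0 addr0 [c *: 1]mulr1 ltr_distlC => /andP[+ _].
  by rewrite subrr pmulr_rgt0// invr_gt0.
move=> f1c E; have := fmax (e / 2).
by rewrite -subr_le0 E subr0 leNgt mulr_gt0.
Qed.

Lemma lipschitz_of_derive_le (R : realType) (f f1 : R -> R) (K : R) :
  (forall t : R, is_derive t 1 f (f1 t)) -> (forall t, `|f1 t| <= K) ->
  forall a b, `|f a - f b| <= K * `|a - b|.
Proof.
move=> df f1K.
have H a b : a <= b -> `|f b - f a| <= K * `|b - a|.
  move=> ab; have [|c _ ->] := @MVT_segment R f f1 a b ab (fun x _ => df x).
    by apply: continuous_subspaceT; exact: is_derive1_continuous df.
  by rewrite normrM ler_wpM2r.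
move=> a b; have [ab|/ltW ba] := leP a b; last exact: H.
by rewrite distrC [`|a - b|]distrC; exact: H.
Qed.

Section liouville.
Context {R : realType}.
Local Notation mu := (mu2 R).
Local Notation ip := (ip mu).
Local Notation L2 := (L2 mu).
Implicit Types (f g h : plane R -> R) (psi phi rho : R * R -> R) (z e : R * R).

Lemma test_laplacian psi : test_function psi -> test_function (laplacian psi).
Proof.
by move=> tp; apply: (@test_add _ ('D_e1 ('D_e1 psi)) ('D_e2 ('D_e2 psi)));
  [apply: test_D1; exact: test_D1|apply: test_D2; exact: test_D2].
Qed.

Lemma ip_laplacian h psi : L2 h -> test_function psi ->
  ip h (laplacian psi) = ip h ('D_e1 ('D_e1 psi)) + ip h ('D_e2 ('D_e2 psi)).
Proof.
move=> Lh tp; rewrite -ipDr//; apply: test_L2.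
  by apply: test_D1; exact: test_D1.
by apply: test_D2; exact: test_D2.
Qed.

(** A mollification of h, up to reflection: it is differentiable in z even though h is only square
    integrable, so a pointwise maximum principle can be applied to it. *)
Definition correlation h rho z := ip h (shiftf z rho).

Lemma correlation_line h rho z e (t : R) :
  correlation h rho (z + t *: e) = ip h (fun x : R * R => shiftf z rho (x + t *: e)).
Proof.
congr ip; apply/funext => x; rewrite /shiftf /shiftp; congr (rho (_, _)).
  by rewrite /= addrA addrAC.
by rewrite /= addrA addrAC.
Qed.

Lemma is_derive_correlation h rho z e (a : R) : axis e -> L2 h -> test_function rho ->
  is_derive a 1 (fun t : R => correlation h rho (z + t *: e)) (correlation h ('D_e rho) (z + a *: e)).
Proof.
move=> ax Lh tr.
rewrite (_ : (fun t : R => _) = (fun t : R => ip h (fun x : R * R => shiftf z rho (x + t *: e)))); last first.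
  by apply/funext => t; rewrite correlation_line.
rewrite correlation_line.
have -> : shiftf z ('D_e rho) = 'D_e (shiftf z rho) by exact/esym/(derive_shiftE rho e z).
by apply: is_derive_ip_line => //; exact: test_shift.
Qed.

Lemma correlation_derive2 e h rho z :
  ip h ('D_e ('D_e (shiftf z rho))) = correlation h ('D_e ('D_e rho)) z.
Proof.
have E (g : R * R -> R) : 'D_e (shiftf z g) = shiftf z ('D_e g) := derive_shiftE g e z.
exact: (congr1 (ip h) (etrans (congr1 (fun g => 'D_e g) (E rho)) (E _))).
Qed.

Lemma laplacian_correlation h rho z : L2 h -> test_function rho ->
  ip h (laplacian (shiftf z rho)) =
  correlation h ('D_e1 ('D_e1 rho)) z + correlation h ('D_e2 ('D_e2 rho)) z.
Proof.
move=> Lh tr; exact: (etrans (ip_laplacian Lh (test_shift z tr))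
  (congr2 +%R (correlation_derive2 e1 h rho z) (correlation_derive2 e2 h rho z))).
Qed.

Lemma correlation_le h rho z : L2 h -> test_function rho ->
  `|correlation h rho z| <= ip h h + ip rho rho.
Proof.
move=> Lh tr; have Lr := test_L2 tr; have Ls := L2_shift z Lr.
have h0 := ip_ge0 mu h; have r0 := ip_ge0 mu rho.
apply: norm_le_of_sqr_le; first by rewrite addr_ge0.
apply: le_trans (cauchy_schwarz Lh Ls) _; rewrite ip_shift//; nra.
Qed.

Lemma continuous_correlation h rho : L2 h -> test_function rho ->
  continuous (correlation h rho).
Proof.
move=> Lh tr z.
have lip e (K : R) : axis e -> K = ip h h + ip ('D_e rho) ('D_e rho) -> forall z (t : R),
    `|correlation h rho (z + t *: e) - correlation h rho z| <= K * `|t|.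
  move=> ax -> z' t.
  have := lipschitz_of_derive_le (fun a => is_derive_correlation z' a ax Lh tr)
    (fun a => correlation_le (z' + a *: e) Lh (axis_test ax tr)) t 0.
  by rewrite subr0 scale0r addr0.
have [K1 hK1] : exists K, K = ip h h + ip ('D_e1 rho) ('D_e1 rho) := ex_intro _ _ erefl.
have [K2 hK2] : exists K, K = ip h h + ip ('D_e2 rho) ('D_e2 rho) := ex_intro _ _ erefl.
have K10 : 0 <= K1 by rewrite hK1 addr_ge0 ?ip_ge0.
have K20 : 0 <= K2 by rewrite hK2 addr_ge0 ?ip_ge0.
apply/cvgrPdist_le => eps eps0.
have d0 : 0 < eps / (K1 + K2 + 1) by rewrite divr_gt0// ltr_wpDl// addr_ge0.
exists (ball z.1 (eps / (K1 + K2 + 1)), ball z.2 (eps / (K1 + K2 + 1))).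
  by split; exact: nbhsx_ballx.
move=> y /= [/= b1 b2].
have P1 : `|y.1 - z.1| <= eps / (K1 + K2 + 1) by rewrite distrC; exact: ltW.
have P2 : `|y.2 - z.2| <= eps / (K1 + K2 + 1) by rewrite distrC; exact: ltW.
have -> : y = (z + (y.1 - z.1) *: e1) + (y.2 - z.2) *: e2.
  rewrite adde2E adde1E /= [z.1 + _]addrC [z.2 + _]addrC !subrK.
  by case: (y).
rewrite distrC -(subrKA (correlation h rho (z + (y.1 - z.1) *: e1))).
apply: le_trans (ler_normD _ _) _.
apply: le_trans (lerD (lip e2 K2 (or_intror erefl) hK2 _ _) (lip e1 K1 (or_introl erefl) hK1 _ _)) _.
apply: le_trans (lerD (ler_wpM2l K20 P2) (ler_wpM2l K10 P1)) _.
rewrite -mulrDl [K2 + _]addrC mulrA ler_pdivrMr; last by rewrite ltr_wpDl// addr_ge0.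
by rewrite mulrC ler_pM2l// lerDl.
Qed.

(* Maximum principle for [Delta k >= lam k]: the barrier [eps (4 / lam + |z|^2)] is a
   supersolution, and [k] minus the barrier attains its maximum since [k] is bounded. *)
Lemma correlation_le0 (lam : R) h rho : 0 < lam -> L2 h -> test_function rho ->
  (forall z, ip h (fun x => - laplacian (shiftf z rho) x + lam * shiftf z rho x) <= 0) ->
  ip h rho <= 0.
Proof.
move=> lam0 Lh tr hlap.
pose k := correlation h rho.
pose K := ip h h + ip rho rho.
have K0 : 0 <= K by rewrite addr_ge0 ?ip_ge0.
have kK z : k z <= K by apply: le_trans (ler_norm _) _; exact: correlation_le.
have k0 : k 0 = ip h rho.
  congr ip; apply/funext => x; rewrite /shiftf /shiftp; congr (rho _).
  by case: x => a b; congr pair; rewrite /= addr0.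
rewrite -k0.
suff H eps : 0 < eps -> k 0 <= eps * (4 / lam).
  have l4 : 0 < 4 / lam by rewrite divr_gt0.
  apply/ler_addgt0Pl => d d0; rewrite addr0.
  have := H (d / (4 / lam)) (divr_gt0 d0 l4).
  by rewrite divfK// gt_eqF.
move=> eps0; rewrite leNgt; apply/negP => kpos.
pose M z : R := 4 / lam + (z.1 ^+ 2 + z.2 ^+ 2).
pose P z := k z - eps * M z.
have P0 : 0 < P 0 by rewrite /P /M/= expr0n/= !addr0 subr_gt0.
have cP : continuous P.
  move=> z; apply: cvgB; first exact: continuous_correlation.
  apply: cvgM; first exact: cvg_cst.
  apply: cvgD; first exact: cvg_cst.
  by apply: cvgD; rewrite expr2; apply: cvgM; first [exact: cvg_fst|exact: cvg_snd].
(* Outside the square of half-side r the barrier is at least eps r^2 >= K, and K bounds k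
   everywhere; so P can be positive only inside. *)
pose r := K / eps + 1.
have r1 : 1 <= r by rewrite /r lerDr divr_ge0// ltW.
have Kr : K <= eps * r ^+ 2.
  have : K / eps <= r by rewrite /r lerDl.
  rewrite ler_pdivrMr// => h1; apply: le_trans h1 _.
  rewrite mulrC ler_pM2l// expr2 ler_peMl//; lra.
pose box : set (R * R) := `[- r, r]%classic `*` `[- r, r]%classic.
have outside z : ~ box z -> P z <= 0.
  move=> nb.
  have : r ^+ 2 <= z.1 ^+ 2 + z.2 ^+ 2.
    rewrite leNgt; apply/negP => zr; apply: nb.
    have r0 : 0 <= r by lra.
    have h1 : `|z.1| <= r by apply: norm_le_of_sqr_le => //; have := sqr_ge0 z.2; lra.
    have h2 : `|z.2| <= r by apply: norm_le_of_sqr_le => //; have := sqr_ge0 z.1; lra.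
    by split; rewrite /= in_itv/= -ler_norml.
  move=> h1; rewrite /P /M; have := kK z.
  have : 0 <= eps * (4 / lam) by rewrite mulr_ge0 ?divr_ge0// ltW.
  have := ler_wpM2l (ltW eps0) h1; rewrite [eps * (_ + (_ + _))]mulrDr; lra.
have box0 : box 0 by split; rewrite /= in_itv/=; apply/andP; split; lra.
have cbox : compact box by apply: compact_setX; exact: segment_compact.
have [z0 _ zmax'] := compact_EVT_max (ex_intro _ _ box0) cbox (continuous_subspaceT cP).
have zmax z : P z <= P z0.
  have [bz|nbz] := pselect (box z); first by apply: zmax'; rewrite inE.
  by apply: le_trans (outside z nbz) _; rewrite (le_trans (ltW P0))// zmax' ?inE.
(* At the maximum of P the second derivative of k along an axis is at most that of the barrier,
   which is 2 eps. *)
have second e (s : R) : axis e -> (forall t : R, M (z0 + t *: e) = M z0 + 2 * s * t + t ^+ 2) ->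
    correlation h ('D_e ('D_e rho)) z0 <= 2 * eps.
  move=> ax ME.
  pose F (t : R) := P (z0 + t *: e).
  pose F1 (t : R) := correlation h ('D_e rho) (z0 + t *: e) - eps * (2 * s + 2 * t).
  have dF (t : R) : is_derive t 1 F (F1 t).
    have -> : F = (fun t => k (z0 + t *: e)) - (fun t => eps * (M z0 + 2 * s * t + t ^+ 2)).
      by apply/funext => u; rewrite /F /P ME.
    apply: is_deriveB; first exact: is_derive_correlation.
    have d1 : is_derive t 1 (fun t : R => M z0 + 2 * s * t + t ^+ 2) (2 * s + 2 * t).
      have := is_deriveD (is_deriveD (is_derive_cst (M z0) t (1 : R))
         (is_deriveZ (2 * s) (is_derive_id t (1 : R)))) (is_deriveX 2 (is_derive_id t (1 : R))).
      by rewrite add0r [(2 * s) *: 1]mulr1 expr1 [_ *: 1]mulr1.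
    exact: is_deriveZ.
  have dF1 : is_derive (0 : R) 1 F1 (correlation h ('D_e ('D_e rho)) z0 - eps * 2).
    have d1 := is_derive_correlation z0 0 ax Lh (axis_test ax tr).
    rewrite scale0r addr0 in d1.
    apply: is_deriveB => //.
    have := is_deriveZ eps (is_deriveD (is_derive_cst (2 * s) (0 : R) (1 : R))
       (is_deriveZ 2 (is_derive_id (0 : R) (1 : R)))).
    by rewrite add0r [2 *: 1]mulr1.
  have := second_derivative_at_max dF dF1; rewrite subr_le0 mulrC; apply => t.
  by rewrite /F scale0r addr0.
have s1 := second e1 z0.1 (or_introl erefl).
have s2 := second e2 z0.2 (or_intror erefl).
have {}s1 : correlation h ('D_e1 ('D_e1 rho)) z0 <= 2 * eps.
  by apply: s1 => t; rewrite adde1E /M/=; ring.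
have {}s2 : correlation h ('D_e2 ('D_e2 rho)) z0 <= 2 * eps.
  by apply: s2 => t; rewrite adde2E /M/=; ring.
have tz : test_function (shiftf z0 rho) by exact: test_shift.
have := hlap z0.
have Ltz := test_L2 tz; have Llz := test_L2 (test_laplacian tz).
rewrite (ipDr (L2N Llz) (L2Z lam Ltz) Lh) (ipNr Llz Lh) (ipZr lam Ltz Lh) (laplacian_correlation z0 Lh tr).
have arith (a b c : R) : a <= 2 * eps -> b <= 2 * eps -> - (a + b) + c <= 0 -> c <= 4 * eps.
  by clear; lra.
move=> /(arith _ _ _ s1 s2) E; have {}E : lam * k z0 <= 4 * eps := E.
clear s1 s2 second.
(* From lam k(z0) <= 4 eps one gets P(z0) <= - eps |z0|^2 <= 0 < P(0), against maximality. *)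
have := zmax 0; rewrite leNgt => /negP; apply.
apply: le_lt_trans P0; rewrite /P /M.
have q : k z0 <= eps * (4 / lam) by rewrite mulrA ler_pdivlMr// [_ * lam]mulrC [eps * 4]mulrC.
have := sqr_ge0 z0.1; have := sqr_ge0 z0.2 => a b.
have := mulr_ge0 (ltW eps0) (addr_ge0 b a); rewrite mulrDr; lra.
Qed.

(** The maximum principle applied to rho and to - rho forces <h, rho> = 0 for every test function
    rho. *)
Lemma green_homogeneous_eq0 (lam : R) h : 0 < lam -> L2 h ->
  (forall psi, test_function psi -> ip h (fun x => - laplacian psi x + lam * psi x) = 0) ->
  {ae mu, forall x, h x = 0}.
Proof.
move=> lam0 Lh hlap; apply: fundamental_lemma => // rho tr.
have tN := test_scale (-1) tr.
have h1 : ip h rho <= 0.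
  by apply: (correlation_le0 lam0) => // z; rewrite hlap//; exact: test_shift.
have h2 : ip h (fun x => -1 * rho x) <= 0.
  by apply: (correlation_le0 lam0) => // z; rewrite hlap//; exact: test_shift.
apply/eqP; rewrite eq_le h1 /=.
by move: h2; rewrite ipZr ?mulN1r ?oppr_le0//; exact: test_L2.
Qed.

End liouville.

(** * Weak solutions *)

Section sobolev.
Context {R : realType}.
Local Notation mu := (mu2 R).
Local Notation ip := (ip mu).
Local Notation L2 := (L2 mu).
Implicit Types (f g h w : plane R -> R) (psi phi : R * R -> R).

(** The derivatives are data rather than chosen representatives, so sums, multiples and energies can
    be computed literally. *)
Definition sobolev f g1 g2 := [/\ L2 f, L2 g1, L2 g2, wderiv e1 f g1 & wderiv e2 f g2].

Lemma axis1 : axis (e1 : R * R). Proof. by left. Qed.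
Lemma axis2 : axis (e2 : R * R). Proof. by right. Qed.

Lemma sobolevD f g1 g2 f' g1' g2' : sobolev f g1 g2 -> sobolev f' g1' g2' ->
  sobolev (fun x => f x + f' x) (fun x => g1 x + g1' x) (fun x => g2 x + g2' x).
Proof.
move=> [Lf L1 L2g w1 w2] [Lf' L1' L2g' w1' w2'].
split; [exact: L2D|exact: L2D|exact: L2D| |].
  exact: (wderivD axis1).
exact: (wderivD axis2).
Qed.

Lemma sobolevZ (a : R) f g1 g2 : sobolev f g1 g2 ->
  sobolev (fun x => a * f x) (fun x => a * g1 x) (fun x => a * g2 x).
Proof.
move=> [Lf L1 L2g w1 w2].
split; [exact: L2Z|exact: L2Z|exact: L2Z| |].
  exact: (wderivZ _ axis1).
exact: (wderivZ _ axis2).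
Qed.

Lemma sobolev0 : sobolev (fun=> 0) (fun=> 0) (fun=> 0).
Proof.
have L0 : L2 (fun=> 0) := L20 mu.
have L00 : L2 (fun x : plane R => 0 * 0) := L2Z 0 L0.
have z (g : plane R -> R) : ip (fun=> 0) g = 0.
  rewrite ipE; have -> : (fun x : plane R => 0 * g x) = cst 0 by apply/funext => x; rewrite mul0r.
  by rewrite Rintegral_cst//= mul0r.
by split => //; move=> psi tp; rewrite !z oppr0.
Qed.

Lemma sobolev_test psi : test_function psi -> sobolev psi ('D_e1 psi) ('D_e2 psi).
Proof.
move=> tp; split.
- exact: test_L2.
- exact: test_L2 (axis_test axis1 tp).
- exact: test_L2 (axis_test axis2 tp).
- exact: (wderiv_test axis1).
- exact: (wderiv_test axis2).
Qed.

Local Notation V := ((plane R -> R) * (plane R -> R) * (plane R -> R))%type.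

(** Riesz representation on triples (f, g1, g2), where the energy is bilinear without any choice of
    derivatives. Completeness is applied to each component, since B controls the three L^2 norms
    separately, and weak derivatives pass to the limit. The equation holds against every Sobolev
    function, as needed later with |u|. *)
Lemma weak_solution (lam : R) F : 0 < lam -> L2 F ->
  exists w w1 w2, sobolev w w1 w2 /\
    forall f g1 g2, sobolev f g1 g2 -> ip w1 g1 + ip w2 g2 + lam * ip w f = ip F f.
Proof.
move=> lam0 LF.
pose B (x y : V) := ip x.1.2 y.1.2 + ip x.2 y.2 + lam * ip x.1.1 y.1.1.
pose S (x : V) := sobolev x.1.1 x.1.2 x.2.
pose l (x : V) := ip F x.1.1.
have C0 : 0 <= ip F F / lam by rewrite divr_ge0 ?ip_ge0// ltW.
have SD x y : S x -> S y -> S (x + y) by exact: sobolevD.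
have SZ a x : S x -> S (a *: x) by exact: sobolevZ.
have S0 : S 0 := sobolev0.
have BC x y : S x -> S y -> B x y = B y x.
  by move=> _ _; rewrite /B ipC [ip x.2 _]ipC [ip x.1.1 _]ipC.
have BD x y z : S x -> S y -> S z -> B (x + y) z = B x z + B y z.
  move=> [a1 a2 a3 _ _] [b1 b2 b3 _ _] [c1 c2 c3 _ _].
  have E1 : ip (x + y).1.2 z.1.2 = ip x.1.2 z.1.2 + ip y.1.2 z.1.2 by exact: ipDl.
  have E2 : ip (x + y).2 z.2 = ip x.2 z.2 + ip y.2 z.2 by exact: ipDl.
  have E3 : ip (x + y).1.1 z.1.1 = ip x.1.1 z.1.1 + ip y.1.1 z.1.1 by exact: ipDl.
  by rewrite /B E1 E2 E3; ring.
have BZ a x z : S x -> S z -> B (a *: x) z = a * B x z.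
  move=> [a1 a2 a3 _ _] [c1 c2 c3 _ _].
  have E1 : ip (a *: x).1.2 z.1.2 = a * ip x.1.2 z.1.2 := ipZl a a2 c2.
  have E2 : ip (a *: x).2 z.2 = a * ip x.2 z.2 := ipZl a a3 c3.
  have E3 : ip (a *: x).1.1 z.1.1 = a * ip x.1.1 z.1.1 := ipZl a a1 c1.
  by rewrite /B E1 E2 E3; ring.
have B_ge0 x : S x -> 0 <= B x x.
  by move=> _; rewrite /B !addr_ge0 ?mulr_ge0 ?ip_ge0// ltW.
have lD x y : S x -> S y -> l (x + y) = l x + l y.
  by move=> [a1 _ _ _ _] [b1 _ _ _ _]; exact: ipDr.
have lZ a x : S x -> l (a *: x) = a * l x.
  by move=> [a1 _ _ _ _]; exact: (ipZr a a1 LF).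
have lB x : S x -> l x ^+ 2 <= ip F F / lam * B x x.
  move=> [a1 _ _ _ _]; apply: le_trans (cauchy_schwarz LF a1) _.
  rewrite mulrAC ler_pdivlMr// -mulrA ler_wpM2l ?ip_ge0//.
  by rewrite /B mulrC lerDr addr_ge0 ?ip_ge0.
have [x_ [Sx xC xl]] := riesz_sequence C0 S0 SD SZ BC BD BZ B_ge0 lD lZ lB.
have bnd (P : V -> plane R -> R) (c : R) : 0 < c -> (forall n, L2 (P (x_ n))) ->
    (forall m n, c * ip (fun x => P (x_ m) x - P (x_ n) x) (fun x => P (x_ m) x - P (x_ n) x)
       <= B (x_ m - x_ n) (x_ m - x_ n)) ->
    exists2 f, L2 f & forall e, 0 < e -> exists N, forall n, (N <= n)%N ->
      ip (fun x => P (x_ n) x - f x) (fun x => P (x_ n) x - f x) <= e.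
  move=> c0 LP PB; apply: L2_complete => // e e0.
  have [N HN] := xC (c * e) (mulr_gt0 c0 e0); exists N => m n Nm Nn.
  by rewrite -(ler_pM2l c0); apply: le_trans (PB m n) _; exact: HN.
have ipB_ge0 (g : plane R -> R) := ip_ge0 mu g.
have [w Lw wc] : exists2 f, L2 f & forall e, 0 < e -> exists N, forall n, (N <= n)%N ->
      ip (fun x => (x_ n).1.1 x - f x) (fun x => (x_ n).1.1 x - f x) <= e.
  apply: (bnd (fun x => x.1.1) lam) => // [n|m n]; first by have [] := Sx n.
  by rewrite /B lerDr addr_ge0 ?ip_ge0.
have [w1 Lw1 w1c] : exists2 f, L2 f & forall e, 0 < e -> exists N, forall n, (N <= n)%N ->
      ip (fun x => (x_ n).1.2 x - f x) (fun x => (x_ n).1.2 x - f x) <= e.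
  apply: (bnd (fun x => x.1.2) 1) => // [n|m n]; first by have [] := Sx n.
  by rewrite mul1r /B -addrA lerDl addr_ge0 ?mulr_ge0 ?ip_ge0// ltW.
have [w2 Lw2 w2c] : exists2 f, L2 f & forall e, 0 < e -> exists N, forall n, (N <= n)%N ->
      ip (fun x => (x_ n).2 x - f x) (fun x => (x_ n).2 x - f x) <= e.
  apply: (bnd (fun x => x.2) 1) => // [n|m n]; first by have [] := Sx n.
  by rewrite mul1r /B [X in X + _]addrC -addrA lerDl addr_ge0 ?mulr_ge0 ?ip_ge0// ltW.
have L0 n : L2 (x_ n).1.1 by have [] := Sx n.
have L1 n : L2 (x_ n).1.2 by have [] := Sx n.
have L2' n : L2 (x_ n).2 by have [] := Sx n.
have wd e g (p : nat -> plane R -> R) : axis e -> L2 g -> (forall n, L2 (p n)) ->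
    (forall n, wderiv e (x_ n).1.1 (p n)) ->
    (forall e, 0 < e -> exists N, forall n, (N <= n)%N ->
      ip (fun x => p n x - g x) (fun x => p n x - g x) <= e) -> wderiv e w g.
  move=> ax Lg Lp dp pc psi tp.
  have c1 := cvg_L2_ip L0 Lw (test_L2 (axis_test ax tp)) wc.
  have c2 := cvg_L2_ip Lp Lg (test_L2 tp) pc.
  apply: (cvg_unique (@Rhausdorff R) c1).
  rewrite (_ : (fun n => _) = (fun n => - ip (p n) psi)); last by apply/funext => n; exact: dp.
  exact: cvgN.
exists w, w1, w2; split.
  split => //.
    by apply: (wd _ _ (fun n => (x_ n).1.2)) => // [|n]; [exact: axis1|have [] := Sx n].
  by apply: (wd _ _ (fun n => (x_ n).2)) => // [|n]; [exact: axis2|have [] := Sx n].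
move=> f g1 g2 sf; have [Lf Lg1 Lg2 _ _] := sf.
apply: (cvg_unique (@Rhausdorff R)) (xl ((f, g1), g2) sf).
by apply: cvgD; [apply: cvgD|apply: cvgMr]; exact: cvg_L2_ip.
Qed.

End sobolev.

(** * Profile of the parametrix *)

Section profile.
Context {R : realType}.
Implicit Types (a p s r : R).

(** The Bose-Einstein function, minus the derivative of [coth_log]; [planck_slope] below is minus
    the derivative of [planck]. In the Laplacian of the kernel the terms in [planck] cancel and only
    [planck_slope] survives. *)
Definition bose p : R := (expR p - 1)^-1.
Definition planck p : R := p * bose p.
Definition planck_slope p : R := bose p ^+ 2 * (p * expR p - expR p + 1).

Lemma bose_gt0 p : 0 < p -> 0 < bose p.
Proof. by move=> p0; rewrite invr_gt0 subr_gt0 expR_gt1. Qed.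

Lemma boseK p : 0 < p -> bose p * (expR p - 1) = 1.
Proof. by move=> p0; rewrite mulVf// gt_eqF// subr_gt0 expR_gt1. Qed.

Lemma bose_le n p : 0 < p -> p ^+ n.+1 * bose p <= n.+1`!%:R.
Proof.
move=> p0; rewrite ler_pdivrMr ?subr_gt0 ?expR_gt1//.
have := expR_ge1Dxn n (ltW p0); rewrite addrC -lerBrDr ler_pdivrMr ?ltr0n ?fact_gt0//.
by rewrite mulrC.
Qed.

Lemma expR_le1D p : p < 1 -> expR p * (1 - p) <= 1.
Proof.
move=> p1; have := expR_ge1Dx (- p); rewrite expRN => h.
by rewrite -(@ler_pM2l _ (expR p)^-1) ?invr_gt0 ?expR_gt0// mulKf ?gt_eqF ?expR_gt0// mulr1.
Qed.

Lemma planck_slope_le p : 0 < p -> 0 <= planck_slope p /\ planck_slope p <= p * bose p.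
Proof.
move=> p0; have b0 := bose_gt0 p0; have bE := boseK p0.
have E1 := expR_ge1Dx p.
split.
  rewrite mulr_ge0// ?sqr_ge0//.
  have [p1|p1] := ltP p 1; first by have := expR_le1D p1; lra.
  by have := expR_gt0 p; nra.
have -> : p * bose p = bose p ^+ 2 * (p * (expR p - 1)).
  have -> : bose p ^+ 2 * (p * (expR p - 1)) = p * bose p * (bose p * (expR p - 1)) by ring.
  by rewrite bE mulr1.
by rewrite ler_wpM2l ?sqr_ge0//; lra.
Qed.

Lemma planck_slope_bounds p : 0 < p ->
  [/\ 0 <= planck_slope p, planck_slope p <= 1 & p * planck_slope p <= 2].
Proof.
move=> p0; have [B0 B1] := planck_slope_le p0.
have b1 := bose_le 0 p0; have b2 := bose_le 1 p0.
rewrite expr1 in b1; rewrite expr2 -mulrA in b2.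
split => //; first exact: le_trans B1 b1.
by apply: le_trans b2; rewrite ler_pM2l.
Qed.

(** With y = exp (p/2) this is (y (1 - p/2))^2 <= 1. *)
Lemma expR_quadratic p : p <= 2 -> p ^+ 2 / 4 * expR p <= p * expR p - expR p + 1.
Proof.
move=> p2; have h0 := expR_gt0 (p / 2).
have EE : expR p = expR (p / 2) ^+ 2 by rewrite -expRM_natl; congr expR; field.
have p21 : p / 2 < 1 \/ p = 2.
  by have [?|?] := ltP p 2; [left; lra|right; lra].
have : expR (p / 2) * (1 - p / 2) <= 1.
  case: p21 => [|->]; first exact: expR_le1D.
  by rewrite divff// subrr mulr0.
have : 0 <= expR (p / 2) * (1 - p / 2) by apply: mulr_ge0; lra.
rewrite EE; move: (expR (p / 2)) => y y0 y1; nra.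
Qed.

Lemma expR_sub1_le p : 0 < p -> p <= 2 -> expR p - 1 <= 16 * p.
Proof.
move=> p0 p2; have h0 := expR_gt0 (p / 4).
have EE : expR p = expR (p / 4) ^+ 4 by rewrite -expRM_natl; congr expR; field.
have h1 : expR (p / 4) * (1 - p / 4) <= 1 by apply: expR_le1D; lra.
have h2 : expR (p / 4) <= 2 by move: (expR (p / 4)) h0 h1 => y; nra.
have h3 : expR p <= 16.
  by rewrite EE (_ : 16 = 2 ^+ 4) ?lerXn2r ?nnegrE ?expR_ge0//; ring.
have := expR_ge1Dx (- p); rewrite expRN => h4.
have h5 : expR p - 1 = expR p * (1 - (expR p)^-1).
  by rewrite mulrBr mulfV ?mulr1// gt_eqF ?expR_gt0.
rewrite h5; apply: le_trans (_ : expR p * p <= _); last by rewrite ler_pM2r.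
by rewrite ler_pM2l ?expR_gt0//; lra.
Qed.

Definition coth_log p : R := - ln (1 - expR (- p)).

Lemma expR_coth_log p : 0 < p -> expR (coth_log p) = 1 + bose p.
Proof.
move=> p0; have E1 : 0 < expR p - 1 by rewrite subr_gt0 expR_gt1.
have E0 := expR_gt0 p.
rewrite /coth_log expRN lnK; last by rewrite posrE subr_gt0 expR_lt1 oppr_lt0.
rewrite expRN /bose; field; rewrite !gt_eqF//; lra.
Qed.

Lemma coth_log_gt0 p : 0 < p -> 0 < coth_log p.
Proof. by move=> p0; rewrite -expR_gt1 expR_coth_log// ltrDl bose_gt0. Qed.

Lemma coth_log_le p : 0 < p -> coth_log p <= bose p.
Proof.
by move=> p0; have := expR_ge1Dx (coth_log p); rewrite expR_coth_log// lerD2l.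
Qed.

Lemma coth_logX_le n p : 0 < p -> coth_log p ^+ n.+1 <= n.+1`!%:R * bose p.
Proof.
move=> p0; have := expR_ge1Dxn n (ltW (coth_log_gt0 p0)).
by rewrite expR_coth_log// lerD2l ler_pdivrMr ?ltr0n ?fact_gt0// mulrC.
Qed.

(** For p <= 2 the left side is bounded, the singularity being logarithmic, while [planck_slope]
    stays away from 0. For p > 2 both functions decay exponentially, with [coth_log] at most [bose]
    and [planck_slope] at least half of p [bose]. The factor p and the cube fit the scaling in
    [kern_le_laplacian]. *)
Lemma coth_log_cube_le : exists2 c : R, 0 < c &
  forall p, 0 < p -> coth_log p ^+ 3 * p <= (c * planck_slope p) ^+ 3.
Proof.
(* 1024 = 4 * 16^2: on p <= 2, p [bose p] is at least 1/16 and [planck_slope p] at least a quarter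
   of its square. *)
have [M M1] : exists M : R, 1024 <= M by exists 1024.
have M4 : 4 <= M by apply: le_trans M1; rewrite ler_nat.
exists (2 * M) => [|p p0]; first lra.
have []  := planck_slope_bounds p0 => B0 _ _; have b0 := bose_gt0 p0; have k0 := coth_log_gt0 p0.
have bE := boseK p0; have b1 := bose_le 0 p0; rewrite expr1 (_ : 1`!%:R = 1)// in b1.
have [p2|p2] := leP p 2.
  have q := expR_quadratic p2; have u := expR_sub1_le p0 p2.
  have E1 : 1 <= expR p by rewrite -expR0 ler_expR ltW.
  have pb : 1 <= 16 * (p * bose p).
    by have := ler_wpM2l (ltW b0) u; rewrite bE; lra.
  have B1 : 1 <= M * planck_slope p.
    have q2 : p ^+ 2 / 4 <= p * expR p - expR p + 1.
      by apply: le_trans q; rewrite ler_peMr// divr_ge0// sqr_ge0.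
    have h1 : bose p ^+ 2 * (p ^+ 2 / 4) <= planck_slope p by rewrite ler_wpM2l ?sqr_ge0.
    have h2 : 1 <= 1024 * (bose p ^+ 2 * (p ^+ 2 / 4)).
      by rewrite (_ : 1024 * _ = (16 * (p * bose p)) ^+ 2); [rewrite exprn_ege1|field].
    apply: le_trans h2 _; apply: le_trans (ler_wpM2r _ M1) _; last by rewrite ler_wpM2l//; lra.
    by rewrite mulr_ge0 ?sqr_ge0// divr_ge0// sqr_ge0.
  have := coth_logX_le 2 p0; rewrite (_ : 3`!%:R = 6)// => h.
  apply: le_trans (_ : 8 <= _).
    apply: le_trans (ler_wpM2r (ltW p0) h) _.
    by rewrite -mulrA [bose p * p]mulrC; lra.
  rewrite (_ : 8 = 2 ^+ 3); last by ring.
  by apply: lerXn2r; rewrite ?nnegrE; lra.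
have E0 := expR_gt0 p.
have xE : bose p * expR p = 1 + bose p by rewrite -[in RHS]bE; ring.
have B1 : bose p * p <= 2 * planck_slope p.
  have -> : 2 * planck_slope p = bose p * (2 * (bose p * expR p) * (p - 1) + 2 * bose p).
    by rewrite /planck_slope; ring.
  by rewrite ler_pM2l// xE; nra.
have M0 : 0 <= M by lra.
have bp0 : 0 <= bose p * p by rewrite mulr_ge0 ?ltW.
apply: le_trans (_ : (M * (bose p * p)) ^+ 3 <= _); last first.
  by apply: lerXn2r; rewrite ?nnegrE; [exact: mulr_ge0|apply: mulr_ge0; lra|nra].
rewrite !exprMn mulrA; apply: ler_pM; [by rewrite exprn_ge0 ?ltW|exact: ltW| |].
  have h : coth_log p ^+ 3 <= bose p ^+ 3.
    by apply: lerXn2r; [rewrite nnegrE ltW|rewrite nnegrE ltW|exact: coth_log_le].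
  apply: le_trans h _; apply: ler_peMl; first by rewrite exprn_ge0// ltW.
  by apply: exprn_ege1; lra.
by rewrite exprS ler_peMr// ?(ltW p0)// expr2; nra.
Qed.

Lemma is_derive_coth_log p : 0 < p -> is_derive p 1 coth_log (- bose p).
Proof.
move=> p0.
have E1 : 0 < 1 - expR (- p) by rewrite subr_gt0 expR_lt1 oppr_lt0.
have dN : is_derive p 1 (fun q : R => - q) (-1) := is_deriveN (is_derive_id p (1 : R)).
have dE : is_derive p 1 (fun q : R => expR (- q)) (expR (- p) * -1).
  exact: (is_derive1_comp (is_derive_expR (- p)) dN).
have d1 : is_derive p 1 (fun q : R => 1 - expR (- q)) (0 - expR (- p) * -1).
  exact: (is_deriveB (is_derive_cst (1 : R) p (1 : R)) dE).
have d2 : is_derive p 1 (fun q => ln (1 - expR (- q))) ((1 - expR (- p))^-1 * (0 - expR (- p) * -1)).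
  exact: (@is_derive1_comp R (@ln R) (fun q : R => 1 - expR (- q)) p _ _ (is_derive1_ln E1) d1).
apply: (is_derive_eq (is_deriveN d2)).
rewrite /bose expRN; have := expR_gt0 p; have : 0 < expR p - 1 by rewrite subr_gt0 expR_gt1.
by move=> ? ?; field; rewrite !gt_eqF//; lra.
Qed.

Lemma is_derive_planck p : 0 < p -> is_derive p 1 planck (- planck_slope p).
Proof.
move=> p0; have E1 : expR p - 1 != 0 by rewrite gt_eqF// subr_gt0 expR_gt1.
have d1 : is_derive p 1 (fun q : R => expR q - 1) (expR p - 0).
  exact: (is_deriveB (is_derive_expR p) (is_derive_cst (1 : R) p (1 : R))).
have d2 := @is_deriveV R (fun q : R => expR q - 1) p _ 1 E1 d1.
apply: (is_derive_eq (is_deriveM (is_derive_id p (1 : R)) d2)).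
rewrite /planck_slope /bose [_ *: 1]mulr1 ![_ *: _]mulrA /=.
rewrite /GRing.scale/=; field; exact: E1.
Qed.

(** At s = |x|^2 this is a |x|^(3/2). For a power |x|^g the Laplacian of the kernel behaves like
    |x|^(g - 2) at the origin: square integrability asks for g > 1, and dominating the logarithmic
    singularity of the kernel asks for g < 2. The choice g = 3/2 also makes the Laplacian win at
    infinity, by a factor of order |x|. *)
Definition gauge a s : R := a * s `^ (3 / 4).

Lemma gauge_gt0 a s : 0 < a -> 0 < s -> 0 < gauge a s.
Proof. by move=> a0 s0; rewrite mulr_gt0// powR_gt0. Qed.

Lemma gauge_le a s t : 0 <= a -> 0 <= s -> s <= t -> gauge a s <= gauge a t.
Proof.
move=> a0 s0 st; rewrite ler_wpM2l//; apply: ge0_ler_powR; rewrite ?nnegrE ?divr_ge0//.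
exact: le_trans st.
Qed.

Lemma gauge_sqr a r : 0 < r -> gauge a (r ^+ 2) ^+ 2 = a ^+ 2 * r ^+ 3.
Proof.
move=> r0; rewrite exprMn; congr (_ * _).
have r0' := ltW r0.
have -> : (r ^+ 2) `^ (3 / 4) = r `^ (3 / 2).
  by rewrite -powR_mulrn// -powRrM; congr (_ `^ _); field.
by rewrite -(powR_mulrn 2 (powR_ge0 _ _)) -powRrM -(powR_mulrn 3 r0'); congr (_ `^ _); field.
Qed.

Lemma is_derive_gauge a s : 0 < s -> is_derive s 1 (gauge a) (3 / 4 * gauge a s / s).
Proof.
move=> s0; have d := @is_derive1_powR R (3 / 4) s s0.
apply: (is_derive_eq (is_deriveZ a d)).
have p0 : (0 : R) < 3 / 4 by rewrite divr_gt0.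
rewrite /gauge -(mulr_powRB1 (ltW s0) p0) /GRing.scale/=; field; exact: lt0r_neq0.
Qed.

(* The parametrix is [kern a (|x|^2)]: since [coth_log p] is [- ln p + o(1)] at [0], it has
   the singularity [- (3/2) ln |x|], and it decays like [expR (- a |x|^(3/2))]. *)
Definition kern a s := coth_log (gauge a s).
Definition kern1 a s := - (3 / 4) * planck (gauge a s) / s.
Definition kern2 a s :=
  3 / 4 * (planck (gauge a s) + 3 / 4 * (gauge a s * planck_slope (gauge a s))) / s ^+ 2.

(* [4 (s k'' + k')], the Laplacian of [x |-> k (|x|^2)]. *)
Definition kern_laplacian a s := 9 / 4 * (gauge a s * planck_slope (gauge a s)) / s.

Lemma is_derive_kern a s : 0 < a -> 0 < s -> is_derive s 1 (kern a) (kern1 a s).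
Proof.
move=> a0 s0; have g0 := gauge_gt0 a0 s0.
apply: (is_derive_eq (is_derive1_comp (is_derive_coth_log g0) (is_derive_gauge a s0))).
by rewrite /kern1 /planck; field; exact: lt0r_neq0.
Qed.

Lemma is_derive_kern1 a s : 0 < a -> 0 < s -> is_derive s 1 (kern1 a) (kern2 a s).
Proof.
move=> a0 s0; have g0 := gauge_gt0 a0 s0; have s_neq0 := lt0r_neq0 s0.
have d1 : is_derive s 1 (fun t => planck (gauge a t))
    (- planck_slope (gauge a s) * (3 / 4 * gauge a s / s)).
  exact: (is_derive1_comp (is_derive_planck g0) (is_derive_gauge a s0)).
have d2 : is_derive s 1 (fun t : R => t^-1) (- (s ^- 2) *: 1).
  exact: (@is_deriveV _ _ _ _ _ s_neq0 (is_derive_id s (1 : R))).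
have d3 : is_derive s 1 (fun t => - (3 / 4) * planck (gauge a t))
    (- (3 / 4) * (- planck_slope (gauge a s) * (3 / 4 * gauge a s / s))).
  exact: (is_deriveZ (- (3 / 4)) d1).
apply: (is_derive_eq (is_deriveM d3 d2)).
by rewrite /kern2 /GRing.scale/=; field.
Qed.

Lemma kern_laplacianE a s : 0 < s -> 4 * (s * kern2 a s + kern1 a s) = kern_laplacian a s.
Proof. by move=> s0; rewrite /kern2 /kern1 /kern_laplacian; field; exact: lt0r_neq0. Qed.

Lemma kern_gt0 a s : 0 < a -> 0 < s -> 0 < kern a s.
Proof. by move=> a0 s0; exact/coth_log_gt0/gauge_gt0. Qed.

Lemma kern_le a s t : 0 < a -> 0 < s -> s <= t -> kern a t <= kern a s.
Proof.
move=> a0 s0 st; have g0 := gauge_gt0 a0 s0; have g1 := gauge_le (ltW a0) (ltW s0) st.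
rewrite /kern /coth_log lerN2 ler_ln ?posrE ?subr_gt0 ?expR_lt1 ?oppr_lt0//.
  by rewrite lerB// ler_expR lerN2.
exact: lt_le_trans g1.
Qed.

(** Allows bounds to be checked on cubes, where the half-integer powers of r become polynomial in
    p^2 = a^2 r^3. *)
Lemma le_1Dcube (y D : R) : 0 <= y -> y ^+ 3 <= D -> y <= 1 + D.
Proof.
move=> y0 yD; have [y1|y1] := leP y 1; first by have := exprn_ge0 3 y0; lra.
by apply: le_trans (ler_eXnr _ (ltW y1)) (le_trans yD _) => //; rewrite lerDr.
Qed.

(** The weights r and r^3 are those of [integrable_radial]; the squares serve K in L^2 and the
    fourth powers K in L^4. *)
Lemma kern_bounds a : 1 <= a -> exists C : R, forall r, 0 < r ->
  [/\ kern a (r ^+ 2) ^+ 2 * r <= C, kern a (r ^+ 2) ^+ 2 * r ^+ 3 <= C,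
      kern a (r ^+ 2) ^+ 4 * r <= C & kern a (r ^+ 2) ^+ 4 * r ^+ 3 <= C].
Proof.
move=> a1; have [M ME] : exists M : R, M = 6`!%:R by exists 6`!%:R.
have M0 : 0 <= M by rewrite ME.
exists (1 + 2 * M + (6 * M) ^+ 2) => r r0; have a0 : 0 < a by lra.
have r20 : 0 < r ^+ 2 by rewrite exprn_gt0.
have := gauge_sqr a r0; have := gauge_gt0 a0 r20; rewrite /kern.
move: (gauge a _) => p p0 pr; have b0 := bose_gt0 p0.
have k0 := coth_log_gt0 p0; have k1 := coth_log_le p0; have k6 := coth_logX_le 5 p0.
have [b1 b2 b3] := And3 (bose_le 0 p0) (bose_le 1 p0) (bose_le 2 p0).
have pr3 : r ^+ 3 <= p ^+ 2.
  by rewrite pr; apply: ler_peMl; [rewrite exprn_ge0// ltW|exact: exprn_ege1].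
rewrite -ME in k6; rewrite (_ : 1`!%:R = 1)// expr1 in b1.
rewrite (_ : 2`!%:R = 2)// in b2; rewrite (_ : 3`!%:R = 6)// in b3.
move: (coth_log p) k0 k1 k6 => k k0 k1 k6; move: (bose p) b0 b1 b2 b3 k1 k6 => b b0 b1 b2 b3 k1 k6.
clear ME; have [b0' k0' p0' r0'] := And4 (ltW b0) (ltW k0) (ltW p0) (ltW r0).
have Mb0 : 0 <= M * b by exact: mulr_ge0.
have k12 : k ^+ 12 <= (M * b) ^+ 2.
  by rewrite (_ : 12 = 6 * 2)%N// exprM; apply: lerXn2r; rewrite ?nnegrE ?exprn_ge0.
have MM := sqr_ge0 (6 * M).
split.
- apply: le_trans (_ : 1 + 2 * M <= _); last lra.
  apply: le_1Dcube; rewrite ?mulr_ge0 ?exprn_ge0// exprMn -exprM; apply: le_trans (ler_pM _ _ k6 pr3) _; rewrite ?exprn_ge0//.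
  by rewrite [2 * M]mulrC -mulrA ler_wpM2l// mulrC.
- apply: le_trans (_ : 1 <= _); last lra.
  apply: le_trans (_ : b ^+ 2 * p ^+ 2 <= _).
    by apply: ler_pM; rewrite ?exprn_ge0//; apply: lerXn2r.
  by rewrite -exprMn mulrC expr_le1// mulr_ge0.
- apply: le_trans (_ : 1 + (M * 1) ^+ 2 <= _); last by nra.
  apply: le_1Dcube; rewrite ?mulr_ge0 ?exprn_ge0// exprMn -exprM; apply: le_trans (ler_pM _ _ k12 pr3) _; rewrite ?exprn_ge0//.
  rewrite -exprMn; apply: lerXn2r; rewrite ?nnegrE ?mulr_ge0//.
  by rewrite -mulrA ler_wpM2l// mulrC.
- apply: le_trans (_ : 1 + (6 * M) ^+ 2 <= _); last by nra.
  apply: le_1Dcube; rewrite ?mulr_ge0 ?exprn_ge0// exprMn -!exprM.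
  have pr9 : r ^+ (3 * 3) <= (p ^+ 3) ^+ 2.
    rewrite exprM (_ : p ^+ 3 ^+ 2 = p ^+ 2 ^+ 3); last by ring.
    by apply: lerXn2r; rewrite ?nnegrE ?exprn_ge0.
  apply: le_trans (ler_pM _ _ k12 pr9) _; rewrite ?exprn_ge0//.
  rewrite -exprMn; apply: lerXn2r; rewrite ?nnegrE ?mulr_ge0 ?exprn_ge0//.
  by rewrite [6 * M]mulrC -mulrA ler_wpM2l// mulrC.
Qed.

Lemma kern_laplacian_bounds a : 1 <= a -> exists C : R, forall r, 0 < r ->
  [/\ 0 <= kern_laplacian a (r ^+ 2), kern_laplacian a (r ^+ 2) ^+ 2 * r <= C
   & kern_laplacian a (r ^+ 2) ^+ 2 * r ^+ 3 <= C].
Proof.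
move=> a1; exists (9 ^+ 2 * a ^+ 2 * 5 ^+ 2) => r r0; have a0 : 0 < a by lra.
have r20 : 0 < r ^+ 2 by rewrite exprn_gt0.
have := gauge_sqr a r0; have := gauge_gt0 a0 r20; rewrite /kern_laplacian.
move: (gauge a _) => p p0 pr.
have [B0 B1 B2] := planck_slope_bounds p0; move: (planck_slope p) B0 B1 B2 => B B0 B1 B2.
have pB0 : 0 <= p * B by rewrite mulr_ge0// ltW.
have a20 := sqr_ge0 a.
have E : (9 / 4 * (p * B) / r ^+ 2) ^+ 2 = 81 / 16 * a ^+ 2 * B ^+ 2 / r.
  have -> : (9 / 4 * (p * B) / r ^+ 2) ^+ 2 = 81 / 16 * p ^+ 2 * B ^+ 2 / r ^+ 4.
    by field; exact: lt0r_neq0.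
  by rewrite pr; field; exact: lt0r_neq0.
(* Since r^3 <= p^2 and p B <= 2, the cube of r B is at most (p B)^2 B <= 4. *)
have rB : r * B <= 1 + 4.
  apply: le_1Dcube; first by rewrite mulr_ge0// ltW.
  have -> : (r * B) ^+ 3 = r ^+ 3 * B ^+ 2 * B by ring.
  have h1 : r ^+ 3 <= p ^+ 2.
    by rewrite pr; apply: ler_peMl; [rewrite exprn_ge0// ltW|exact: exprn_ege1].
  apply: le_trans (_ : p ^+ 2 * B ^+ 2 * 1 <= _).
    by rewrite ler_pM ?mulr_ge0 ?exprn_ge0 ?(ltW r0)// ler_wpM2r ?sqr_ge0.
  by rewrite mulr1 -exprMn expr2; nra.
have rB0 : 0 <= r * B by rewrite mulr_ge0// ltW.
have rB2 : (r * B) ^+ 2 <= 5 ^+ 2 by apply: lerXn2r; rewrite ?nnegrE; lra.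
have BB : B ^+ 2 <= 1 by rewrite expr_le1.
have BB0 := sqr_ge0 B.
rewrite E; split.
- by rewrite divr_ge0 ?(ltW r20)// mulr_ge0// divr_ge0.
- rewrite mulfVK ?gt_eqF//; nra.
- rewrite (_ : _ * r ^+ 3 = 81 / 16 * a ^+ 2 * (r * B) ^+ 2); last by field; exact: lt0r_neq0.
  by move: ((r * B) ^+ 2) rB2 => y; nra.
Qed.

(** [gauge a s / s] is a s^(-1/4), decreasing in s. A value at the shifted argument |x|^2 + d is
    thus dominated by an expression at |x|^2, uniformly in d. *)
Lemma kern_laplacian_le a s t : 0 < a -> 0 < s -> s <= t ->
  kern_laplacian a t <= 9 / 4 * gauge a s / s.
Proof.
move=> a0 s0 st; have t0 := lt_le_trans s0 st.
have [B0 B1 _] := planck_slope_bounds (gauge_gt0 a0 t0).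
have g0 := ltW (gauge_gt0 a0 t0).
have : gauge a t / t <= gauge a s / s.
  have q : (0 : R) < 3 / 4 by rewrite divr_gt0.
  rewrite /gauge -(mulr_powRB1 (ltW s0) q) -(mulr_powRB1 (ltW t0) q) mulrCA [t * _]mulrC.
  rewrite mulfK ?gt_eqF// mulrCA [s * _]mulrC mulfK ?gt_eqF// ler_pM2l//.
  rewrite (_ : 3 / 4 - 1 = - (1 / 4)); last by field.
  rewrite !powRN lef_pV2 ?posrE ?powR_gt0//; apply: ge0_ler_powR; rewrite ?nnegrE ?(ltW s0) ?(ltW t0)//.
rewrite /kern_laplacian; move: (planck_slope _) B0 B1 => B B0 B1 h.
have -> : 9 / 4 * (gauge a t * B) / t = 9 / 4 * (gauge a t / t) * B by ring.
have -> : 9 / 4 * gauge a s / s = 9 / 4 * (gauge a s / s) by ring.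
have q0 : (0 : R) <= 9 / 4 by rewrite divr_ge0.
apply: le_trans (_ : 9 / 4 * (gauge a t / t) * 1 <= _); last by rewrite mulr1 ler_wpM2l.
by rewrite ler_wpM2l// mulr_ge0// divr_ge0// ltW.
Qed.

Lemma kern2_bounds a s : 0 < a -> 0 < s ->
  0 <= kern2 a s /\ kern2 a s <= 2 / s ^+ 2.
Proof.
move=> a0 s0; have p0 := gauge_gt0 a0 s0; rewrite /kern2 /planck.
move: (gauge a s) p0 => p p0.
have [B0 _ B2] := planck_slope_bounds p0; have b0 := bose_gt0 p0; have b1 := bose_le 0 p0.
rewrite expr1 (_ : 1`!%:R = 1)// in b1.
have pb0 : 0 <= p * bose p by rewrite mulr_ge0 ?ltW.
have pB0 : 0 <= p * planck_slope p by rewrite mulr_ge0// ltW.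
have s20 : 0 < s ^+ 2 by rewrite exprn_gt0.
split.
- by rewrite divr_ge0 ?(ltW s20)// mulr_ge0 ?divr_ge0// addr_ge0// mulr_ge0// divr_ge0.
- by rewrite ler_pM2r ?invr_gt0//; move: (p * bose p) (p * planck_slope p) b1 B2 => *; lra.
Qed.

Lemma kern_le_laplacian (w : R) : 0 < w -> exists a, 1 <= a /\
  forall s, 0 < s -> w * kern a s <= kern_laplacian a s.
Proof.
move=> w0; have [c c0 kc] := coth_log_cube_le.
exists (1 + w * c); have wc : 0 < w * c by rewrite mulr_gt0.
split=> [|s s0]; first lra.
have a0 : 0 < 1 + w * c by lra.
have p0 := gauge_gt0 a0 s0; rewrite /kern_laplacian /kern.
have k0 := coth_log_gt0 p0; have kp := kc _ p0; have [B0 _ _] := planck_slope_bounds p0.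
pose y := gauge (1 + w * c) s / s.
have y0 : 0 < y by rewrite divr_gt0.
(* From p^4 = a^4 s^3. Cubing and multiplying by p turns the comparison into (w c)^3 <= a^4, which a
   = 1 + w c satisfies. *)
have y3 : y ^+ 3 * gauge (1 + w * c) s = (1 + w * c) ^+ 4.
  have r0 : 0 < Num.sqrt s by rewrite sqrtr_gt0.
  have sE : s = Num.sqrt s ^+ 2 by rewrite sqr_sqrtr// ltW.
  have := gauge_sqr (1 + w * c) r0; rewrite -sE /y.
  move: (gauge _ _) r0 sE => p; move: (Num.sqrt s) => r r0 sE pE.
  have -> : (p / s) ^+ 3 * p = p ^+ 2 ^+ 2 / s ^+ 3 by field; exact: lt0r_neq0.
  by rewrite pE sE; field; exact: lt0r_neq0.
move: y3; rewrite (_ : 9 / 4 * _ / s = 9 / 4 * (y * planck_slope (gauge (1 + w * c) s))); last first.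
  by rewrite /y; field; exact: lt0r_neq0.
move: (gauge _ _) (coth_log _) (planck_slope _) k0 kp B0 p0 => p k B k0 kp B0 p0 y3.
have yB0 : 0 <= y * B by rewrite mulr_ge0// ltW.
have wk0 : 0 <= w * k by rewrite mulr_ge0// ltW.
apply: le_trans (_ : y * B <= _); last lra.
rewrite -(@ler_pXn2r _ 3) ?nnegrE// -(ler_pM2r p0).
have B3 : 0 <= B ^+ 3 by rewrite exprn_ge0.
have -> : (y * B) ^+ 3 * p = y ^+ 3 * p * B ^+ 3 by ring.
have -> : (w * k) ^+ 3 * p = w ^+ 3 * (k ^+ 3 * p) by ring.
apply: le_trans (ler_wpM2l (exprn_ge0 3 (ltW w0)) kp) _.
rewrite y3 exprMn mulrA ler_wpM2r// -exprMn.
apply: le_trans (_ : (1 + w * c) ^+ 3 <= _).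
  by apply: lerXn2r; rewrite ?nnegrE; lra.
by rewrite [leRHS]exprS ler_peMl ?exprn_ge0//; lra.
Qed.

End profile.

(** * Integrable singularities *)

Lemma measurable_inv_ge0 d (T : measurableType d) (R : realType) (f : T -> R) :
  (forall x, 0 <= f x) -> measurable_fun setT f -> measurable_fun setT (fun x => (f x)^-1).
Proof.
move=> f0 mf; rewrite (_ : (fun x => _) = (fun r => r `^ (-1)) \o f).
  by apply: measurableT_comp => //; exact: measurable_powR.
by apply/funext => x /=; rewrite powR_inv1.
Qed.

Lemma measurable_sqrt_ge0 d (T : measurableType d) (R : realType) (f : T -> R) :
  (forall x, 0 <= f x) -> measurable_fun setT f -> measurable_fun setT (fun x => Num.sqrt (f x)).
Proof.
move=> f0 mf; rewrite (_ : (fun x => _) = (fun r => r `^ (2^-1)) \o f).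
  by apply: measurableT_comp => //; exact: measurable_powR.
by apply/funext => x /=; rewrite powR12_sqrt.
Qed.

Section majorant.
Context {R : realType}.
Local Notation mu1 := (@lebesgue_measure R).
Local Notation mu := (mu2 R).

(** The product of two such functions replaces polar coordinates: it is integrable by Tonelli and
    dominates a multiple of 1/(r + r^3). On the positive half-line the antiderivative is 2 atan
    (sqrt x). *)
Definition hyp (x : R) : R := (Num.sqrt `|x| * (1 + `|x|))^-1.

Lemma hyp_ge0 x : 0 <= hyp x.
Proof. by rewrite invr_ge0 mulr_ge0// addr_ge0. Qed.

Lemma measurable_hyp : measurable_fun setT hyp.
Proof.
apply: measurable_inv_ge0 => [x|]; first by rewrite mulr_ge0// addr_ge0.
apply: measurable_funM; last exact: measurable_funD.
by apply: measurable_sqrt_ge0.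
Qed.

Lemma continuous_hyp (x : R) : x != 0 -> {for x, continuous hyp}.
Proof.
move=> x0; have nx : 0 < `|x| by rewrite normr_gt0.
apply: cvgV; first by rewrite gt_eqF// mulr_gt0 ?sqrtr_gt0// addr_gt0.
apply: cvgM.
  by apply: (@continuous_comp _ _ _ (fun y : R => `|y|) Num.sqrt x);
    [exact: norm_continuous|exact: sqrt_continuous].
by apply: cvgD; [exact: cvg_cst|exact: norm_continuous].
Qed.

Lemma is_derive_atan_sqrt (x : R) : 0 < x ->
  is_derive x 1 (fun y => 2 * atan (Num.sqrt y)) (hyp x).
Proof.
move=> x0; have d1 := is_derive1_comp (is_derive1_atan (Num.sqrt x)) (is_derive1_sqrt x0).
apply: (is_derive_eq (is_deriveZ 2 d1)).
rewrite /hyp gtr0_norm// sqr_sqrtr ?ltW// /GRing.scale/=.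
have s0 : 0 < Num.sqrt x by rewrite sqrtr_gt0.
by field; rewrite !gt_eqF// addr_gt0.
Qed.

Lemma integral_hyp_itv (a b : R) : 0 < a -> a < b ->
  (\int[mu1]_(x in `[a, b]) (hyp x)%:E <= (2 * pi)%:E)%E.
Proof.
move=> a0 ab; pose F (y : R) := 2 * atan (Num.sqrt y).
have cF (x : R) : 0 < x -> F @ x --> F x.
  by move=> x0; apply: differentiable_continuous; apply/derivable1_diffP;
    have [] := is_derive_atan_sqrt x0.
rewrite (@continuous_FTC2 _ hyp F) //.
- rewrite -EFinB lee_fin /F; have := atan_ltpi2 (Num.sqrt b).
  have := atan_gtNpi2 (Num.sqrt a); have := pi_gt0 R; lra.
- apply: continuous_in_subspaceT => x; rewrite inE/= in_itv/= => /andP[ax _].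
  by apply: continuous_hyp; rewrite gt_eqF// (lt_le_trans a0).
- split.
  + move=> x; rewrite in_itv/= => /andP[ax _].
    by have [] := is_derive_atan_sqrt (lt_trans a0 ax).
  + by apply: cvg_at_right_filter; exact: cF.
  + by apply: cvg_at_left_filter; apply: cF; exact: lt_trans ab.
- move=> x; rewrite in_itv/= => /andP[ax _]; rewrite derive1E.
  by have [_ ->] := is_derive_atan_sqrt (lt_trans a0 ax).
Qed.

Lemma integral_hyp : (\int[mu1]_x (hyp x)%:E <= (4 * pi)%:E)%E.
Proof.
have mh : measurable_fun setT (EFin \o hyp) by apply/measurable_EFinP; exact: measurable_hyp.
pose P n : set R := `[n.+2%:R^-1, n.+2%:R]%classic.
pose Z : set R := [set x | x != 0].
pose N n : set R := `[- n.+2%:R, - n.+2%:R^-1]%classic.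
have n0 n : (0 : R) < n.+2%:R^-1 by rewrite invr_gt0.
have n1 n : (n.+2%:R^-1 : R) < n.+2%:R.
  by apply: (@lt_trans _ _ 1); rewrite ?invf_lt1 ?ltr1n.
have bP n : (\int[mu1]_(x in P n) (hyp x)%:E <= (2 * pi)%:E)%E by exact: integral_hyp_itv.
have bN n : (\int[mu1]_(x in N n) (hyp x)%:E <= (2 * pi)%:E)%E.
  rewrite integration_by_substitution_oppr//; last 2 first.
  - exact: ltW.
  - apply: continuous_in_subspaceT => x; rewrite inE/= in_itv/= => /andP[_ ax].
    by apply: continuous_hyp; rewrite lt_eqF// (le_lt_trans ax)// oppr_lt0.
  by rewrite (_ : hyp \o -%R = hyp); [exact: bP|apply/funext => x; rewrite /= /hyp normrN].
have bPN n : (\int[mu1]_(x in P n `|` N n) (hyp x)%:E <= (4 * pi)%:E)%E.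
  rewrite ge0_integral_setU//.
  - apply: le_trans (leeD (bP n) (bN n)) _; rewrite -EFinD lee_fin; lra.
  - exact: measurable_itv.
  - exact: measurable_itv.
  - exact: measurable_funS mh.
  - by move=> x _; rewrite lee_fin hyp_ge0.
  - apply/disj_set2P; rewrite -subset0 => x []; rewrite /P /N/= !in_itv/= => /andP[h1 _] /andP[_ h2].
    have := lt_le_trans (n0 n) (le_trans h1 h2); rewrite oppr_gt0 => h.
    by have := lt_trans h (n0 n); rewrite ltxx.
have nnd : {homo (fun n => P n `|` N n) : n m / (n <= m)%N >-> (n <= m)%O}.
  move=> n m nm; rewrite subsetEset => x.
  have h1 : n.+2%:R <= m.+2%:R :> R by rewrite ler_nat !ltnS.
  have h2 : m.+2%:R^-1 <= n.+2%:R^-1 :> R by rewrite lef_pV2 ?posrE.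
  case; rewrite /P /N/= in_itv/= => /andP[h3 h4]; [left|right]; rewrite /= in_itv/=; apply/andP; split.
  - exact: le_trans h3.
  - exact: le_trans h1.
  - by apply: le_trans h3; rewrite lerN2.
  - by apply: le_trans h4 _; rewrite lerN2.
have mPN n : measurable (P n `|` N n) by apply: measurableU; exact: measurable_itv.
have : (\int[mu1]_(x in P n `|` N n) (hyp x)%:E @[n --> \oo] -->
    \int[mu1]_(x in \bigcup_n (P n `|` N n)) (hyp x)%:E)%E.
  apply: ge0_nondecreasing_set_cvg_integral => //.
  - by move=> n; exact: measurable_funS mh.
  - by move=> n x _; rewrite lee_fin hyp_ge0.
rewrite (_ : \bigcup_n (P n `|` N n) = Z); last first.
  apply/seteqP; split => [x [n _]|x /= x0].
    case; rewrite /P /N/= in_itv/= => /andP[h1 h2].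
      by rewrite /Z/= gt_eqF// (lt_le_trans (n0 n)).
    by rewrite /Z/= lt_eqF// (le_lt_trans h2)// oppr_lt0.
  have nx : 0 < `|x| by rewrite normr_gt0.
  pose n := Num.truncn (`|x| + `|x|^-1).
  have := truncnS_gt (`|x| + `|x|^-1); rewrite -/n => nlt.
  have xn : `|x| <= n.+2%:R.
    have : 0 < `|x|^-1 by rewrite invr_gt0.
    have : n.+1%:R <= n.+2%:R :> R by rewrite ler_nat.
    by move: nlt; lra.
  have nx' : n.+2%:R^-1 <= `|x|.
    rewrite invf_ple ?posrE//.
    have : n.+1%:R <= n.+2%:R :> R by rewrite ler_nat.
    by move: nlt; lra.
  exists n => //; have [xp|xn'] := ltP 0 x.
    by left; rewrite /P/= in_itv/= -(gtr0_norm xp) nx'.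
  right; rewrite /N/= in_itv/=; move: xn nx'; rewrite ler0_norm// => h1 h2.
  by rewrite lerNl h1 lerNr h2.
(* At the origin [hyp] is the inverse of 0, hence 0, so leaving that point out does not change the
   integral. *)
move=> cv; have <- : (\int[mu1]_(x in Z) (hyp x)%:E = \int[mu1]_x (hyp x)%:E)%E.
  rewrite integral_mkcond; congr (integral _ _ _); apply/funext => x.
  rewrite patchE; case: ifPn => //; rewrite notin_setE /Z/= => /negP/negPn/eqP ->.
  by rewrite /hyp normr0 sqrtr0 mul0r invr0.
by apply: cvge_le cv; near=> n; exact: bPN.
Unshelve. all: by end_near. Qed.

Lemma integrable_hyp2 : mu.-integrable setT (fun x => (hyp x.1 * hyp x.2)%:E).
Proof.
have m1 : measurable_fun setT (fun x : plane R => hyp x.1).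
  exact: (measurableT_comp measurable_hyp measurable_fst).
have m2 : measurable_fun setT (fun x : plane R => hyp x.2).
  exact: (measurableT_comp measurable_hyp measurable_snd).
have mH : measurable_fun setT (fun x : plane R => (hyp x.1 * hyp x.2)%:E).
  by apply/measurable_EFinP; exact: measurable_funM.
apply/integrableP; split => //.
under eq_integral do rewrite gee0_abs ?lee_fin ?mulr_ge0 ?hyp_ge0//.
rewrite fubini_tonelli1//; last by move=> x; rewrite lee_fin mulr_ge0 ?hyp_ge0.
rewrite /fubini_F /=.
have mh : measurable_fun setT (EFin \o hyp) by apply/measurable_EFinP; exact: measurable_hyp.
have h0 x : (0 <= (hyp x)%:E)%E by rewrite lee_fin hyp_ge0.
under eq_integral do under eq_integral do rewrite EFinM.
under eq_integral do rewrite ge0_integralZl ?lee_fin ?hyp_ge0//.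
rewrite ge0_integralZr//; last exact: integral_ge0.
apply: le_lt_trans (lee_pmul _ _ integral_hyp integral_hyp) _; rewrite ?integral_ge0//.
by rewrite -EFinM ltry.
Qed.

Lemma ae_fst_neq0 : {ae mu, forall x, x.1 != 0}.
Proof.
exists ([set 0] `*` setT); split.
- by apply: measurableX => //; exact: measurable_set1.
- apply: (etrans (product_measure1E _ _ _ _)); [exact: measurable_set1|exact: measurableT|].
  exact: etrans (congr2 mule (lebesgue_measure_set1 _) erefl) (mul0e _).
- by move=> [a b] /= /negP/negPn/eqP ->.
Qed.

Lemma ae_snd_neq0 : {ae mu, forall x, x.2 != 0}.
Proof.
exists (setT `*` [set 0]); split.
- by apply: measurableX => //; exact: measurable_set1.
- apply: (etrans (product_measure1E _ _ _ _)); [exact: measurableT|exact: measurable_set1|].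
  exact: etrans (congr2 mule erefl (lebesgue_measure_set1 _)) (mule0 _).
- by move=> [a b] /= /negP/negPn/eqP ->.
Qed.

Lemma ae_axes : {ae mu, forall x, x.1 != 0 /\ x.2 != 0}.
Proof.
apply: negligibleS (negligibleU ae_fst_neq0 ae_snd_neq0) => x /= h.
by apply: contrapT => /not_orP[/contrapT h1 /contrapT h2]; exact: h.
Qed.

Definition sqn (x : R * R) : R := x.1 ^+ 2 + x.2 ^+ 2.

Definition eucl (x : R * R) : R := Num.sqrt (sqn x).

Lemma sqn_ge0 x : 0 <= sqn x.
Proof. by rewrite addr_ge0 ?sqr_ge0. Qed.

Lemma sqr_eucl x : eucl x ^+ 2 = sqn x.
Proof. by rewrite sqr_sqrtr// sqn_ge0. Qed.

Lemma eucl_ge0 x : 0 <= eucl x. Proof. exact: sqrtr_ge0. Qed.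

Lemma le_eucl x : `|x.1| <= eucl x /\ `|x.2| <= eucl x.
Proof.
by split; apply: norm_le_of_sqr_le (eucl_ge0 x) _; rewrite sqr_eucl /sqn ?lerDl ?lerDr sqr_ge0.
Qed.

Lemma eucl_gt0 x : x.1 != 0 -> 0 < eucl x.
Proof. by move=> x0; apply: lt_le_trans (le_eucl x).1; rewrite normr_gt0. Qed.

Lemma hyp2_ge x : x.1 != 0 -> x.2 != 0 ->
  1 <= hyp x.1 * hyp x.2 * (4 * (eucl x + eucl x ^+ 3)).
Proof.
move=> x1 x2; have [a1 a2] : 0 < `|x.1| /\ 0 < `|x.2| by rewrite !normr_gt0.
have [l1 l2] := le_eucl x; rewrite /hyp -invfM ler_pdivlMl; last first.
  by rewrite !mulr_gt0 ?sqrtr_gt0// addr_gt0.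
rewrite mulr1 mulrACA -sqrtrM//.
move: (eucl x) l1 l2 => r; move: `|x.1| `|x.2| a1 a2 => a b a0 b0 l1 l2.
have r0 : 0 < r by exact: lt_le_trans l1.
have h : Num.sqrt (a * b) <= r.
  by rewrite -(ger0_norm (ltW r0)) -sqrtr_sqr ler_wsqrtr// expr2 ler_pM// ltW.
have -> : 4 * (r + r ^+ 3) = r * (4 * (1 + r ^+ 2)) by ring.
apply: ler_pM => //; first by rewrite mulr_ge0// addr_ge0// ltW.
apply: le_trans (_ : (1 + r) * (1 + r) <= _); first by apply: ler_pM; rewrite ?lerD2l// addr_ge0// ltW.
by have := sqr_ge0 (r - 1); nra.
Qed.

(** The weight r controls the singularity at the origin and r^3 the decay at infinity. The sum |G|
    (r + r^3) <= 2 C and the factor 4 of [hyp2_ge] give the constant 8 C. *)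
Lemma integrable_radial (G : plane R -> R) (C : R) : measurable_fun setT G ->
  (forall x, x.1 != 0 -> `|G x| * eucl x <= C) ->
  (forall x, x.1 != 0 -> `|G x| * eucl x ^+ 3 <= C) ->
  mu.-integrable setT (EFin \o G).
Proof.
move=> mG G1 G3.
have aeH : {ae mu, forall x, setT x ->
    (`|(EFin \o G) x| <= `|(8 * C)%:E * (hyp x.1 * hyp x.2)%:E|)%E}.
  apply: negligibleS ae_axes => x /= h [x1 x2]; apply: h => _.
  rewrite /= lee_fin; have h := hyp2_ge x1 x2; have h1 := G1 x x1; have h3 := G3 x x1.
  have H0 : 0 <= hyp x.1 * hyp x.2 by rewrite mulr_ge0 ?hyp_ge0.
  apply: le_trans _ (ler_norm _); move: (hyp x.1 * hyp x.2) H0 h => H H0 h.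
  move: `|G x| (normr_ge0 (G x)) h1 h3 => g g0; move: (eucl x) h => r h h1 h3.
  have := ler_wpM2l g0 h; rewrite mulr1 => h'; apply: le_trans h' _.
  have -> : g * (H * (4 * (r + r ^+ 3))) = H * (4 * (g * r + g * r ^+ 3)) by ring.
  by rewrite [leRHS]mulrC ler_wpM2l//; lra.
have mEG : measurable_fun setT (EFin \o G) by exact/measurable_EFinP.
have := integrableZl measurableT (8 * C) integrable_hyp2 => /integrableP[mH fH].
apply/integrableP; split => //; apply: le_lt_trans fH.
apply: ae_ge0_le_integral => //.
- exact: measurableT_comp.
- exact: measurableT_comp.
Qed.

End majorant.

(** * Green identity for radial functions *)

Section parametrix.
Context {R : realType}.
Local Notation mu := (mu2 R).
Local Notation ip := (ip mu).
Local Notation L2 := (L2 mu).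
Implicit Types (f g h : plane R -> R) (psi phi : R * R -> R) (e : R * R) (a d B M t : R).

Lemma continuous_supported_bounded psi B : continuous psi -> supported_in B psi ->
  exists2 M, 0 <= M & forall x, `|psi x| <= M.
Proof.
move=> cp sB.
have [M [Mr hM]] := compact_bounded (continuous_compact (continuous_subspaceT cp)
  (compact_setX (@segment_compact R (- B) B) (@segment_compact R (- B) B))).
exists (Num.max 0 (M + 1)) => [|x]; first by rewrite le_max lexx.
have [->|p0] := eqVneq (psi x) 0; first by rewrite normr0 le_max lexx.
rewrite le_max; apply/orP; right; apply: (hM (M + 1)); first by rewrite ltrDl.
exists x => //; have [h1 h2] := sB x p0.
by split; rewrite /= in_itv/= -ler_norml.
Qed.

Lemma supported_integrable psi B M : measurable_fun setT (psi : plane R -> R) ->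
  supported_in B psi -> (forall x, `|psi x| <= M) -> mu.-integrable setT (EFin \o psi).
Proof.
move=> mpsi sB bM.
pose D : set (plane R) := obox (- B - 1) (B + 1) (- B - 1) (B + 1).
have mD : measurable D := measurable_obox _ _ _ _.
have M0 : 0 <= M := le_trans (normr_ge0 _) (bM (0, 0)).
apply: (@le_integrable _ _ _ mu setT measurableT _ (fun x => (M * \1_D x)%:E)).
- exact/measurable_EFinP.
- move=> x _ /=; rewrite lee_fin [leRHS]ger0_norm ?mulr_ge0//.
  have [->|p0] := eqVneq (psi x) 0; first by rewrite normr0 mulr_ge0.
  have [/ler_normlP[h1 h2] /ler_normlP[h3 h4]] := sB x p0.
  rewrite indicE mem_set ?mulr1//; split; rewrite /= in_itv/=; apply/andP; split; lra.
- exact: (integrableZl measurableT M (integrable_indic_box _ _ _ _)).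
Qed.

Lemma supported_shift psi B e (t : R) : axis e -> supported_in B psi ->
  supported_in (B + `|t|) (fun x => psi (x + t *: e)).
Proof.
move=> ax sB x /sB[h1 h2]; have [k1 k2] := axis_dist x t ax.
by split; [apply: le_trans k1 _|apply: le_trans k2 _]; rewrite lerD2r.
Qed.

(** By translation invariance the integral of psi (x + t e) is constant in t; its derivative at t =
    0 is the integral in question. *)
Lemma Rintegral_derive_eq0 psi psi' B M e : axis e -> continuous psi ->
  (forall x, is_derive x e psi (psi' x)) -> supported_in B psi -> (forall x, `|psi' x| <= M) ->
  \int[mu]_x psi' x = 0.
Proof.
move=> ax cp dp sB bM; have [N N0 bN] := continuous_supported_bounded cp sB.
have sB' : supported_in B psi'.
  have -> : psi' = 'D_e psi by apply/funext => x; have [_ ->] := dp x.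
  exact: supported_in_derive.
pose D : set (plane R) := obox (- (B + 2)) (B + 2) (- (B + 2)) (B + 2).
have mp : measurable_fun setT (psi : plane R -> R) := continuous_measurable_plane cp.
have ip0 : mu.-integrable setT (EFin \o psi) := supported_integrable mp sB bN.
have zt (t : R) : shiftf (t *: e) psi = (fun x : R * R => psi (x + t *: e)).
  by apply/funext => x.
have cpt (t : R) : continuous (fun x : R * R => psi (x + t *: e)).
  by move=> x; apply: (@continuous_comp _ _ _ (fun x : R * R => x + t *: e) psi);
    [apply: cvgD; [exact: cvg_id|exact: cvg_cst]|exact: cp].
have M0 : 0 <= M := le_trans (normr_ge0 _) (bM (0, 0)).
have H : is_derive (0 : R) 1 (fun t => \int[mu]_x psi ((x : R * R) + t *: e))
    (\int[mu]_x psi' ((x : R * R) + (0 : R) *: e)).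
  apply: (@is_derive_integral _ _ _ mu (fun t x => psi ((x : R * R) + t *: e))
    (fun t x => psi' ((x : R * R) + t *: e)) 0 (fun x => M * \1_D x)).
  - move=> t _; apply: supported_integrable (fun x => bN (x + t *: e)).
      exact: continuous_measurable_plane (cpt t).
    exact: supported_shift sB.
  - by move=> t x _; exact: (is_derive_lineP e psi x t _).1.
  - exact: (integrableZl measurableT M (integrable_indic_box _ _ _ _)).
  - move=> t x; rewrite subr0 => t1.
    have [->|p0] := eqVneq (psi' (x + t *: e)) 0; first by rewrite normr0 mulr_ge0.
    have [h1 h2] := supported_shift ax sB' p0.
    rewrite indicE mem_set ?mulr1//.
    by split; rewrite /= in_itv/= -ltr_norml; lra.
have E0 : (fun x : plane R => psi' ((x : R * R) + (0 : R) *: e)) = psi'.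
  by apply/funext => x; rewrite scale0r addr0.
rewrite E0 in H.
have Ec : (fun t => \int[mu]_x psi ((x : R * R) + t *: e)) = cst (\int[mu]_x psi x).
  by apply/funext => t; rewrite -(Rintegral_shift (t *: e) mp ip0).
rewrite Ec in H; have [_ <-] := H; exact: derive_cst.
Qed.

(** * Green identity for the regularised kernel *)

Section smoothing.
Variables (a d : R).
Hypotheses (a0 : 0 < a) (d0 : 0 < d).

Lemma continuous_sqn (r : R) : continuous (fun x : R * R => sqn x + r).
Proof.
move=> x; apply: cvgD; last exact: cvg_cst.
by apply: cvgD; rewrite expr2; apply: cvgM; first [exact: cvg_fst|exact: cvg_snd].
Qed.

Lemma sqnD_gt0 x : 0 < sqn x + d.
Proof. by rewrite ltr_wpDl// sqn_ge0. Qed.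

Lemma continuous_radial (f f' : R -> R) : (forall s : R, 0 < s -> is_derive s 1 f (f' s)) ->
  continuous (fun x : R * R => f (sqn x + d)).
Proof.
move=> df x; apply: (@continuous_comp _ _ _ (fun x : R * R => sqn x + d) f).
  exact: continuous_sqn.
by apply: differentiable_continuous; apply/derivable1_diffP; have [] := df _ (sqnD_gt0 x).
Qed.

Lemma is_derive_radial1 (f f' : R -> R) x : (forall s : R, 0 < s -> is_derive s 1 f (f' s)) ->
  is_derive x e1 (fun y => f (sqn y + d)) (2 * x.1 * f' (sqn x + d)).
Proof.
move=> df; apply/is_derive_line0.
rewrite (_ : (fun s : R => _) = (fun s : R => f ((x.1 + s) ^+ 2 + x.2 ^+ 2 + d))); last first.
  by apply/funext => s; rewrite adde1E.
have dq : is_derive (0 : R) 1 (fun s : R => (x.1 + s) ^+ 2 + x.2 ^+ 2 + d) (2 * x.1).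
  have dx := is_deriveD (is_derive_cst x.1 (0 : R) (1 : R)) (is_derive_id (0 : R) (1 : R)).
  have := is_deriveD (is_deriveD (is_deriveX 2 dx) (is_derive_cst (x.2 ^+ 2) (0 : R) (1 : R)))
    (is_derive_cst d (0 : R) (1 : R)).
  by move=> h; apply: (is_derive_eq h); rewrite -[(cst x.1 + id) 0]/(x.1 + 0) !addr0 !add0r expr1 /GRing.scale/= mulr1.
have d2 : is_derive ((x.1 + 0) ^+ 2 + x.2 ^+ 2 + d) 1 f (f' (sqn x + d)).
  by rewrite addr0; exact: (df _ (sqnD_gt0 x)).
rewrite mulrC; exact: (@is_derive1_comp R f (fun s : R => (x.1 + s) ^+ 2 + x.2 ^+ 2 + d) 0 _ _ d2 dq).
Qed.

Lemma is_derive_radial2 (f f' : R -> R) x : (forall s : R, 0 < s -> is_derive s 1 f (f' s)) ->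
  is_derive x e2 (fun y => f (sqn y + d)) (2 * x.2 * f' (sqn x + d)).
Proof.
move=> df; apply/is_derive_line0.
rewrite (_ : (fun s : R => _) = (fun s : R => f (x.1 ^+ 2 + (x.2 + s) ^+ 2 + d))); last first.
  by apply/funext => s; rewrite adde2E.
have dq : is_derive (0 : R) 1 (fun s : R => x.1 ^+ 2 + (x.2 + s) ^+ 2 + d) (2 * x.2).
  have dx := is_deriveD (is_derive_cst x.2 (0 : R) (1 : R)) (is_derive_id (0 : R) (1 : R)).
  have := is_deriveD (is_deriveD (is_derive_cst (x.1 ^+ 2) (0 : R) (1 : R)) (is_deriveX 2 dx))
    (is_derive_cst d (0 : R) (1 : R)).
  by move=> h; apply: (is_derive_eq h); rewrite -[(cst x.2 + id) 0]/(x.2 + 0) !addr0 !add0r expr1 /GRing.scale/= mulr1.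
have d2 : is_derive (x.1 ^+ 2 + (x.2 + 0) ^+ 2 + d) 1 f (f' (sqn x + d)).
  by rewrite addr0; exact: (df _ (sqnD_gt0 x)).
rewrite mulrC; exact: (@is_derive1_comp R f (fun s : R => x.1 ^+ 2 + (x.2 + s) ^+ 2 + d) 0 _ _ d2 dq).
Qed.

(** Component along e of k grad psi - psi grad k, for k the kernel evaluated at |x|^2 + d; c is the
    coordinate along e, so 2 c [kern1] is the derivative of k in that direction. *)
Definition psi_flux e (c : R * R -> R) psi : R * R -> R := fun x =>
  kern a (sqn x + d) * 'D_e psi x - 2 * c x * kern1 a (sqn x + d) * psi x.

Lemma kern_norm_le (s : R) : d <= s -> `|kern a s| <= kern a d.
Proof.
move=> ds; rewrite (gtr0_norm (kern_gt0 a0 (lt_le_trans d0 ds))).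
exact: kern_le.
Qed.

Lemma kern2_norm_le (s : R) : d <= s -> `|4 * d * kern2 a s| <= 4 * d * (2 / d ^+ 2).
Proof.
move=> ds; have s0 := lt_le_trans d0 ds; have [k20 k2s] := kern2_bounds a0 s0.
have d4 : 0 <= 4 * d by rewrite mulr_ge0// ltW.
rewrite (ger0_norm (mulr_ge0 d4 k20)); apply: (ler_wpM2l d4); apply: le_trans k2s _.
rewrite ler_wpM2l// lef_pV2 ?posrE ?exprn_gt0//.
by apply: lerXn2r; [rewrite nnegrE ltW|rewrite nnegrE ltW|].
Qed.

(** For c a coordinate and s = |x|^2 + d, the expression is the second derivative of the regularised
    kernel along that axis. *)
Lemma flux_coeff_le (c s : R) : d <= s -> c ^+ 2 <= s ->
  `|2 * kern1 a s + 4 * c ^+ 2 * kern2 a s| <= 2 / d + 8 / d.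
Proof.
move=> ds cs; have s0 := lt_le_trans d0 ds; have [k20 k2s] := kern2_bounds a0 s0.
have sd : s^-1 <= d^-1 by rewrite lef_pV2.
apply: le_trans (ler_normD _ _) _; apply: lerD.
  have p0 := gauge_gt0 a0 s0; have b0 := bose_gt0 p0; have b1 := bose_le 0 p0.
  rewrite expr1 (_ : 1`!%:R = 1)// -/(planck _) in b1.
  have pl0 : 0 <= planck (gauge a s) by rewrite mulr_ge0 ?ltW.
  have s0' : 0 <= s^-1 by rewrite invr_ge0 ltW.
  rewrite normrM ger0_norm// ler_wpM2l// /kern1.
  have -> : - (3 / 4) * planck (gauge a s) / s = - (3 / 4 * planck (gauge a s) / s) by ring.
  have x0 : 0 <= 3 / 4 * planck (gauge a s) / s by rewrite mulr_ge0// mulr_ge0// divr_ge0.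
  rewrite normrN ger0_norm//; apply: le_trans sd; rewrite ler_piMl//.
  by move: (planck _) b1 => *; lra.
have c20 := sqr_ge0 c.
rewrite ger0_norm; last by rewrite mulr_ge0// mulr_ge0.
have h : 4 * c ^+ 2 * kern2 a s <= 4 * s * (2 / s ^+ 2).
  by apply: ler_pM; [rewrite mulr_ge0|exact: k20|rewrite ler_wpM2l|exact: k2s].
apply: le_trans h _.
have -> : 4 * s * (2 / s ^+ 2) = 8 / s by field; exact: lt0r_neq0.
by rewrite ler_wpM2l.
Qed.

Lemma green_identity_axis e (c : R * R -> R) psi : axis e -> test_function psi ->
  continuous c -> (forall x, is_derive x e c 1) -> (forall x, `|c x| <= eucl x) ->
  (forall (f f' : R -> R) x, (forall s : R, 0 < s -> is_derive s 1 f (f' s)) ->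
     is_derive x e (fun y => f (sqn y + d)) (2 * c x * f' (sqn x + d))) ->
  \int[mu]_x (kern a (sqn x + d) * 'D_e ('D_e psi) x -
     (2 * kern1 a (sqn x + d) + 4 * c x ^+ 2 * kern2 a (sqn x + d)) * psi x) = 0.
Proof.
move=> ax tp cc dc cr dr.
have tD := axis_test ax tp; have tDD := axis_test ax tD.
have /test_functionP[_ [B sB]] := tp.
have [M M0 bM] := test_bounded tDD; have [N N0 bN] := test_bounded tp.
have dk (s : R) : 0 < s -> is_derive s 1 (kern a) (kern1 a s) by exact: is_derive_kern.
have dk1 (s : R) : 0 < s -> is_derive s 1 (kern1 a) (kern2 a s) by exact: is_derive_kern1.
apply: (@Rintegral_derive_eq0 (psi_flux e c psi) _ B (kern a d * M + (2 / d + 8 / d) * N) e) => //.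
- move=> x; apply: cvgB; apply: cvgM; [exact: (continuous_radial dk)|exact: (test_continuous tD)| |exact: (test_continuous tp)].
  by apply: cvgM; [apply: cvgM; [exact: cvg_cst|exact: cc]|exact: (continuous_radial dk1)].
- move=> x.
  have dp : is_derive x e psi ('D_e psi x) by apply: DeriveDef => //; exact: axis_derivable.
  have dDp : is_derive x e ('D_e psi) ('D_e ('D_e psi) x).
    by apply: DeriveDef => //; exact: axis_derivable.
  have h1 := is_deriveM (dr _ _ x dk) dDp.
  have h0 : is_derive x e (fun y => 2 * c y) (2 * 1) := is_deriveZ 2 (dc x).
  have h3 : is_derive x e (fun y => 2 * c y * kern1 a (sqn y + d))
      (2 * c x * (2 * c x * kern2 a (sqn x + d)) + kern1 a (sqn x + d) * (2 * 1)).
    exact: (is_deriveM h0 (dr _ _ x dk1)).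
  have h2 := is_deriveM h3 dp.
  apply: (is_derive_eq (is_deriveB h1 h2)); rewrite /GRing.scale/=; ring.
- move=> x; rewrite /psi_flux; apply: contraNP => nB.
  have p0 : psi x = 0 by apply/eqP; apply: contra_notT nB; exact: sB.
  have D0 : 'D_e psi x = 0 by apply/eqP; apply: contra_notT nB; exact: supported_in_derive.
  by rewrite p0 D0 !mulr0 subrr.
- move=> x; have s0 := sqnD_gt0 x; have sd : d <= sqn x + d by rewrite lerDr sqn_ge0.
  have h1 := kern_norm_le sd.
  have c2 : c x ^+ 2 <= sqn x + d.
    apply: le_trans (_ : sqn x <= _); last by rewrite lerDl ltW.
    by rewrite -sqr_eucl -[leLHS]real_normK ?num_real//; apply: lerXn2r; rewrite ?nnegrE ?eucl_ge0.
  have h2 := flux_coeff_le sd c2.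
  apply: le_trans (ler_normB _ _) _; rewrite normrM [X in _ + X]normrM.
  exact: lerD (ler_pM (normr_ge0 _) (normr_ge0 _) h1 (bM x))
              (ler_pM (normr_ge0 _) (normr_ge0 _) h2 (bN x)).
Qed.

Lemma measurable_sqn : measurable_fun setT (sqn : plane R -> R).
Proof.
apply: measurable_funD; apply: measurable_funX.
  exact: measurable_fst.
exact: measurable_snd.
Qed.

Lemma measurable_gauge (S : plane R -> R) : measurable_fun setT S ->
  measurable_fun setT (fun x => gauge a (S x)).
Proof.
by move=> mS; apply: measurable_funM => //; exact: measurableT_comp (measurable_powR _) mS.
Qed.

Lemma gauge_ge0 s : 0 <= gauge a s.
Proof. by rewrite mulr_ge0 ?powR_ge0// ltW. Qed.

Lemma measurable_kern (S : plane R -> R) : measurable_fun setT S ->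
  measurable_fun setT (fun x => kern a (S x)).
Proof.
move=> /measurable_gauge mG; rewrite /kern /coth_log.
apply: measurable_funN; apply: (measurableT_comp (@measurable_ln R)).
apply: measurable_funB => //; apply: (measurableT_comp (@measurable_expR R)).
exact: measurable_funN.
Qed.

Lemma measurable_bose (S : plane R -> R) : measurable_fun setT S ->
  measurable_fun setT (fun x => bose (gauge a (S x))).
Proof.
move=> /measurable_gauge mG; apply: measurable_inv_ge0 => [x|].
  by rewrite subr_ge0 -expR0 ler_expR gauge_ge0.
by apply: measurable_funB => //; exact: measurableT_comp mG.
Qed.

Lemma measurable_gauge_slope (S : plane R -> R) : measurable_fun setT S ->
  measurable_fun setT (fun x => gauge a (S x) * planck_slope (gauge a (S x))).
Proof.
move=> mS; have mG := measurable_gauge mS; have mE := measurableT_comp (@measurable_expR R) mG.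
apply: measurable_funM => //; apply: measurable_funM.
  exact: measurable_funX (measurable_bose mS).
by apply: measurable_funD => //; apply: measurable_funB => //; exact: measurable_funM.
Qed.

Lemma measurable_kern_laplacian (S : plane R -> R) : (forall x, 0 <= S x) ->
  measurable_fun setT S -> measurable_fun setT (fun x => kern_laplacian a (S x)).
Proof.
move=> S0 mS; apply: measurable_funM; last exact: measurable_inv_ge0.
by apply: measurable_funM => //; exact: measurable_gauge_slope.
Qed.

Lemma measurable_kern2 (S : plane R -> R) : measurable_fun setT S ->
  measurable_fun setT (fun x => kern2 a (S x)).
Proof.
move=> mS; apply: measurable_funM; last first.
  by apply: measurable_inv_ge0 => [x|]; [rewrite sqr_ge0|exact: measurable_funX].
apply: measurable_funM => //; apply: measurable_funD.
  by apply: measurable_funM; [exact: measurable_gauge|exact: measurable_bose].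
by apply: measurable_funM => //; exact: measurable_gauge_slope.
Qed.

Lemma measurable_kern1 (S : plane R -> R) : (forall x, 0 <= S x) -> measurable_fun setT S ->
  measurable_fun setT (fun x => kern1 a (S x)).
Proof.
move=> S0 mS; apply: measurable_funM; last exact: measurable_inv_ge0.
apply: measurable_funM => //; apply: measurable_funM; first exact: measurable_gauge.
exact: measurable_bose.
Qed.

Lemma bounded_test_integrable f psi M : measurable_fun setT f -> (forall x, `|f x| <= M) ->
  test_function psi -> mu.-integrable setT (EFin \o (fun x => f x * psi x)).
Proof.
move=> mf fM tp; have [N N0 bN] := test_bounded tp; have /test_functionP[_ [B sB]] := tp.
apply: (@supported_integrable _ B (M * N)).
- by apply: measurable_funM => //; exact: test_measurable.
- by move=> x; rewrite mulf_eq0 negb_or => /andP[_ /sB].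
- by move=> x; rewrite normrM ler_pM.
Qed.

Lemma kern_laplacian_ge0 (s : R) : 0 < s -> 0 <= kern_laplacian a s.
Proof.
move=> s0; have p0 := gauge_gt0 a0 s0; have [B0 _ _] := planck_slope_bounds p0.
by rewrite divr_ge0 ?(ltW s0)// mulr_ge0 ?divr_ge0// mulr_ge0// ltW.
Qed.

(** The Laplacian of k(|x|^2 + d) is 4 (|x|^2 k'' + k'), that is [kern_laplacian] at the shifted
    argument minus 4 d k''. The last term carries the point mass in the limit d -> 0. *)
Lemma green_identity psi : test_function psi ->
  \int[mu]_x (kern a (sqn x + d) * laplacian psi x) =
  \int[mu]_x (kern_laplacian a (sqn x + d) * psi x)
  - \int[mu]_x (4 * d * kern2 a (sqn x + d) * psi x).
Proof.
move=> tp; have [td1 td2] := (test_D1 tp, test_D2 tp).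
have [tdd1 tdd2] := (test_D1 td1, test_D2 td2).
have s0 x := sqnD_gt0 x; have s0' x := ltW (s0 x).
have sd x : d <= sqn x + d by rewrite lerDr sqn_ge0.
have mS : measurable_fun setT (fun x : plane R => sqn x + d).
  by apply: measurable_funD => //; exact: measurable_sqn.
have [mk mk1 mk2] := And3 (measurable_kern mS) (measurable_kern1 s0' mS) (measurable_kern2 mS).
have mkl := measurable_kern_laplacian s0' mS.
have kb x := kern_norm_le (sd x).
have i1 := bounded_test_integrable mk kb tdd1.
have i2 := bounded_test_integrable mk kb tdd2.
have c1 x : x.1 ^+ 2 <= sqn x + d by rewrite /sqn -addrA lerDl addr_ge0 ?sqr_ge0 ?ltW.
have c2 x : x.2 ^+ 2 <= sqn x + d by rewrite /sqn addrAC lerDr addr_ge0 ?sqr_ge0 ?ltW.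
have mc (c : plane R -> R) : measurable_fun setT c ->
    measurable_fun setT (fun x => 2 * kern1 a (sqn x + d) + 4 * c x ^+ 2 * kern2 a (sqn x + d)).
  move=> m; apply: measurable_funD; apply: measurable_funM => //.
  by apply: measurable_funM => //; exact: measurable_funX.
have j1 := bounded_test_integrable (mc _ measurable_fst) (fun x => flux_coeff_le (sd x) (c1 x)) tp.
have j2 := bounded_test_integrable (mc _ measurable_snd) (fun x => flux_coeff_le (sd x) (c2 x)) tp.
have klb x : `|kern_laplacian a (sqn x + d)| <= 9 / 4 * gauge a d / d.
  rewrite (ger0_norm (kern_laplacian_ge0 (s0 x))); exact: kern_laplacian_le.
have k2b x : `|4 * d * kern2 a (sqn x + d)| <= 4 * d * (2 / d ^+ 2).
  exact: kern2_norm_le (sd x).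
have il := bounded_test_integrable mkl klb tp.
have mk2d : measurable_fun setT (fun x : plane R => 4 * d * kern2 a (sqn x + d)).
  exact: measurable_funM.
have i3 := bounded_test_integrable mk2d k2b tp.
have G1 : \int[mu]_x (kern a (sqn x + d) * 'D_e1 ('D_e1 psi) x) =
    \int[mu]_x ((2 * kern1 a (sqn x + d) + 4 * x.1 ^+ 2 * kern2 a (sqn x + d)) * psi x).
  apply/eqP; rewrite -subr_eq0 -(RintegralB measurableT i1 j1); apply/eqP.
  apply: (@green_identity_axis e1 fst psi (or_introl erefl) tp).
  - by move=> x; exact: cvg_fst.
  - move=> x; apply/is_derive_line0.
    rewrite (_ : (fun s : R => _) = cst x.1 + id); last first.
      by apply/funext => s; rewrite adde1E.
    rewrite -[1 in X in is_derive _ _ _ X]add0r.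
    exact: (is_deriveD (is_derive_cst x.1 (0 : R) (1 : R)) (is_derive_id (0 : R) (1 : R))).
  - by move=> x; have [] := le_eucl x.
  - by move=> f f' x; exact: is_derive_radial1.
have G2 : \int[mu]_x (kern a (sqn x + d) * 'D_e2 ('D_e2 psi) x) =
    \int[mu]_x ((2 * kern1 a (sqn x + d) + 4 * x.2 ^+ 2 * kern2 a (sqn x + d)) * psi x).
  apply/eqP; rewrite -subr_eq0 -(RintegralB measurableT i2 j2); apply/eqP.
  apply: (@green_identity_axis e2 snd psi (or_intror erefl) tp).
  - by move=> x; exact: cvg_snd.
  - move=> x; apply/is_derive_line0.
    rewrite (_ : (fun s : R => _) = cst x.2 + id); last first.
      by apply/funext => s; rewrite adde2E.
    rewrite -[1 in X in is_derive _ _ _ X]add0r.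
    exact: (is_deriveD (is_derive_cst x.2 (0 : R) (1 : R)) (is_derive_id (0 : R) (1 : R))).
  - by move=> x; have [] := le_eucl x.
  - by move=> f f' x; exact: is_derive_radial2.
rewrite -(RintegralB measurableT il i3).
have -> : (fun x : plane R => kern a (sqn x + d) * laplacian psi x) = (fun x : plane R =>
    kern a (sqn x + d) * 'D_e1 ('D_e1 psi) x + kern a (sqn x + d) * 'D_e2 ('D_e2 psi) x).
  by apply/funext => x; exact: mulrDr.
apply: (etrans (RintegralD measurableT i1 i2)); apply: (etrans (congr2 +%R G1 G2)).
apply: (etrans (esym (RintegralD measurableT j1 j2))).
apply: eq_Rintegral => x _; rewrite -mulrDl -mulrBl; congr (_ * _).
rewrite -(kern_laplacianE _ (s0 x)).
have arith (u v p q s : R) : s = p + q -> 2 * u + 4 * p * v + (2 * u + 4 * q * v) =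
    4 * ((s + d) * v + u) - 4 * d * v by move=> ->; ring.
exact: arith.
Qed.

End smoothing.

End parametrix.

(** * Parametrix *)

Opaque kern kern1 kern2 kern_laplacian eucl gauge.

Lemma cvg_Rintegral_dominated d (T : measurableType d) (R : realType)
    (mu : {measure set T -> \bar R}) (F_ : nat -> T -> R) (F G : T -> R) :
  (forall n, measurable_fun setT (F_ n)) -> measurable_fun setT F ->
  mu.-integrable setT (EFin \o G) -> {ae mu, forall x, forall n, `|F_ n x| <= G x} ->
  {ae mu, forall x, F_ ^~ x @ \oo --> F x} ->
  (fun n => \int[mu]_x F_ n x) @ \oo --> \int[mu]_x F x.
Proof.
move=> mF_ mF iG FG FF.
have [] := @dominated_convergence _ _ _ mu setT measurableT (fun n => EFin \o F_ n) (EFin \o F) (EFin \o G).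
- by move=> n; apply/measurable_EFinP.
- exact/measurable_EFinP.
- by apply: filterS FF => x Fx _; apply: cvg_EFin => //; near=> n.
- exact: iG.
- by apply: filterS FG => x Fx n _; rewrite /= lee_fin.
move=> iF _ cv; apply: fine_cvg; rewrite fineK//.
exact: integrable_fin_num.
Unshelve. all: by end_near. Qed.

Lemma ler_norm_mul2r (R : realType) (x y z : R) : `|x| <= `|y| -> `|x * z| <= `|y * z|.
Proof. by move=> xy; rewrite !normrM ler_wpM2r. Qed.

Section fundamental_solution.
Context {R : realType}.
Local Notation mu := (mu2 R).
Local Notation ip := (ip mu).
Local Notation L2 := (L2 mu).
Implicit Types (f g h : plane R -> R) (psi phi : R * R -> R) (e : R * R) (d B M t : R).

Transparent kern_laplacian gauge.
Lemma continuous_kern_laplacian (a s : R) : 0 < a -> 0 < s -> {for s, continuous (kern_laplacian a)}.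
Proof.
move=> a0 s0; have p0 := gauge_gt0 a0 s0.
have cg : {for s, continuous (gauge a)}.
  by apply: differentiable_continuous; apply/derivable1_diffP; have [] := is_derive_gauge a s0.
have cE : {for s, continuous (fun t => expR (gauge a t))}.
  by apply: (@continuous_comp _ _ _ (gauge a) expR); [exact: cg|exact: continuous_expR].
have cb : {for s, continuous (fun t => bose (gauge a t))}.
  apply: cvgV; first by rewrite gt_eqF// subr_gt0 expR_gt1.
  by apply: cvgB; [exact: cE|exact: cvg_cst].
apply: cvgM; last by apply: cvgV; [rewrite gt_eqF|exact: cvg_id].
apply: cvgM; first exact: cvg_cst.
apply: cvgM; first exact: cg.
apply: cvgM; first by rewrite expr2; apply: cvgM; exact: cb.
by apply: cvgD; [apply: cvgB; [apply: cvgM; [exact: cg|exact: cE]|exact: cE]|exact: cvg_cst].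
Qed.

Opaque kern_laplacian gauge.

Transparent kern gauge kern_laplacian.
Lemma kern_laplacian0 (a : R) : kern_laplacian a 0 = 0.
Proof. by rewrite /kern_laplacian invr0 mulr0. Qed.

(** Default values (ln 0 = 0 here) keep the kernel and its Laplacian equal to 0 at the origin, so
    the pointwise inequalities between them need no exceptional point. *)
Lemma kern0 (a : R) : kern a 0 = 0.
Proof.
rewrite /kern /gauge powR0 ?mulr0; last by rewrite mulf_neq0 ?invr_eq0.
by rewrite /coth_log oppr0 expR0 subrr ln0 ?oppr0.
Qed.
Opaque kern gauge kern_laplacian.

Definition step (n : nat) : R := n.+1%:R^-1.

Lemma step_gt0 n : 0 < step n. Proof. by rewrite invr_gt0. Qed.

Lemma cvg_step : step @ \oo --> (0 : R).
Proof. exact: cvg_harmonic. Qed.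

Lemma cvg_sqn_step x : (fun n => sqn x + step n) @ \oo --> sqn x.
Proof. by rewrite -[X in _ --> X]addr0; apply: cvgD; [exact: cvg_cst|exact: cvg_step]. Qed.

Lemma sqn_gt0 (x : R * R) : x.1 != 0 -> 0 < sqn x.
Proof. by move=> x0; rewrite -sqr_eucl exprn_gt0// eucl_gt0. Qed.

Lemma eucl_le (x : R * R) : eucl x <= `|x.1| + `|x.2|.
Proof.
apply: le_trans (ler_norm _) _; apply: norm_le_of_sqr_le; first by rewrite addr_ge0.
rewrite sqr_eucl /sqn -(real_normK (num_real x.1)) -(real_normK (num_real x.2)).
by move: (normr_ge0 x.1) (normr_ge0 x.2); move: `|x.1| `|x.2| => u v u0 v0; nra.
Qed.

Lemma integrable_compact_radial (G : plane R -> R) (B C : R) : measurable_fun setT G ->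
  supported_in B G -> (forall x, x.1 != 0 -> `|G x| * eucl x <= C) ->
  mu.-integrable setT (EFin \o G).
Proof.
move=> mG sB GC; apply: (@integrable_radial _ _ (`|C| + `|C| * (2 * B) ^+ 2) mG) => x x0.
  apply: le_trans (GC x x0) _; apply: le_trans (ler_norm _) _.
  by rewrite lerDl mulr_ge0// sqr_ge0.
have [->|G0] := eqVneq (G x) 0; first by rewrite normr0 mul0r addr_ge0// mulr_ge0// sqr_ge0.
have [h1 h2] := sB x G0; have r2 : eucl x <= 2 * B by have := eucl_le x; lra.
have r0 := eucl_ge0 x.
have q : eucl x ^+ 2 <= (2 * B) ^+ 2 by apply: lerXn2r; rewrite ?nnegrE//; exact: le_trans r2.
rewrite exprS mulrA; apply: le_trans (ler_pM _ (sqr_ge0 _) (GC x x0) q) _.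
  by rewrite mulr_ge0.
apply: le_trans (_ : `|C| * (2 * B) ^+ 2 <= _); last by rewrite lerDr.
by rewrite ler_wpM2r ?sqr_ge0// ler_norm.
Qed.

Lemma gauge_le_mul (a : R) (x : R * R) : 0 < a -> x.1 != 0 ->
  gauge a (sqn x) <= a * eucl x * (1 + eucl x).
Proof.
move=> a0 x0; have r0 := eucl_gt0 x0; have := gauge_sqr a r0; rewrite sqr_eucl => E.
have s0 := sqn_gt0 x0; have g0 := gauge_gt0 a0 s0.
apply: le_trans (ler_norm _) _; apply: norm_le_of_sqr_le.
  by rewrite !mulr_ge0 ?addr_ge0// ltW.
rewrite E; move: (eucl x) r0 => r r0.
have -> : (a * r * (1 + r)) ^+ 2 = a ^+ 2 * (r ^+ 2 * (1 + r) ^+ 2) by ring.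
rewrite ler_wpM2l ?sqr_ge0// exprSr ler_wpM2l ?sqr_ge0//; nra.
Qed.

(** * Removal of the regularisation *)

Section limit.
Variable a : R.
Hypothesis a1 : 1 <= a.

Let a0 : 0 < a. Proof. exact: lt_le_trans a1. Qed.

Definition par : plane R -> R := fun x => kern a (sqn x).
Definition par_laplacian : plane R -> R := fun x => kern_laplacian a (sqn x).

Lemma measurable_par : measurable_fun setT par.
Proof. exact: (measurable_kern _ measurable_sqn). Qed.

Lemma measurable_par_laplacian : measurable_fun setT par_laplacian.
Proof. by apply: (measurable_kern_laplacian a0); [exact: sqn_ge0|exact: measurable_sqn]. Qed.

Lemma L2_par : L2 par.
Proof.
split; first exact: measurable_par.
have [C HC] := kern_bounds a1; apply: (@integrable_radial _ _ C).
- by apply: measurable_funX; exact: measurable_par.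
- move=> x x0; have [h _ _ _] := HC _ (eucl_gt0 x0).
  by rewrite sqr_eucl in h; rewrite (ger0_norm (sqr_ge0 _)); exact: h.
- move=> x x0; have [_ h _ _] := HC _ (eucl_gt0 x0).
  by rewrite sqr_eucl in h; rewrite (ger0_norm (sqr_ge0 _)); exact: h.
Qed.

Lemma par4_integrable : mu.-integrable setT (EFin \o (fun x => par x ^+ 4)).
Proof.
have [C HC] := kern_bounds a1; apply: (@integrable_radial _ _ C).
- by apply: measurable_funX; exact: measurable_par.
- move=> x x0; have [_ _ h _] := HC _ (eucl_gt0 x0).
  by rewrite sqr_eucl in h; rewrite (ger0_norm (@exprn_even_ge0 _ 4 _ isT)); exact: h.
- move=> x x0; have [_ _ _ h] := HC _ (eucl_gt0 x0).
  by rewrite sqr_eucl in h; rewrite (ger0_norm (@exprn_even_ge0 _ 4 _ isT)); exact: h.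
Qed.

Lemma L2_par_laplacian : L2 par_laplacian.
Proof.
split; first exact: measurable_par_laplacian.
have [C HC] := kern_laplacian_bounds a1; apply: (@integrable_radial _ _ C).
- by apply: measurable_funX; exact: measurable_par_laplacian.
- move=> x x0; have [_ h _] := HC _ (eucl_gt0 x0).
  by rewrite sqr_eucl in h; rewrite (ger0_norm (sqr_ge0 _)); exact: h.
- move=> x x0; have [_ _ h] := HC _ (eucl_gt0 x0).
  by rewrite sqr_eucl in h; rewrite (ger0_norm (sqr_ge0 _)); exact: h.
Qed.

Lemma measurable_sqn_step n : measurable_fun setT (fun x : plane R => sqn x + step n).
Proof. by apply: measurable_funD => //; exact: measurable_sqn. Qed.

Lemma cvg_par phi : test_function phi ->
  (fun n => \int[mu]_x (kern a (sqn x + step n) * phi x)) @ \oo --> ip par phi.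
Proof.
move=> tp; have mp := test_measurable tp.
apply: (@cvg_Rintegral_dominated _ _ _ _ _ _ (fun x => `|par x * phi x|)).
- by move=> n; apply: measurable_funM => //; exact: (measurable_kern _ (measurable_sqn_step n)).
- by apply: measurable_funM => //; exact: measurable_par.
- exact: (integrable_norm (L2_integrableM L2_par (test_L2 tp))).
- apply: negligibleS ae_axes => x /= h [x1 _]; apply: h => n.
  apply: ler_norm_mul2r; rewrite /par.
  have s0 := sqn_gt0 x1; rewrite [leRHS](ger0_norm (ltW (kern_gt0 a0 s0))).
  by apply: (kern_norm_le a0 s0); rewrite lerDl ltW// step_gt0.
- apply: negligibleS ae_axes => x /= h [x1 _]; apply: h.
  apply: cvgM; last exact: cvg_cst.
  have ck : {for sqn x, continuous (kern a)}.
    apply: differentiable_continuous; apply/derivable1_diffP.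
    by have [] := is_derive_kern a0 (sqn_gt0 x1).
  by apply: (@cvg_comp _ _ _ (fun n => sqn x + step n) (kern a)); [exact: cvg_sqn_step|exact: ck].
Qed.

Lemma cvg_par_laplacian phi : test_function phi ->
  (fun n => \int[mu]_x (kern_laplacian a (sqn x + step n) * phi x)) @ \oo --> ip par_laplacian phi.
Proof.
move=> tp; have mp := test_measurable tp; have [M M0 bM] := test_bounded tp.
have /test_functionP[_ [B sB]] := tp.
have aM0 : 0 <= 9 / 4 * a * M by rewrite !mulr_ge0 ?divr_ge0// ltW.
pose G : plane R -> R := fun x => 9 / 4 * (gauge a (sqn x) / sqn x) * phi x.
have mG : measurable_fun setT G.
  apply: measurable_funM => //; apply: measurable_funM => //; apply: measurable_funM.
    exact: (measurable_gauge _ measurable_sqn).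
  by apply: measurable_inv_ge0; [exact: sqn_ge0|exact: measurable_sqn].
apply: (@cvg_Rintegral_dominated _ _ _ _ _ _ (fun x => `|G x|)).
- move=> n; apply: measurable_funM => //.
  apply: (measurable_kern_laplacian a0); last exact: measurable_sqn_step.
  by move=> x; rewrite addr_ge0 ?sqn_ge0// ltW// step_gt0.
- by apply: measurable_funM => //; exact: measurable_par_laplacian.
- apply: integrable_norm.
  apply: (@integrable_compact_radial G B (9 / 4 * (a * (1 + 2 * `|B|)) * M) mG).
    by move=> x; rewrite /G mulf_eq0 negb_or => /andP[_ /sB].
  move=> x x1; have [p0|p0] := eqVneq (phi x) 0.
    rewrite /G p0 mulr0 normr0 mul0r !mulr_ge0 ?addr_ge0 ?(ltW a0)// ?mulr_ge0// divr_ge0.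
  have [h1 h2] := sB x p0; have r0 := eucl_gt0 x1; have s0 := sqn_gt0 x1.
  have g0 := gauge_gt0 a0 s0.
  have g1 : gauge a (sqn x) / sqn x * eucl x <= a * (1 + 2 * `|B|).
    rewrite mulrAC ler_pdivrMr//; apply: le_trans (ler_wpM2r (ltW r0) (gauge_le_mul a0 x1)) _.
    rewrite -sqr_eucl; have := eucl_le x; move: (eucl x) r0 => r r0 rB.
    have -> : a * r * (1 + r) * r = a * (1 + r) * r ^+ 2 by ring.
    rewrite ler_wpM2r ?sqr_ge0// ler_pM2l//; have := ler_norm B; lra.
  rewrite /G normrM mulrAC; apply: ler_pM => //; first by rewrite mulr_ge0// ltW.
  have y0 : 0 <= 9 / 4 * (gauge a (sqn x) / sqn x).
    by apply: mulr_ge0; [rewrite divr_ge0|rewrite divr_ge0// ltW].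
  have q0 : (0 : R) <= 9 / 4 by rewrite divr_ge0.
  by rewrite (ger0_norm y0) -(mulrA (9 / 4)); exact: (ler_wpM2l q0 g1).
- apply: negligibleS ae_axes => x /= h [x1 _]; apply: h => n.
  apply: ler_norm_mul2r; rewrite /par.
  have s0 := sqn_gt0 x1; have s1 : sqn x <= sqn x + step n by rewrite lerDl ltW// step_gt0.
  rewrite (ger0_norm (kern_laplacian_ge0 a0 (lt_le_trans s0 s1))) //.
  apply: le_trans (ler_norm _); rewrite mulrA; exact: kern_laplacian_le.
- apply: negligibleS ae_axes => x /= h [x1 _]; apply: h.
  apply: cvgM; last exact: cvg_cst.
  have ck := continuous_kern_laplacian a0 (sqn_gt0 x1).
  by apply: (@cvg_comp _ _ _ (fun n => sqn x + step n) (kern_laplacian a));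
    [exact: cvg_sqn_step|exact: ck].
Qed.

(** Only functions that vanish at the origin are treated: there 8 |phi| / |x|^2 = O(1/|x|)
    dominates, it is integrable on bounded sets, and the factor [step n] kills the integrand at each
    fixed point off an axis. *)
Lemma cvg_delta0 phi (Lip : R) : test_function phi -> (forall x, `|phi x| <= Lip * eucl x) ->
  (fun n => \int[mu]_x (4 * step n * kern2 a (sqn x + step n) * phi x)) @ \oo --> (0 : R).
Proof.
move=> tp lip; have mp := test_measurable tp.
have /test_functionP[_ [B sB]] := tp.
pose G : plane R -> R := fun x => 8 * (sqn x)^-1 * phi x.
have mG : measurable_fun setT G.
  apply: measurable_funM => //; apply: measurable_funM => //.
  by apply: measurable_inv_ge0; [exact: sqn_ge0|exact: measurable_sqn].
have kb x n : x.1 != 0 -> `|4 * step n * kern2 a (sqn x + step n)| <= 8 * step n / sqn x ^+ 2.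
  move=> x1; have s0 := sqn_gt0 x1; have d0 := step_gt0 n.
  have sd0 : 0 < sqn x + step n by rewrite addr_gt0.
  have [k20 k2s] := kern2_bounds a0 sd0.
  have d4 : 0 <= 4 * step n by rewrite mulr_ge0// ltW.
  rewrite (ger0_norm (mulr_ge0 d4 k20)); apply: le_trans (ler_wpM2l d4 k2s) _.
  rewrite (_ : 8 * step n / sqn x ^+ 2 = 4 * step n * (2 / sqn x ^+ 2)); last by ring.
  apply: (ler_wpM2l d4); rewrite ler_wpM2l// lef_pV2 ?posrE ?exprn_gt0//.
  by apply: lerXn2r; rewrite ?nnegrE ?(ltW s0) ?(ltW sd0)// lerDl ltW.
have kb' x n : x.1 != 0 -> `|4 * step n * kern2 a (sqn x + step n)| <= `|8 * (sqn x)^-1|.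
  move=> x1; have s0 := sqn_gt0 x1; have d0 := step_gt0 n.
  have sd0 : 0 < sqn x + step n by rewrite addr_gt0.
  have [k20 k2s] := kern2_bounds a0 sd0.
  have d4 : 0 <= 4 * step n by rewrite mulr_ge0// ltW.
  rewrite (ger0_norm (mulr_ge0 d4 k20)); apply: le_trans (ler_wpM2l d4 k2s) _.
  apply: le_trans (ler_norm _).
  have -> : 4 * step n * (2 / (sqn x + step n) ^+ 2) = 8 * (step n / (sqn x + step n) ^+ 2) by ring.
  rewrite ler_wpM2l// ler_pdivrMr ?exprn_gt0// ler_pdivlMl//.
  by have := sqr_ge0 (sqn x); have := sqr_ge0 (step n); nra.
rewrite (_ : (0 : R) = \int[mu]_x 0); last by rewrite Rintegral_cst//= mul0r.
apply: (@cvg_Rintegral_dominated _ _ _ _ _ _ (fun x => `|G x|)).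
- move=> n; apply: measurable_funM => //; apply: measurable_funM => //.
  exact: (measurable_kern2 a0 (measurable_sqn_step n)).
- exact: measurable_cst.
- apply: integrable_norm.
  apply: (@integrable_compact_radial G B (8 * Lip) mG).
    by move=> x; rewrite /G mulf_eq0 negb_or => /andP[_ /sB].
  move=> x x1; have s0 := sqn_gt0 x1; have r0 := eucl_gt0 x1.
  have y0 : 0 <= 8 * (sqn x)^-1 by rewrite mulr_ge0// invr_ge0 ltW.
  rewrite /G normrM (ger0_norm y0).
  apply: le_trans (ler_wpM2r (ltW r0) (ler_wpM2l y0 (lip x))) _.
  rewrite -sqr_eucl; move: (eucl x) r0 => r r0.
  by rewrite (_ : _ * _ * r = 8 * Lip)//; field; exact: lt0r_neq0.
- apply: negligibleS ae_axes => x /= h [x1 _]; apply: h => n.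
  by apply: ler_norm_mul2r; exact: kb'.
- apply: negligibleS ae_axes => x /= h [x1 _]; apply: h.
  apply/cvgr0Pnorm_le => eps eps0.
  have s0 := sqn_gt0 x1.
  have c0 : 0 < 8 / sqn x ^+ 2 * (`|phi x| + 1) by rewrite mulr_gt0 ?divr_gt0 ?exprn_gt0// ltr_wpDl.
  have := cvg_step => /cvgr0Pnorm_le /(_ (eps / (8 / sqn x ^+ 2 * (`|phi x| + 1))) (divr_gt0 eps0 c0)).
  apply: filterS => n; rewrite (ger0_norm (ltW (step_gt0 n))) ler_pdivlMr// => hn.
  rewrite normrM; apply: le_trans (ler_wpM2r (normr_ge0 _) (kb x n x1)) _.
  apply: le_trans hn; rewrite (_ : 8 * step n / sqn x ^+ 2 = step n * (8 / sqn x ^+ 2)); last by ring.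
  rewrite -(mulrA (step n)) ler_wpM2l ?(ltW (step_gt0 n))// ler_wpM2l ?lerDl//.
  by rewrite divr_ge0// sqr_ge0.
Qed.

Lemma laplacian_pairing_eq0 phi (Lip : R) : test_function phi ->
  (forall x, `|phi x| <= Lip * eucl x) -> ip par_laplacian phi = ip par (laplacian phi).
Proof.
move=> tp lip; have c1 := cvg_par (test_laplacian tp); have c2 := cvg_par_laplacian tp.
have c3 : (fun n => \int[mu]_x (kern_laplacian a (sqn x + step n) * phi x)) @ \oo -->
    (ip par (laplacian phi) + 0).
  rewrite (_ : (fun n => _) = (fun n => \int[mu]_x (kern a (sqn x + step n) * laplacian phi x) +
      \int[mu]_x (4 * step n * kern2 a (sqn x + step n) * phi x))); last first.
    by apply/funext => n; rewrite (green_identity a0 (step_gt0 n) tp) subrK.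
  by apply: cvgD; [exact: c1|exact: cvg_delta0 lip].
by rewrite (cvg_unique (@Rhausdorff R) c2 c3) addr0.
Qed.

Lemma par_ge0 x : 0 <= par x.
Proof.
have [s0|] := ltP 0 (sqn x); first exact: ltW (kern_gt0 a0 s0).
move=> s0; have {s0} s0 : sqn x = 0 by apply/eqP; rewrite eq_le s0 sqn_ge0.
rewrite /par s0 kern0; exact: lexx.
Qed.

Lemma par_gt0 x : x.1 != 0 -> 0 < par x.
Proof. by move=> /sqn_gt0/(kern_gt0 a0). Qed.

End limit.

Lemma test_lipschitz0 phi : test_function phi -> phi (0, 0) = 0 ->
  exists Lip : R, forall x, `|phi x| <= Lip * eucl x.
Proof.
move=> tp p0; have [M1 M10 b1] := test_bounded (test_D1 tp).
have [M2 M20 b2] := test_bounded (test_D2 tp).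
have lip e (M : R) : axis e -> (forall x, `|'D_e phi x| <= M) -> forall z (t : R),
    `|phi (z + t *: e) - phi z| <= M * `|t|.
  move=> ax bM z t.
  have df (s : R) : is_derive s 1 (fun s => phi (z + s *: e)) ('D_e phi (z + s *: e)).
    by apply/is_derive_lineP; apply: DeriveDef => //; exact: axis_derivable.
  have := lipschitz_of_derive_le df (fun s => bM (z + s *: e)) t 0.
  by rewrite subr0 scale0r addr0.
exists (M2 + M1) => x; have [l1 l2] := le_eucl x.
have h1 := lip e1 M1 (or_introl erefl) b1 (0, 0) x.1.
have h2 := lip e2 M2 (or_intror erefl) b2 ((0, 0) + x.1 *: e1) x.2.
rewrite adde1E adde2E /= !add0r -surjective_pairing in h2.
rewrite adde1E /= add0r p0 subr0 in h1.
rewrite -(subrK (phi (x.1, 0)) (phi x)) mulrDl; apply: le_trans (ler_normD _ _) (lerD _ _).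
  exact: le_trans h2 (ler_wpM2l M20 l2).
exact: le_trans h1 (ler_wpM2l M10 l1).
Qed.

Lemma derive_lincomb e phi psi (k : R) : axis e -> test_function phi -> test_function psi ->
  'D_e (fun x => phi x + k * psi x) = (fun x => 'D_e phi x + k * 'D_e psi x).
Proof.
move=> ax tp ts.
have d1 x : derivable phi x e by exact: axis_derivable.
have d2 x : derivable psi x e by exact: axis_derivable.
have d3 x : derivable (fun x => k * psi x) x e.
  by apply: axis_derivable => //; exact: test_scale.
rewrite (derive_add d1 d3); apply/funext => x; congr (_ + _).
exact: (congr1 (fun g => g x) (derive_scale k d2)).
Qed.

Lemma laplacian_lincomb phi psi (k : R) : test_function phi -> test_function psi ->
  laplacian (fun x => phi x + k * psi x) = (fun x => laplacian phi x + k * laplacian psi x).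
Proof.
move=> tp ts.
have D e : axis e -> 'D_e ('D_e (fun x => phi x + k * psi x)) =
    (fun x => 'D_e ('D_e phi) x + k * 'D_e ('D_e psi) x).
  move=> ax; have [tp' ts'] := (axis_test ax tp, axis_test ax ts).
  by rewrite (derive_lincomb k ax tp ts); exact: derive_lincomb.
apply/funext => x; rewrite /laplacian.
apply: etrans (congr2 +%R (congr1 (fun g => g x) (D e1 (or_introl erefl)))
  (congr1 (fun g => g x) (D e2 (or_intror erefl)))) _.
by rewrite mulrDr; exact: addrACA.
Qed.

Lemma Rintegral_eq0_ae (dd : measure_display) (T : measurableType dd) (nu : {measure set T -> \bar R}) (f : T -> R) :
  nu.-integrable setT (EFin \o f) -> (forall x, 0 <= f x) -> \int[nu]_x f x = 0 ->
  {ae nu, forall x, f x = 0}.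
Proof.
move=> intf f0 If; have mf := measurable_int _ intf.
have : (\int[nu]_x `|(EFin \o f) x| = 0)%E.
  under eq_integral do rewrite /= ger0_norm//.
  by rewrite -(fineK (integrable_fin_num measurableT intf)) -/(Rintegral _ _ _) If.
by move=> /(ae_eq_integral_abs nu measurableT mf).1; apply: filterS => x /(_ I) [].
Qed.

Lemma mu2_unit_box_neq0 : mu (obox (-1) 1 (-1) 1) != 0%E.
Proof.
pose J : set R := `]-1, 1[%classic.
rewrite (_ : mu _ = (lebesgue_measure J * lebesgue_measure J)%E); last first.
  by apply: product_measure1E; exact: measurable_itv.
have -> : lebesgue_measure J = 2%:E.
  rewrite lebesgue_measure_itv/= ifT; last by rewrite lte_fin; lra.
  by rewrite -EFinD; congr EFin; ring.
by rewrite -EFinM eqe mulf_neq0.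
Qed.

Definition bell : R * R -> R :=
  fun x => smooth_indic (-1) 1 1 x.1 * smooth_indic (-1) 1 1 x.2.

Lemma test_bell : test_function bell.
Proof. exact: (test_smooth_box (-1) 1 (-1) 1 0). Qed.

Lemma bell_ge0 x : 0 <= bell x.
Proof. by rewrite mulr_ge0 ?smooth_indic_ge0. Qed.

Lemma bell_gt0 x : obox (-1) 1 (-1) 1 x -> 0 < bell x.
Proof.
by move=> [] /=; rewrite !in_itv/= => h1 h2; rewrite mulr_gt0 ?smooth_indic_gt0.
Qed.

(** The explicit kernel is divided by the mass c of its point source; rho is then the excess of its
    Laplacian over w times the kernel, nonnegative by the choice of a. *)
Lemma parametrix (w : R) : 0 < w -> exists K rho : plane R -> R,
  [/\ L2 K /\ L2 rho, mu.-integrable setT (EFin \o (fun x => K x ^+ 4)),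
      (forall x, 0 <= K x) /\ (forall x, 0 <= rho x), {ae mu, forall x, 0 < K x} &
      forall psi, test_function psi ->
        ip K (fun x => - laplacian psi x + w * psi x) = psi (0, 0) - ip rho psi].
Proof.
move=> w0; have [a [a1 wk]] := kern_le_laplacian w0.
have LK := L2_par a1; have LL := L2_par_laplacian a1.
have tb := test_bell; have b00 : 0 < bell (0, 0).
  by apply: bell_gt0; split; rewrite /= in_itv/= ?oppr_lt0 ?ltr01.
(* The defect in the Green identity vanishes on test functions null at the origin. Subtracting a
   multiple of [bell] reduces to these, so the defect is c times evaluation at 0. *)
pose c := (ip (par_laplacian a) bell - ip (par a) (laplacian bell)) / bell (0, 0).
have cE psi : test_function psi ->
    ip (par_laplacian a) psi - ip (par a) (laplacian psi) = c * psi (0, 0).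
  move=> tp; pose k := - (psi (0, 0) / bell (0, 0)).
  have tg : test_function (fun x => psi x + k * bell x).
    by apply: test_add => //; exact: test_scale.
  have g0 : psi (0, 0) + k * bell (0, 0) = 0.
    by rewrite /k mulNr divfK ?subrr// gt_eqF.
  have [Lip lip] := test_lipschitz0 tg g0.
  have := laplacian_pairing_eq0 a1 tg lip; rewrite laplacian_lincomb//.
  have Lp := test_L2 tp; have Lb := test_L2 tb.
  have Lp' := test_L2 (test_laplacian tp); have Lb' := test_L2 (test_laplacian tb).
  rewrite (ipDr Lp (L2Z k Lb) LL) (ipDr Lp' (L2Z k Lb') LK) (ipZr k Lb LL) (ipZr k Lb' LK) /c /k.
  have arith (p q r s y b : R) : b != 0 -> p + - (y / b) * q = r + - (y / b) * s ->
      p - r = (q - s) / b * y.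
    move=> b0 E; have -> : p = r + - (y / b) * s - - (y / b) * q by rewrite -E; ring.
    by field.
  by apply: arith; rewrite gt_eqF.
have rho0 x : w * par a x <= par_laplacian a x.
  have [s0|] := ltP 0 (sqn x); first exact: wk.
  move=> s0; have {s0} s0 : sqn x = 0 by apply/eqP; rewrite eq_le s0 sqn_ge0.
  by rewrite /par /par_laplacian s0 kern0 kern_laplacian0 mulr0.
(* If c <= 0, the kernel would satisfy (- Delta + w) K <= 0 as a distribution; the maximum principle
   would give <K, bell> <= 0, although K is positive almost everywhere. *)
have c0 : 0 < c.
  rewrite ltNge; apply/negP => cneg.
  have : ip (par a) bell <= 0.
    apply: (correlation_le0 w0 LK tb) => z; have ts := test_shift z tb.
    have Ls := test_L2 ts; have Lls := test_L2 (test_laplacian ts).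
    rewrite (ipDr (L2N Lls) (L2Z w Ls) LK) (ipNr Lls LK) (ipZr w Ls LK).
    have := cE _ ts; rewrite -ipZl// => E.
    have h1 : ip (fun x => w * par a x) (shiftf z bell) <= ip (par_laplacian a) (shiftf z bell).
      apply: (le_Rintegral measurableT (L2_integrableM (L2Z w LK) Ls) (L2_integrableM LL Ls)) => x _.
      exact: (ler_wpM2r (bell_ge0 _) (rho0 x)).
    have h2 : c * shiftf z bell (0, 0) <= 0 by rewrite mulr_le0_ge0// bell_ge0.
    have arith (p q r y : R) : r <= p -> c * y <= 0 -> p - q = c * y -> - q + r <= 0.
      by clear; lra.
    exact: arith h1 h2 E.
  have kb0 x : 0 <= par a x * bell x by rewrite mulr_ge0 ?par_ge0 ?bell_ge0.
  have ge0 : 0 <= ip (par a) bell by apply: Rintegral_ge0 => x _; exact: kb0.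
  move=> le0; have I0 : ip (par a) bell = 0 by apply/eqP; rewrite eq_le le0 ge0.
  have := Rintegral_eq0_ae (L2_integrableM LK (test_L2 tb)) kb0 I0 => ae0.
  have : mu.-negligible (obox (-1) 1 (-1) 1 : set (plane R)).
    apply: negligibleS (negligibleU ae0 (@ae_fst_neq0 R)) => x bx /=.
    have [x1|x1] := eqVneq x.1 0; [right; exact|left => /eqP].
    by rewrite mulf_eq0 !gt_eqF ?bell_gt0 ?par_gt0.
  move=> /(negligibleP mu (measurable_obox _ _ _ _)) E.
  by have := mu2_unit_box_neq0; rewrite E eqxx.
pose K x := c^-1 * par a x; pose rho x := c^-1 * (par_laplacian a x - w * par a x).
have ci0 : 0 <= c^-1 by rewrite invr_ge0 ltW.
have Lr := L2B LL (L2Z w LK).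
exists K, rho; split.
- by split; exact: L2Z.
- have := integrableZl measurableT (c^-1 ^+ 4) (par4_integrable a1).
  by apply: eq_integrable => // x _; rewrite /= -EFinM exprMn.
- split=> x; rewrite mulr_ge0 ?par_ge0// subr_ge0; exact: rho0.
- apply: negligibleS (@ae_fst_neq0 R) => x /= h x1; apply: h.
  by rewrite mulr_gt0 ?invr_gt0 ?par_gt0.
- move=> psi tp; have Lp := test_L2 tp; have Llp := test_L2 (test_laplacian tp).
  rewrite (ipDr (L2N Llp) (L2Z w Lp) (L2Z _ LK)) (ipNr Llp (L2Z _ LK)) (ipZr w Lp (L2Z _ LK)).
  rewrite (ipZl _ LK Llp) (ipZl _ LK Lp) (ipZl _ Lr Lp) (ipBl LL (L2Z w LK) Lp) (ipZl w LK Lp).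
  have arith (p q r y : R) : p - q = c * y ->
      - (c^-1 * q) + w * (c^-1 * r) = y - c^-1 * (p - w * r).
    move=> E; have -> : y = c^-1 * (p - q) by rewrite E mulKf// gt_eqF.
    by ring.
  exact: arith (cE _ tp).
Qed.

End fundamental_solution.

(** * Point masses are not in the dual of the Sobolev space *)

Section no_delta.
Context {R : realType}.
Local Notation mu := (mu2 R).
Local Notation ip := (ip mu).
Local Notation L2 := (L2 mu).
Implicit Types (f g h w : plane R -> R) (psi phi : R * R -> R).

Lemma mu2_oboxE (a b c d : R) : a <= b -> c <= d ->
  mu (obox a b c d) = ((b - a) * (d - c))%:E.
Proof.
move=> ab cd.
have len (x y : R) : x <= y -> lebesgue_measure (`]x, y[%classic : set R) = (y - x)%:E.
  move=> xy; rewrite lebesgue_measure_itv/= lte_fin; case: ltP => // yx.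
  by rewrite (_ : y = x) ?subrr//; apply/eqP; rewrite eq_le yx xy.
have -> : mu (obox a b c d) = (lebesgue_measure (`]a, b[%classic : set R) *
    lebesgue_measure (`]c, d[%classic : set R))%E.
  by apply: product_measure1E; exact: measurable_itv.
by rewrite !len.
Qed.

(** Half-side 2 B rather than B, so that the open square contains a closed one of half-side B; its
    area is 16 B^2. *)
Definition square (B : R) : set (plane R) := obox (- (2 * B)) (2 * B) (- (2 * B)) (2 * B).

Lemma measurable_square B : measurable (square B). Proof. exact: measurable_obox. Qed.

Lemma indic_L2 (D : set (plane R)) : measurable D -> (mu D < +oo)%E -> L2 \1_D.
Proof.
move=> mD fD; have iD : mu.-integrable setT (EFin \o (\1_D : plane R -> R)).
  apply/integrableP; split; first by apply/measurable_EFinP; exact: measurable_indic.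
  under eq_integral do rewrite /= ger0_norm//.
  by rewrite integral_indic// setIT.
split; first exact: measurable_indic.
by apply: eq_integrable iD => // x _; rewrite /= indicE; case: (x \in D); rewrite ?expr1n ?expr0n.
Qed.

(** Only the mass of h on the square enters, so the pairing may vanish in the limit although the
    norms of the concentrating functions merely stay bounded. *)
Lemma ip_supported_le h psi (B M : R) : 0 < B -> L2 h ->
  measurable_fun setT (psi : plane R -> R) -> supported_in B psi -> (forall x, `|psi x| <= M) ->
  ip h psi ^+ 2 <= ip (fun x => h x * \1_(square B) x) (fun x => h x * \1_(square B) x)
                   * (M ^+ 2 * (16 * B ^+ 2)).
Proof.
move=> B0 Lh mp sB bM; have M0 : 0 <= M := le_trans (normr_ge0 _) (bM (0, 0)).
have mD := measurable_square B.
have B2 : - (2 * B) <= 2 * B by lra.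
have muD : mu (square B) = (16 * B ^+ 2)%:E.
  by rewrite /square mu2_oboxE//; congr EFin; ring.
have LD : L2 \1_(square B) by apply: indic_L2 => //; rewrite muD ltry.
have Lp := supported_L2 mp sB bM.
have inD x : psi x != 0 -> square B x.
  by move=> /sB[/ler_normlP[? ?] /ler_normlP[? ?]]; split; rewrite /= in_itv/=; apply/andP; split; lra.
have LhD : L2 (fun x => h x * \1_(square B) x).
  apply: (L2_le _ _ Lh); first by apply: measurable_funM; [case: Lh|exact: measurable_indic].
  by move=> x; rewrite normrM ler_piMr// ger0_norm ?indicE//; case: (_ \in _).
have -> : ip h psi = ip (fun x => h x * \1_(square B) x) psi.
  rewrite !ipE; apply: eq_Rintegral => x _; have [->|p0] := eqVneq (psi x) 0; first by rewrite !mulr0.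
  by rewrite indicE mem_set ?mulr1//; exact: inD.
apply: le_trans (cauchy_schwarz LhD Lp) _; rewrite ler_wpM2l ?ip_ge0//.
apply: le_trans (ip_le (L2Z M LD) mp _) _.
  move=> x; have [->|p0] := eqVneq (psi x) 0; first by rewrite normr0.
  by rewrite indicE mem_set ?mulr1; [rewrite (ger0_norm M0)|exact: inD].
rewrite ip_sqrZ// ler_wpM2l ?sqr_ge0//.
have -> : ip \1_(square B) \1_(square B) = \int[mu]_x \1_(square B) x.
  rewrite ipE; apply: eq_Rintegral => x _.
  by rewrite indicE; case: (x \in _); rewrite ?mulr1 ?mulr0.
have -> : \int[mu]_x \1_(square B) x = fine (mu (square B)).
  by rewrite /Rintegral integral_indic// setIT.
by rewrite muD.
Qed.

Lemma square_cvg0 h : L2 h ->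
  (fun n => ip (fun x => h x * \1_(square (step n)) x) (fun x => h x * \1_(square (step n)) x))
    @ \oo --> (0 : R).
Proof.
move=> [mh ih]; rewrite (_ : (0 : R) = \int[mu]_x 0); last by rewrite Rintegral_cst//= mul0r.
have m1 n : measurable_fun setT (fun x => h x * \1_(square (step n)) x).
  by apply: measurable_funM => //; apply: measurable_indic; exact: measurable_square.
apply: (@cvg_Rintegral_dominated _ _ _ mu _ _ (fun x => h x ^+ 2)) => //.
- by move=> n; exact: measurable_funM.
- apply: aeW => x n; rewrite indicE; case: (x \in _); rewrite ?mulr1 ?mulr0 ?mul0r ?normr0 ?sqr_ge0//.
  by rewrite -expr2 ger0_norm ?sqr_ge0.
- apply: negligibleS (@ae_fst_neq0 R) => x /= hx x1; apply: hx.
  have x10 : 0 < `|x.1| / 2 by rewrite divr_gt0// normr_gt0.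
  have := @cvg_step R => /cvgr0Pnorm_le /(_ _ x10) near1.
  apply: (@cvg_near_cst _ _ _ _ _ _ _).
  apply: filterS near1 => n; rewrite (ger0_norm (ltW (step_gt0 n))) => hn.
  rewrite indicE memNset ?mulr0 ?mul0r// => -[/=]; rewrite in_itv/= -ltr_norml => h1 _.
  by move: h1; rewrite ltNge => /negP; apply; lra.
Qed.

Lemma ip_concentrating_cvg0 h (psi_ : nat -> R * R -> R) (C : R) : L2 h ->
  (forall n, measurable_fun setT (psi_ n : plane R -> R)) ->
  (forall n, supported_in (step n) (psi_ n)) ->
  (forall n x, `|psi_ n x| <= C / step n) ->
  (fun n => ip h (psi_ n)) @ \oo --> (0 : R).
Proof.
move=> Lh mp sp bp; apply/cvgr0Pnorm_le => eps eps0.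
have c0 : 0 < 16 * C ^+ 2 + 1 by rewrite ltr_wpDl// mulr_ge0// sqr_ge0.
have := square_cvg0 Lh => /cvgr0Pnorm_le /(_ _ (divr_gt0 (exprn_gt0 2 eps0) c0)).
apply: filterS => n; rewrite ger0_norm ?ip_ge0// ler_pdivlMr// => hn.
apply: norm_le_of_sqr_le; first exact: ltW.
apply: le_trans (ip_supported_le (step_gt0 n) Lh (mp n) (sp n) (bp n)) _.
apply: le_trans hn; rewrite ler_wpM2l ?ip_ge0//.
have sn : step n != 0 :> R by rewrite gt_eqF// step_gt0.
rewrite (_ : (C / step n) ^+ 2 * (16 * step n ^+ 2) = 16 * C ^+ 2); last by field.
by rewrite lerDl.
Qed.

Definition profile (m s : R) : R := smooth_indic (-1) 1 1 (m * s + 0).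

Definition spike (m : R) : R * R -> R := fun x => profile m x.1 * profile m x.2.

Lemma profile_neq0 m s : 0 < m -> profile m s != 0 -> `|s| <= m^-1.
Proof.
move=> m0 /(smooth_indic_neq0 (@ltr01 R)); rewrite addr0 -ltr_norml normrM gtr0_norm// => h.
by rewrite -(ler_pM2l m0) mulfV ?gt_eqF// ltW.
Qed.

Lemma test_spike m : 0 < m -> test_function (spike m).
Proof.
move=> m0; apply: (@test_tensor _ _ _ m^-1) => [n|n|s|s]; try exact: profile_neq0.
  by apply: Dn_affine; exact: Dn_smooth_indic.
by apply: Dn_affine; exact: Dn_smooth_indic.
Qed.

Lemma spike_supported m : 0 < m -> supported_in m^-1 (spike m).
Proof.
by move=> m0 x; rewrite mulf_eq0 negb_or => /andP[/(profile_neq0 m0) ? /(profile_neq0 m0)].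
Qed.

Lemma derive_spike (m : R) x :
  'D_e1 (spike m) x = m * 'D_e1 bell (m * x.1 + 0, m * x.2 + 0) /\
  'D_e2 (spike m) x = m * 'D_e2 bell (m * x.1 + 0, m * x.2 + 0).
Proof.
have [b' db _] := @Dn_smooth_indic R 1 (-1) 1 1.
have dp (s : R) : is_derive s 1 (profile m) (m * b' (m * s + 0)).
  have d0 : is_derive s 1 (fun t : R => m * t + 0) m.
    have := is_deriveD (is_deriveZ m (is_derive_id s (1 : R))) (is_derive_cst (0 : R) s (1 : R)).
    by move=> H; apply: (is_derive_eq H); rewrite addr0 /GRing.scale/= mulr1.
  rewrite mulrC; exact: (@is_derive1_comp R _ (fun t : R => m * t + 0) s _ _ (db _) d0).
split.
  have [_ ->] := is_derive_tensor1 (a' := fun s => m * b' (m * s + 0)) (profile m) (dp x.1).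
  have [_ ->] := @is_derive_tensor1 R _ b' (smooth_indic (-1) 1 1) (m * x.1 + 0, m * x.2 + 0) (db _).
  by rewrite -mulrA.
have [_ ->] := is_derive_tensor2 (b' := fun s => m * b' (m * s + 0)) (profile m) (dp x.2).
have [_ ->] := @is_derive_tensor2 R (smooth_indic (-1) 1 1) _ b' (m * x.1 + 0, m * x.2 + 0) (db _).
by rewrite /= mulrCA.
Qed.

(** The spikes bell (m x) keep their value at the origin, while their gradients are of size m on
    squares of side of order 1/m, hence bounded in L^2 in two dimensions. Against fixed g1, g2 and f
    the pairings tend to 0, because the squares shrink. *)
Lemma no_delta (c : R) f g1 g2 : L2 f -> L2 g1 -> L2 g2 ->
  (forall psi, test_function psi ->
    c * psi (0, 0) = ip g1 ('D_e1 psi) + ip g2 ('D_e2 psi) + ip f psi) -> c = 0.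
Proof.
move=> Lf L1 L2' H.
have [M1 M10 b1] := test_bounded (test_D1 (@test_bell R)).
have [M2 M20 b2] := test_bounded (test_D2 (@test_bell R)).
have [M M0 b] := test_bounded (@test_bell R).
pose m n : R := n.+1%:R.
have m0 n : 0 < m n by [].
have ms n : step n = (m n)^-1 by [].
have m1 n : 1 <= m n by rewrite ler1n.
have t n := test_spike (m0 n).
have s n : supported_in (step n) (spike (m n)) := spike_supported (m0 n).
have c1 : (fun n => ip g1 ('D_e1 (spike (m n)))) @ \oo --> (0 : R).
  apply: (ip_concentrating_cvg0 (C := M1)) => // [n|n|n x].
  - exact: test_measurable (test_D1 (t n)).
  - exact: supported_in_derive (s n).
  - have [-> _] := derive_spike (m n) x.
    by rewrite ms invrK normrM gtr0_norm// mulrC ler_wpM2r// ltW.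
have c2 : (fun n => ip g2 ('D_e2 (spike (m n)))) @ \oo --> (0 : R).
  apply: (ip_concentrating_cvg0 (C := M2)) => // [n|n|n x].
  - exact: test_measurable (test_D2 (t n)).
  - exact: supported_in_derive (s n).
  - have [_ ->] := derive_spike (m n) x.
    by rewrite ms invrK normrM gtr0_norm// mulrC ler_wpM2r// ltW.
have c3 : (fun n => ip f (spike (m n))) @ \oo --> (0 : R).
  apply: (ip_concentrating_cvg0 (C := M)) => // [n|n x].
  - exact: test_measurable.
  - rewrite ms invrK; apply: le_trans (b (m n * x.1 + 0, m n * x.2 + 0)) _.
    by rewrite ler_peMr.
have c4 := cvgD (cvgD c1 c2) c3; rewrite !addr0 in c4.
have E n : c * bell (0, 0) = ip g1 ('D_e1 (spike (m n))) + ip g2 ('D_e2 (spike (m n))) + ip f (spike (m n)).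
  by rewrite -H// /spike /profile /bell /= mulr0 addr0.
have c5 : (fun n : nat => c * bell (0, 0)) @ \oo --> (0 : R).
  by rewrite (_ : (fun n => _) = (fun n => ip g1 ('D_e1 (spike (m n))) +
    ip g2 ('D_e2 (spike (m n))) + ip f (spike (m n)))); [exact: c4|apply/funext => n; exact: E].
have c6 : (fun n : nat => c * bell (0, 0)) @ \oo --> (c * bell (0, 0)) by exact: cvg_cst.
have E0 : c * bell (0, 0) = 0 := cvg_unique (@Rhausdorff R) c6 c5.
have b0 : 0 < bell (0, 0) :> R.
  by apply: bell_gt0; split; rewrite /= in_itv/= ?oppr_lt0 ?ltr01.
by apply: (mulIf (lt0r_neq0 b0)); rewrite mul0r; exact: E0.
Qed.

Lemma sobolev_ae f f' g1 g2 : measurable_fun setT f' -> {ae mu, forall x, f x = f' x} ->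
  sobolev f g1 g2 -> sobolev f' g1 g2.
Proof.
move=> mf' ff' [Lf L1 L2' w1 w2]; have [mf if2] := Lf.
have Lf' : L2 f'.
  split => //; apply/integrableP; split; first by apply/measurable_EFinP; exact: measurable_funX.
  have /integrableP[_] := if2; congr (_ < +oo)%E; apply: ae_eq_integral => //.
  - by apply: measurableT_comp => //; apply/measurable_EFinP; exact: measurable_funX.
  - by apply: measurableT_comp => //; apply/measurable_EFinP; exact: measurable_funX.
  - by apply: negligibleS ff' => x /= h E; apply: h => _; rewrite /= E.
split => // psi tp.
  by rewrite -(ip_ae mf mf' (test_measurable (test_D1 tp)) ff') w1.
by rewrite -(ip_ae mf mf' (test_measurable (test_D2 tp)) ff') w2.
Qed.

Lemma sobolev_laplacian f g1 g2 psi : sobolev f g1 g2 -> test_function psi ->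
  ip f (laplacian psi) = - (ip g1 ('D_e1 psi) + ip g2 ('D_e2 psi)).
Proof.
move=> [Lf L1 L2' w1 w2] tp; rewrite (ip_laplacian Lf tp).
exact: etrans (congr2 +%R (w1 _ (test_D1 tp)) (w2 _ (test_D2 tp))) (esym (opprD _ _)).
Qed.

(* A multiple of the parametrix lies in [H^1] only if it vanishes. *)
Lemma parametrix_coefficient (w s : R) (K rho f g1 g2 : plane R -> R) : L2 K -> L2 rho ->
  (forall psi, test_function psi ->
     ip K (fun x => - laplacian psi x + w * psi x) = psi (0, 0) - ip rho psi) ->
  sobolev f g1 g2 -> {ae mu, forall x, f x = s * K x} -> s = 0.
Proof.
move=> LK Lr HK sf fK; have [Lf L1 L2' _ _] := sf.
apply: (@no_delta s (fun x => w * f x + s * rho x) g1 g2) => //; first exact: L2D (L2Z _ _) (L2Z _ _).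
move=> psi tp; have Lp := test_L2 tp; have Ll := test_L2 (test_laplacian tp).
rewrite (ipDl (L2Z w Lf) (L2Z s Lr) Lp) (ipZl w Lf Lp) (ipZl s Lr Lp).
have LP : L2 (fun x => - laplacian psi x + w * psi x) := L2D (L2N Ll) (L2Z w Lp).
have [[mf _] [mK _] [mP _]] := And3 Lf LK LP.
have E := ip_ae mf (measurable_funM (measurable_cst s) mK) mP fK.
rewrite (ipZl s LK LP) (HK _ tp) (ipDr (L2N Ll) (L2Z w Lp) Lf) (ipNr Ll Lf) (ipZr w Lp Lf)
  (sobolev_laplacian sf tp) opprK in E.
have arith (a b p y r : R) : a + b + w * p = s * (y - r) -> s * y = a + b + (w * p + s * r).
  move=> E'; have -> : s * y = s * (y - r) + s * r by ring.
  by rewrite -E'; ring.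
exact: arith E.
Qed.

End no_delta.

(** * Complex-valued functions *)

Section complex_functions.
Context {R : realType}.
Local Notation mu := (mu2 R).
Local Notation ip := (ip mu).
Local Notation L2 := (L2 mu).
Implicit Types (u v g : plane R -> R[i]) (psi : R * R -> R).

Definition re u : plane R -> R := fun x => complex.Re (u x).
Definition im u : plane R -> R := fun x => complex.Im (u x).
Definition rc (f : plane R -> R) : plane R -> R[i] := fun x => (f x)%:C%C.

Lemma cabs_sqr u x : cabs u x ^+ 2 = re u x ^+ 2 + im u x ^+ 2.
Proof. by rewrite /cabs /re /im; case: (u x) => a b /=; rewrite sqr_sqrtr// addr_ge0 ?sqr_ge0. Qed.

Lemma cabs_ge0 u x : 0 <= cabs u x.
Proof. by rewrite /cabs; case: (u x) => a b /=; exact: sqrtr_ge0. Qed.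

Lemma cabsE u : cabs u = (fun x => Num.sqrt (re u x ^+ 2 + im u x ^+ 2)).
Proof. by apply/funext => x; rewrite -cabs_sqr sqrtr_sqr ger0_norm// cabs_ge0. Qed.

Lemma measurable_cabs u : cmeasurable u -> measurable_fun setT (cabs u).
Proof.
move=> [mr mi]; rewrite cabsE; apply: measurable_sqrt_ge0.
  by move=> x; rewrite addr_ge0 ?sqr_ge0.
by apply: measurable_funD; exact: measurable_funX.
Qed.

Lemma Lnorm_poweR u n : ('N[mu]_(n.+1%:R%:E) [EFin \o cabs u] `^ n.+1%:R =
  \int[mu]_x (cabs u x ^+ n.+1)%:E)%E.
Proof.
rewrite poweR_Lnorm ?pnatr_eq0//; apply: eq_integral => x _.
by rewrite /= powR_mulrn ?normr_ge0// ger0_norm ?cabs_ge0.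
Qed.

(** No integrability is assumed: if the norm is infinite, both sides take the default value 0. *)
Lemma lnorm_exp u n : lnorm n.+1%:R u ^+ n.+1 = \int[mu]_x (cabs u x ^+ n.+1).
Proof.
rewrite /Rintegral -Lnorm_poweR /lnorm.
have : (0 <= 'N[mu]_(n.+1%:R%:E) [EFin \o cabs u])%E by exact: Lnorm_ge0.
case: ('N[_]_(_)[_])%E => [r|_|]//=.
  by rewrite lee_fin => r0; rewrite powR_mulrn.
by rewrite pnatr_eq0 /= expr0n.
Qed.

Lemma finite_norm2P u : cmeasurable u ->
  finite_norm mu 2%:E (cabs u) <-> mu.-integrable setT (EFin \o (fun x => cabs u x ^+ 2)).
Proof.
move=> mu_; have mc := measurable_cabs mu_.
have E : (\int[mu]_x `|(EFin \o (fun x => cabs u x ^+ 2)%R) x| = 'N[mu]_(2%:E) [EFin \o cabs u] `^ 2)%E.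
  rewrite (Lnorm_poweR u 1); apply: eq_integral => x _.
  by rewrite /= ger0_norm// sqr_ge0.
have : (0 <= 'N[mu]_(2%:E) [EFin \o cabs u])%E by exact: Lnorm_ge0.
rewrite /finite_norm => N0; split.
  move=> fin; apply/integrableP; split; first by apply/measurable_EFinP; exact: measurable_funX.
  by rewrite E; move: N0 fin; case: ('N[_]_(_)[_])%E => [r|//|//] _ _; rewrite poweR_EFin ltry.
move=> /integrableP[_]; rewrite E; move: N0; case: ('N[_]_(_)[_])%E => [r _ _|_|//]; first by rewrite ltry.
by rewrite poweRyr.
Qed.

Lemma lebesgue_space2P u : lebesgue_space 2 u <-> L2 (re u) /\ L2 (im u).
Proof.
split=> [[mu_ fn]|[[mr ir] [mi ii]]].
  have [mr mi] := mu_; have iu := (finite_norm2P mu_).1 fn.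
  split; split => //; apply: le_integrable iu => //.
  - by apply/measurable_EFinP; exact: measurable_funX.
  - by move=> x _; rewrite /= lee_fin !ger0_norm ?sqr_ge0// cabs_sqr lerDl sqr_ge0.
  - by apply/measurable_EFinP; exact: measurable_funX.
  - by move=> x _; rewrite /= lee_fin !ger0_norm ?sqr_ge0// cabs_sqr lerDr sqr_ge0.
have mu_ : cmeasurable u by split.
split => //; apply/finite_norm2P => //.
have := integrableD measurableT ir ii; apply: eq_integrable => // x _.
by rewrite /= cabs_sqr.
Qed.

Lemma lnorm2_sqr u : lebesgue_space 2 u ->
  lnorm 2 u ^+ 2 = ip (re u) (re u) + ip (im u) (im u).
Proof.
move=> /lebesgue_space2P[Lr Li]; rewrite (lnorm_exp u 1).
have ir := L2_integrableM Lr Lr; have ii := L2_integrableM Li Li.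
rewrite !ipE -(RintegralD measurableT ir ii); apply: eq_Rintegral => x _.
by rewrite cabs_sqr !expr2.
Qed.

Lemma cintegral_mul u psi :
  cintegral (fun x => u x * (psi x)%:C%C) = (ip (re u) psi +i* ip (im u) psi)%C.
Proof.
rewrite /cintegral !ipE; congr (_ +i* _)%C; apply: eq_Rintegral => x _; rewrite /re /im.
  by case: (u x) => a b /=; rewrite mulr0 subr0.
by case: (u x) => a b /=; rewrite mulr0 add0r.
Qed.

Lemma weak_derivativeP e u g :
  is_weak_derivative e u g <-> wderiv e (re u) (re g) /\ wderiv e (im u) (im g).
Proof.
split=> [H|[Hr Hi] psi tp].
  have H' psi : test_function psi ->
      ip (re u) ('D_e psi) = - ip (re g) psi /\ ip (im u) ('D_e psi) = - ip (im g) psi.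
    by move=> tp; have := H psi tp; rewrite !cintegral_mul => -[].
  by split=> psi /H'[].
by rewrite !cintegral_mul Hr// Hi.
Qed.

Definition csobolev u r1 r2 i1 i2 := sobolev (re u) r1 r2 /\ sobolev (im u) i1 i2.

Lemma H1P u : H1 u <-> exists r1 r2 i1 i2, csobolev u r1 r2 i1 i2.
Proof.
split=> [[/lebesgue_space2P[Lr Li] [g1 [/lebesgue_space2P[Lr1 Li1] /weak_derivativeP[wr1 wi1]]]
    [g2 [/lebesgue_space2P[Lr2 Li2] /weak_derivativeP[wr2 wi2]]]]|].
  by exists (re g1), (re g2), (im g1), (im g2).
move=> [r1 [r2 [i1 [i2 [[Lr Lr1 Lr2 wr1 wr2] [Li Li1 Li2 wi1 wi2]]]]]].
split; first exact/lebesgue_space2P.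
  exists (fun x => (r1 x +i* i1 x)%C); split; first exact/lebesgue_space2P.
  exact/weak_derivativeP.
exists (fun x => (r2 x +i* i2 x)%C); split; first exact/lebesgue_space2P.
exact/weak_derivativeP.
Qed.

(** The derivative picked by choice agrees almost everywhere with any given one, so its norm can be
    read off the latter. *)
Lemma weak_derivative_sqr e u r i : axis e -> L2 r -> L2 i ->
  wderiv e (re u) r -> wderiv e (im u) i ->
  lnorm 2 (weak_derivative e u) ^+ 2 = ip r r + ip i i.
Proof.
move=> ax Lr Li wr wi; rewrite /weak_derivative.
case: xgetP => [g _ [Lg /weak_derivativeP[wr' wi']]|H].
  rewrite lnorm2_sqr//; have /lebesgue_space2P[Lr' Li'] := Lg.
  have ae (p q : plane R -> R) : L2 p -> L2 q -> {ae mu, forall x, p x = q x} -> ip p p = ip q q.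
    move=> [mp _] [mq _] pq; rewrite (ip_ae mp mq mp pq) ipC; exact: ip_ae.
  by rewrite (ae _ _ Lr' Lr (wderiv_unique Lr' Lr wr' wr)) (ae _ _ Li' Li (wderiv_unique Li' Li wi' wi)).
exfalso; apply: (H (fun x => (r x +i* i x)%C)); split; first exact/lebesgue_space2P.
exact/weak_derivativeP.
Qed.

Lemma grad_norm2E u r1 r2 i1 i2 : csobolev u r1 r2 i1 i2 ->
  grad_norm2 u = ip r1 r1 + ip i1 i1 + (ip r2 r2 + ip i2 i2).
Proof.
move=> [[Lr Lr1 Lr2 wr1 wr2] [Li Li1 Li2 wi1 wi2]].
exact: (congr2 +%R (weak_derivative_sqr axis1 Lr1 Li1 wr1 wi1)
  (weak_derivative_sqr axis2 Lr2 Li2 wr2 wi2)).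
Qed.

Lemma is_greenP (lam : R) g : is_green lam g <->
  [/\ L2 (re g), L2 (im g),
    forall psi, test_function psi ->
      ip (re g) (fun x => - laplacian psi x + lam * psi x) = psi (0, 0) &
    forall psi, test_function psi ->
      ip (im g) (fun x => - laplacian psi x + lam * psi x) = 0].
Proof.
split=> [[/lebesgue_space2P[Lr Li] H]|[Lr Li Hr Hi]].
  by split => // psi tp; have := H psi tp; rewrite cintegral_mul => -[].
split; first exact/lebesgue_space2P.
by move=> psi tp; rewrite cintegral_mul Hr// Hi.
Qed.

End complex_functions.

(** * Charged functions *)

Section point_charge.
Context {R : realType}.
Local Notation mu := (mu2 R).
Local Notation ip := (ip mu).
Local Notation L2 := (L2 mu).
Implicit Types (u v : plane R -> R[i]) (f g h : plane R -> R) (psi : R * R -> R).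

Variables (w : R) (K rho : plane R -> R).
Hypotheses (LK : L2 K) (Lrho : L2 rho).
Hypothesis HK : forall psi, test_function psi ->
  ip K (fun x => - laplacian psi x + w * psi x) = psi (0, 0) - ip rho psi.

Lemma ip0l f : ip (fun=> 0) f = 0.
Proof.
rewrite ipE; have -> : (fun x : plane R => 0 * f x) = cst 0 by apply/funext => x; rewrite mul0r.
by rewrite Rintegral_cst//= mul0r.
Qed.

Lemma L2_helmholtz (lam : R) psi : test_function psi ->
  L2 (fun x => - laplacian psi x + lam * psi x).
Proof. by move=> tp; exact: L2D (L2N (test_L2 (test_laplacian tp))) (L2Z _ (test_L2 tp)). Qed.

Lemma ip_helmholtz (lam : R) f psi : L2 f -> test_function psi ->
  ip f (fun x => - laplacian psi x + lam * psi x) = - ip f (laplacian psi) + lam * ip f psi.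
Proof.
move=> Lf tp; have [Lp Ll] := (test_L2 tp, test_L2 (test_laplacian tp)).
by rewrite (ipDr (L2N Ll) (L2Z lam Lp) Lf) (ipNr Ll Lf) (ipZr lam Lp Lf).
Qed.

(** What (- Delta + lam) h must equal for K + h to solve the Green equation at lam, given that (-
    Delta + w) K is the point mass minus rho. *)
Definition green_source (lam : R) : plane R -> R := fun x => rho x + (w - lam) * K x.

Lemma green_correction (lam : R) : 0 < lam -> exists h h1 h2, [/\ sobolev h h1 h2,
   forall f g1 g2, sobolev f g1 g2 ->
     ip h1 g1 + ip h2 g2 + lam * ip h f = ip (green_source lam) f,
   L2 (re (green lam)) /\ L2 (im (green lam)),
   {ae mu, forall x, re (green lam) x = K x + h x} &
   {ae mu, forall x, im (green lam) x = 0}].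
Proof.
move=> lam0.
have LF : L2 (green_source lam) := L2D Lrho (L2Z _ LK).
have [h [h1 [h2 [sh Hh]]]] := weak_solution lam0 LF.
have [Lh _ _ _ _] := sh.
have LG : L2 (fun x => K x + h x) := L2D LK Lh.
have HG psi : test_function psi ->
    ip (fun x => K x + h x) (fun x => - laplacian psi x + lam * psi x) = psi (0, 0).
  move=> tp; have Lp := test_L2 tp.
  rewrite (ipDl LK Lh (L2_helmholtz lam tp)) (ip_helmholtz lam Lh tp) (ip_helmholtz lam LK tp).
  rewrite (sobolev_laplacian sh tp) opprK.
  have E1 := HK tp; rewrite (ip_helmholtz w LK tp) in E1.
  have E2 := Hh _ _ _ (sobolev_test tp).
  rewrite /green_source (ipDl Lrho (L2Z _ LK) Lp) (ipZl _ LK Lp) in E2.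
  have arith (p q r s t y : R) : - p + w * q = y - r -> s + lam * t = r + (w - lam) * q ->
      - p + lam * q + (s + lam * t) = y.
    by move=> A ->; rewrite (_ : - p = y - r - w * q); [ring|rewrite -A; ring].
  by apply: arith E1 E2.
(* Exhibiting one solution makes the choice behind [green] meaningful; the uniqueness theorem then
   identifies it with K + h. *)
have G0 : is_green lam (rc (fun x => K x + h x)).
  apply/is_greenP; split => //; first exact: (L20 mu).
  by move=> psi tp; exact: ip0l.
exists h, h1, h2.
have : is_green lam (green lam).
  by rewrite /green; case: xgetP => [g _ //|H]; case: (H _ G0).
move=> /is_greenP[Lr Li Hr Hi]; split => //; last first.
  exact: (green_homogeneous_eq0 lam0 Li Hi).
have : {ae mu, forall x, re (green lam) x - (K x + h x) = 0}.
  apply: (green_homogeneous_eq0 lam0 (L2B Lr LG)) => psi tp.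
  by rewrite (ipBl Lr LG (L2_helmholtz lam tp)) Hr// HG// subrr.
by apply: filterS => x /eqP; rewrite subr_eq0 => /eqP.
Qed.

Lemma K_coefficient (s : R) f g1 g2 : sobolev f g1 g2 -> {ae mu, forall x, f x = s * K x} -> s = 0.
Proof. exact: parametrix_coefficient LK Lrho HK. Qed.

Lemma sobolev_lincomb (s : R) f g1 g2 h h1 h2 : sobolev f g1 g2 -> sobolev h h1 h2 ->
  sobolev (fun x => f x + s * h x) (fun x => g1 x + s * h1 x) (fun x => g2 x + s * h2 x).
Proof. by move=> sf sh; exact: sobolevD sf (sobolevZ s sh). Qed.

(** The singular part uses K instead of [green lam]: one family of functions, independent of lam,
    with an explicit positive singularity. *)
Definition charged (s : R) f : plane R -> R[i] := rc (fun x => f x + s * K x).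

Lemma regular_charged (lam s : R) f g1 g2 h h1 h2 :
  L2 (re (green lam)) -> L2 (im (green lam)) -> sobolev h h1 h2 ->
  {ae mu, forall x, re (green lam) x = K x + h x} -> {ae mu, forall x, im (green lam) x = 0} ->
  sobolev f g1 g2 ->
  [/\ {ae mu, forall x, re (fun x => charged s f x - s%:C%C * green lam x) x = f x + (- s) * h x},
   {ae mu, forall x, im (fun x => charged s f x - s%:C%C * green lam x) x = 0} &
   csobolev (fun x => charged s f x - s%:C%C * green lam x)
     (fun x => g1 x + (- s) * h1 x) (fun x => g2 x + (- s) * h2 x) (fun=> 0) (fun=> 0)].
Proof.
move=> Lr Li sh gr gi sf; have [[Lf _ _ _ _] [Lh _ _ _ _]] := (sf, sh).
have reE x : re (fun x => charged s f x - s%:C%C * green lam x) x =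
    f x + s * K x - s * re (green lam) x.
  by rewrite /re /charged /rc; case: (green lam x) => a b /=; rewrite mul0r subr0.
have imE x : im (fun x => charged s f x - s%:C%C * green lam x) x = - s * im (green lam) x.
  by rewrite /im /charged /rc; case: (green lam x) => a b /=; rewrite mul0r addr0 sub0r mulNr.
have ar : {ae mu, forall x, re (fun x => charged s f x - s%:C%C * green lam x) x = f x + (- s) * h x}.
  apply: filterS gr => x E; rewrite reE E; ring.
have ai : {ae mu, forall x, im (fun x => charged s f x - s%:C%C * green lam x) x = 0}.
  by apply: filterS gi => x E; rewrite imE E mulr0.
split => //; split.
  apply: sobolev_ae (sobolev_lincomb (- s) sf sh).
    have -> : re (fun x => charged s f x - s%:C%C * green lam x) =
        (fun x => f x + s * K x - s * re (green lam) x) by apply/funext.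
    by have [] := L2B (L2D Lf (L2Z s LK)) (L2Z s Lr).
  by apply: filterS ar => x ->.
apply: sobolev_ae sobolev0.
  have -> : im (fun x => charged s f x - s%:C%C * green lam x) =
      (fun x => - s * im (green lam) x) by apply/funext.
  by have [] := L2Z (- s) Li.
by apply: filterS ai => x ->.
Qed.

(** Membership follows from [green_correction], uniqueness from [parametrix_coefficient]: a second
    charge would place a nonzero multiple of K in H^1. *)
Lemma charge_charged (s : R) f g1 g2 : sobolev f g1 g2 ->
  Defs.charge (charged s f) = s%:C%C /\ H1_alpha (charged s f).
Proof.
move=> sf; have [Lf _ _ _ _] := sf.
have sC : charges (charged s f) s%:C%C.
  exists 1 => //; apply/H1P; have [h [h1 [h2 [sh _ [Lr Li] gr gi]]]] := green_correction (@ltr01 R).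
  have [_ _ H] := regular_charged s Lr Li sh gr gi sf.
  by exists (fun x => g1 x + (- s) * h1 x), (fun x => g2 x + (- s) * h2 x), (fun=> 0), (fun=> 0).
split; last first.
  split; last by exists s%:C%C.
  apply/lebesgue_space2P; split; last exact: (L20 mu).
  exact: L2D Lf (L2Z s LK).
rewrite /Defs.charge; case: xgetP => [[a b] _ [lam lam0 /H1P[r1 [r2 [i1 [i2 [sr si]]]]]]|H]; last first.
  by case: (H _ sC).
have [h [h1 [h2 [sh Hh [Lr Li] gr gi]]]] := green_correction lam0.
(* Removing f and restoring a h from the real part of the putative regular part leaves (s - a) K, a
   Sobolev function. *)
have aE : s - a = 0.
  have s1 := sobolev_lincomb a (sobolev_lincomb (-1) sr sf) sh.
  apply: (K_coefficient s1).
  move: gr gi; apply: filterS2 => x; rewrite /re /im /charged /rc.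
  by case: (green lam x) => p q /= -> ->; ring.
have bE : - b = 0.
  have s1 := sobolev_lincomb b si sh.
  apply: (K_coefficient s1).
  move: gr gi; apply: filterS2 => x; rewrite /re /im /charged /rc.
  by case: (green lam x) => p q /= -> ->; ring.
by move/eqP: bE; rewrite oppr_eq0 => /eqP ->; move/eqP: aE; rewrite subr_eq0 => /eqP ->.
Qed.

(** The regular part is f - s h. By the equation of h its cross term is - 2 s <rho + (w - lam) K,
    f>, and the K contribution cancels the one from (w - lam) times the norm of f + s K. *)
Lemma qform_charged (alpha lam : R) : 0 < lam -> exists c0 : R, forall s f g1 g2,
  sobolev f g1 g2 -> qform alpha w lam (charged s f) =
    ip g1 g1 + ip g2 g2 + w * ip f f - 2 * s * ip rho f + c0 * s ^+ 2.
Proof.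
move=> lam0.
have [h [h1 [h2 [sh Hh [Lr Li] gr gi]]]] := green_correction lam0.
(* Energy of h, norm of K and the charge term: the whole coefficient of s^2, of unspecified sign. *)
exists (ip h1 h1 + ip h2 h2 + lam * ip h h + (w - lam) * ip K K + (alpha + theta lam)) => s f g1 g2 sf.
have [cE _] := charge_charged s sf; have [ar ai cs] := regular_charged s Lr Li sh gr gi sf.
have regE : regular_part lam (charged s f) = (fun x => charged s f x - s%:C%C * green lam x).
  by rewrite /regular_part cE.
have [Lf L1 L2' _ _] := sf; have [Lh Lh1 Lh2 _ _] := sh.
have [[Lre _ _ _ _] [Lim _ _ _ _]] := cs.
have ip_eq (p q : plane R -> R) : L2 p -> L2 q -> {ae mu, forall x, p x = q x} -> ip p p = ip q q.
  move=> [mp _] [mq _] pq; rewrite (ip_ae mp mq mp pq) ipC; exact: ip_ae.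
have sq (p q : plane R -> R) : L2 p -> L2 q ->
    ip (fun x => p x + (- s) * q x) (fun x => p x + (- s) * q x) =
    ip p p - 2 * s * ip p q + s ^+ 2 * ip q q.
  by move=> Lp Lq; rewrite (ip_sqrD Lp (L2Z _ Lq)) (ipZr _ Lq Lp) (ip_sqrZ _ Lq); ring.
have Esq : lnorm 2 (regular_part lam (charged s f)) ^+ 2 =
    ip f f - 2 * s * ip f h + s ^+ 2 * ip h h.
  rewrite regE lnorm2_sqr; last exact/lebesgue_space2P.
  rewrite (ip_eq _ _ Lre (L2D Lf (L2Z _ Lh)) ar) (ip_eq _ _ Lim (L20 mu) ai) ip0l addr0.
  exact: sq.
have Eu : lnorm 2 (charged s f) ^+ 2 = ip f f + 2 * s * ip f K + s ^+ 2 * ip K K.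
  rewrite lnorm2_sqr; last first.
    by apply/lebesgue_space2P; split; [exact: L2D Lf (L2Z s LK)|exact: (L20 mu)].
  rewrite (_ : im (charged s f) = (fun=> 0))// ip0l addr0.
  rewrite (_ : re (charged s f) = (fun x => f x + s * K x))//.
  by rewrite (ip_sqrD Lf (L2Z _ LK)) (ipZr _ LK Lf) (ip_sqrZ _ LK); ring.
rewrite /qform Esq Eu regE (grad_norm2E cs) !ip0l !addr0 (sq _ _ L1 Lh1) (sq _ _ L2' Lh2) cE.
have nE : ComplexField.Normc.normc (s%:C)%C ^+ 2 = s ^+ 2.
  by rewrite /= expr0n/= addr0 sqrtr_sqr real_normK ?num_real.
rewrite nE; have := Hh _ _ _ sf.
rewrite /green_source (ipDl Lrho (L2Z _ LK) Lf) (ipZl _ LK Lf).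
rewrite [ip f h]ipC [ip g1 h1]ipC [ip g2 h2]ipC [ip f K]ipC.
move: (ip h1 g1) (ip h2 g2) (ip h f) (ip rho f) (ip K f) => p q r t y E.
have -> : t = p + q + lam * r - (w - lam) * y by rewrite E; ring.
by ring.
Qed.

End point_charge.

(** * Competitors for the Nehari level *)

Section modulus.
Context {R : realType}.
Local Notation mu := (mu2 R).
Local Notation ip := (ip mu).
Local Notation L2 := (L2 mu).
Implicit Types (u : plane R -> R[i]) (f g h : plane R -> R).

Definition modulus (a b : R) : R := Num.sqrt (a ^+ 2 + b ^+ 2).

Lemma modulus_sqr (a b : R) : modulus a b ^+ 2 = a ^+ 2 + b ^+ 2.
Proof. by rewrite sqr_sqrtr// addr_ge0 ?sqr_ge0. Qed.

Lemma modulus_nonexpansive (a b a' b' : R) :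
  (modulus a b - modulus a' b') ^+ 2 <= (a - a') ^+ 2 + (b - b') ^+ 2.
Proof.
have cs : a * a' + b * b' <= modulus a b * modulus a' b'.
  apply: le_trans (ler_norm _) _; apply: norm_le_of_sqr_le; first by rewrite mulr_ge0 ?sqrtr_ge0.
  rewrite exprMn !modulus_sqr -subr_ge0.
  by rewrite (_ : _ - _ = (a * b' - a' * b) ^+ 2) ?sqr_ge0//; ring.
have := modulus_sqr a b; have := modulus_sqr a' b'; move: cs.
move: (modulus a b) (modulus a' b') => p q H Eq Ep.
rewrite (_ : (p - q) ^+ 2 = p ^+ 2 - 2 * (p * q) + q ^+ 2); last by ring.
by rewrite Ep Eq; nra.
Qed.

(** The modulus is a nonexpansive function of the real and imaginary parts, and so is its
    composition with phi. Taking phi = id gives |u|; taking a minimum with a constant gives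
    truncations. *)
Lemma sobolev_modulus u r1 r2 i1 i2 (phi : R -> R) : csobolev u r1 r2 i1 i2 ->
  measurable_fun setT (fun x => phi (cabs u x)) -> phi 0 = 0 ->
  (forall x y, (phi x - phi y) ^+ 2 <= (x - y) ^+ 2) ->
  exists G1 G2, [/\ sobolev (fun x => phi (cabs u x)) G1 G2,
    ip G1 G1 + ip G2 G2 <= ip r1 r1 + ip i1 i1 + (ip r2 r2 + ip i2 i2) &
    ip (fun x => phi (cabs u x)) (fun x => phi (cabs u x)) <= ip (re u) (re u) + ip (im u) (im u)].
Proof.
move=> [[Lr Lr1 Lr2 wr1 wr2] [Li Li1 Li2 wi1 wi2]] mphi phi0 phiN.
have E : (fun x => phi (cabs u x)) = (fun x => phi (modulus (re u x) (im u x))).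
  by rewrite cabsE.
rewrite E in mphi *.
have z : phi (modulus 0 0) = 0 by rewrite /modulus expr0n/= addr0 sqrtr0.
have N a b a' b' : (phi (modulus a b) - phi (modulus a' b')) ^+ 2 <= (a - a') ^+ 2 + (b - b') ^+ 2.
  exact: le_trans (phiN _ _) (modulus_nonexpansive a b a' b').
have [LF [G1 [LG1 le1 w1]]] := wderiv_nonexpansive axis1 Lr Li Lr1 Li1 wr1 wi1 mphi z N.
have [_ [G2 [LG2 le2 w2]]] := wderiv_nonexpansive axis2 Lr Li Lr2 Li2 wr2 wi2 mphi z N.
exists G1, G2; split; [by split|exact: lerD le1 le2|].
apply: (L2_of_sqr_le mphi Lr Li _).2 => x.
by have := N (re u x) (im u x) 0 0; rewrite z !subr0.
Qed.

Lemma truncation_nonexpansive (M x y : R) :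
  (Num.min x M - Num.min y M) ^+ 2 <= (x - y) ^+ 2.
Proof.
rewrite /Num.min; case: ltP => hx; case: ltP => hy.
- exact: lexx.
- have : 0 <= (y - M) * (M - x) by rewrite mulr_ge0 ?subr_ge0 ?(ltW hx).
  have : 0 <= (y - M) ^+ 2 by exact: sqr_ge0.
  by nra.
- have : 0 <= (x - M) * (M - y) by rewrite mulr_ge0 ?subr_ge0 ?(ltW hy).
  have : 0 <= (x - M) ^+ 2 by exact: sqr_ge0.
  by nra.
- by rewrite subrr expr0n sqr_ge0.
Qed.

End modulus.

Section competitors.
Context {R : realType}.
Local Notation mu := (mu2 R).
Local Notation ip := (ip mu).
Local Notation L2 := (L2 mu).
Implicit Types (u v : plane R -> R[i]) (f g h : plane R -> R).

Variables (alpha w wt beta lam : R) (K rho : plane R -> R) (c0 : R).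
Hypotheses (LK : L2 K) (Lrho : L2 rho).
Hypothesis HK : forall psi, test_function psi ->
  ip K (fun x => - laplacian psi x + w * psi x) = psi (0, 0) - ip rho psi.
Hypothesis Hc0 : forall s f g1 g2, sobolev f g1 g2 ->
  qform alpha w lam (charged K s f) =
    ip g1 g1 + ip g2 g2 + w * ip f f - 2 * s * ip rho f + c0 * s ^+ 2.

Definition sq f : plane R -> R := fun x => f x ^+ 2.

Lemma sqZ (a : R) f : sq (fun x => a * f x) = (fun x => a ^+ 2 * sq f x).
Proof. by apply/funext => x; rewrite /sq exprMn. Qed.

Lemma L2_mul_of_sq f g : measurable_fun setT f -> measurable_fun setT g ->
  L2 (sq f) -> L2 (sq g) -> L2 (fun x => f x * g x).
Proof.
move=> mf mg Lf Lg; apply: (L2_of_sqr_le _ Lf Lg _).1 => [|x].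
  exact: measurable_funM.
rewrite /sq exprMn; move: (sqr_ge0 (f x ^+ 2 - g x ^+ 2)) (sqr_ge0 (f x ^+ 2)) (sqr_ge0 (g x ^+ 2)).
by move: (f x ^+ 2) (g x ^+ 2) => a b; nra.
Qed.

Definition quadratic (s : R) f f1 f2 g g1 g2 : R :=
  ip f1 f1 + ip f2 f2 + w * ip f f - 2 * s * ip rho f + c0 * s ^+ 2
  + (ip g1 g1 + ip g2 g2) + wt * ip g g.

Definition quartic f g : R :=
  ip (sq f) (sq f) + ip (sq g) (sq g) + 2 * beta * ip (sq f) (sq g).

Lemma quadraticZ (t s : R) f f1 f2 g g1 g2 : sobolev f f1 f2 -> sobolev g g1 g2 ->
  quadratic (t * s) (fun x => t * f x) (fun x => t * f1 x) (fun x => t * f2 x)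
    (fun x => t * g x) (fun x => t * g1 x) (fun x => t * g2 x) =
  t ^+ 2 * quadratic s f f1 f2 g g1 g2.
Proof.
move=> [Lf Lf1 Lf2 _ _] [Lg Lg1 Lg2 _ _].
rewrite /quadratic (ip_sqrZ t Lf) (ip_sqrZ t Lf1) (ip_sqrZ t Lf2) (ip_sqrZ t Lg)
  (ip_sqrZ t Lg1) (ip_sqrZ t Lg2) (ipZr t Lf Lrho).
by ring.
Qed.

Lemma quarticZ (t : R) f g : L2 (sq f) -> L2 (sq g) ->
  quartic (fun x => t * f x) (fun x => t * g x) = t ^+ 4 * quartic f g.
Proof.
move=> Lf Lg; rewrite /quartic !sqZ (ip_sqrZ _ Lf) (ip_sqrZ _ Lg).
by rewrite (ipZl _ Lf (L2Z _ Lg)) (ipZr _ Lg Lf); ring.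
Qed.

Lemma lnorm4E u : lnorm 4 u ^+ 4 = ip (sq (cabs u)) (sq (cabs u)).
Proof. by rewrite (lnorm_exp u 3) ipE; apply: eq_Rintegral => x _; rewrite /sq -exprD. Qed.

Lemma couplingE u v : coupling u v = ip (sq (cabs u)) (sq (cabs v)).
Proof.
rewrite /coupling ipE; apply: eq_Rintegral => x _; rewrite /sq -exprMn; congr (_ ^+ 2).
by rewrite /cabs /=; exact: ComplexField.Normc.normcM.
Qed.

Lemma sq_cabs_rc f : sq (cabs (rc f)) = sq f.
Proof. by apply/funext => x; rewrite /sq cabs_sqr /re /im /= expr0n addr0. Qed.

Lemma functionalsE (s : R) f f1 f2 g g1 g2 : sobolev f f1 f2 -> sobolev g g1 g2 ->
  let Q := quadratic s f f1 f2 g g1 g2 in let P := quartic (fun x => f x + s * K x) g in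
  action alpha w wt beta lam (charged K s f) (rc g) = Q / 2 - P / 4 /\
  nehari_functional alpha w wt beta lam (charged K s f) (rc g) = Q - P.
Proof.
move=> sf sg /=; have [Lg _ _ _ _] := sg.
have G : grad_norm2 (rc g) = ip g1 g1 + ip g2 g2.
  by rewrite (@grad_norm2E _ (rc g) g1 g2 (fun=> 0) (fun=> 0)) ?ip0l ?addr0//; split => //; exact: sobolev0.
have N : lnorm 2 (rc g) ^+ 2 = ip g g.
  rewrite lnorm2_sqr; last by apply/lebesgue_space2P; split; [exact: Lg|exact: (L20 mu)].
  by rewrite (_ : im (rc g) = (fun=> 0))// ip0l addr0.
rewrite /action /nehari_functional !lnorm4E couplingE !sq_cabs_rc (Hc0 s sf) G N /quartic /quadratic.
by split; [field|ring].
Qed.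

Lemma level_le (s : R) f f1 f2 g g1 g2 : sobolev f f1 f2 -> sobolev g g1 g2 ->
  let F := fun x => f x + s * K x in
  let Q := quadratic s f f1 f2 g g1 g2 in let P := quartic F g in
  L2 (sq F) -> L2 (sq g) -> 0 < Q -> 0 < P ->
  (nehari_level alpha w wt beta lam <= (Q ^+ 2 / (4 * P))%:E)%E.
Proof.
move=> sf sg F Q P LF Lg Q0 P0.
pose t := Num.sqrt (Q / P).
have t2 : t ^+ 2 = Q / P by rewrite sqr_sqrtr// divr_ge0 ?(ltW Q0) ?(ltW P0).
have sft := sobolevZ t sf; have sgt := sobolevZ t sg.
have [] := functionalsE (t * s) sft sgt.
have FE : (fun x => t * f x + t * s * K x) = (fun x => t * F x).
  by apply/funext => x; rewrite /F mulrDr mulrA.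
rewrite FE (quadraticZ t s sf sg) (quarticZ t LF Lg) -/P -/Q => AE NE.
have t4 : t ^+ 4 = (Q / P) ^+ 2 by rewrite -t2 -exprM.
have P0' : P != 0 by rewrite gt_eqF.
rewrite t2 t4 in AE NE.
have -> : Q ^+ 2 / (4 * P) = Q / P * Q / 2 - (Q / P) ^+ 2 * P / 4 by field.
rewrite -AE; apply: ereal_inf_lbound.
exists (charged K (t * s) (fun x => t * f x), rc (fun x => t * g x)) => //.
split => /=.
- by have [_] := charge_charged LK Lrho HK (t * s) sft.
- apply/H1P; exists (fun x => t * g1 x), (fun x => t * g2 x), (fun=> 0), (fun=> 0).
  by split; [exact: sgt|exact: sobolev0].
- move=> [z1 z2].
  have t0 : t != 0 by rewrite -sqrf_eq0 t2 gt_eqF// divr_gt0.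
  have zF : {ae mu, forall x, sq F x = 0}.
    apply: filterS z1 => x; rewrite /charged /rc => -[E].
    have : t * F x = 0 by rewrite /F -E mulrDr mulrA.
    by move=> /eqP; rewrite mulf_eq0 (negPf t0)/= => /eqP; rewrite /sq => ->; rewrite expr0n.
  have zg : {ae mu, forall x, sq g x = 0}.
    apply: filterS z2 => x; rewrite /rc => -[/eqP].
    by rewrite mulf_eq0 (negPf t0)/= => /eqP; rewrite /sq => ->; rewrite expr0n.
  have ip0 h h' : L2 h -> L2 h' -> {ae mu, forall x, h x = 0} -> ip h h' = 0.
    move=> [mh _] [mh' _] hz; rewrite (ip_ae mh _ mh' hz); last exact: measurable_cst.
    exact: ip0l.
  move: P0; rewrite /P /quartic (ip0 _ _ LF LF zF) (ip0 _ _ Lg Lg zg) (ip0 _ _ LF Lg zF).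
  by rewrite mulr0 !addr0 ltxx.
- by rewrite NE; field.
Qed.

(** * Truncations and integrability of fourth powers *)

Definition truncation (n : nat) f : plane R -> R := fun x => Num.min (f x) n.+1%:R.

(** A function with values in [0, n+1] has its square at most n+1 times itself, so L^2 already gives
    L^4. *)
Lemma L2_sq_truncation n f : (forall x, 0 <= f x) -> measurable_fun setT (truncation n f) ->
  L2 (truncation n f) -> L2 (sq (truncation n f)) /\
  ip (sq (truncation n f)) (sq (truncation n f)) <= n.+1%:R ^+ 2 * ip (truncation n f) (truncation n f).
Proof.
move=> f0 mt Lt; have Lm := L2Z n.+1%:R Lt.
have ms : measurable_fun setT (sq (truncation n f)) by exact: measurable_funX.
have le x : `|sq (truncation n f) x| <= `|n.+1%:R * truncation n f x|.
  have t0 : 0 <= truncation n f x by rewrite /truncation le_min f0 ler0n.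
  rewrite !ger0_norm ?sqr_ge0 ?mulr_ge0 ?ler0n// /sq expr2.
  by apply: ler_wpM2r; rewrite ?t0// /truncation ge_min lexx orbT.
split; first exact: L2_le ms le Lm.
by have := ip_le Lm ms le; rewrite (ip_sqrZ _ Lt).
Qed.

Lemma L2_sq_of_truncations f (C : R) : measurable_fun setT f -> (forall x, 0 <= f x) ->
  (forall n, L2 (sq (truncation n f)) /\ ip (sq (truncation n f)) (sq (truncation n f)) <= C) ->
  L2 (sq f).
Proof.
move=> mf f0 H; have ms : measurable_fun setT (sq f) by exact: measurable_funX.
split => //; apply/integrableP; split; first by apply/measurable_EFinP; exact: measurable_funX.
pose G (n : nat) (x : plane R) := (sq (truncation n f) x ^+ 2)%:E.
have t0 n x : 0 <= truncation n f x by rewrite /truncation le_min f0 ler0n.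
have mG n : measurable_fun setT (G n).
  by have [[m _] _] := H n; apply/measurable_EFinP; exact: measurable_funX.
have G0 n x : setT x -> (0 <= G n x)%E by rewrite lee_fin sqr_ge0.
have ndG (x : plane R) : setT x -> {homo G^~ x : n m / (n <= m)%N >-> (n <= m)%E}.
  move=> _ n m nm; rewrite lee_fin /sq -!exprM lerXn2r ?nnegrE ?t0//.
  by rewrite /truncation le_min !ge_min lexx/= ler_nat ltnS nm orbT.
have limG : (fun x => limn (G^~ x)) = (fun x => `|(sq f x ^+ 2)%:E|%E).
  apply/funext => x; apply: cvg_lim => //; apply: cvg_near_cst.
  exists (Num.truncn (f x)) => // n /= hn.
  have fn : f x <= n.+1%:R.
    by apply: ltW; apply: lt_le_trans (truncnS_gt (f x)) _; rewrite ler_nat ltnS.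
  by rewrite /G /= ger0_norm ?sqr_ge0// /truncation /sq min_l.
have := cvg_monotone_convergence (mu := mu) measurableT mG G0 ndG; rewrite limG => cv.
apply: (@le_lt_trans _ _ C%:E); last exact: ltry.
have cvn : cvgn (fun n => (\int[mu]_x G n x)%E) by exact: (cvgP _ cv).
rewrite -(cvg_lim _ cv)//; apply: lime_le => //; near=> n.
by rewrite -EFin_ip ?lee_fin; have [] := H n.
Unshelve. all: by end_near.
Qed.

Variable q : R.
Hypotheses (q0 : 0 < q) (w0 : 0 < w) (wt0 : 0 < wt) (beta0 : 0 <= beta).
Hypothesis level : nehari_level alpha w wt beta lam = (q / 4)%:E.

Lemma level_bound (s : R) f f1 f2 g g1 g2 : sobolev f f1 f2 -> sobolev g g1 g2 ->
  let F := fun x => f x + s * K x in let Q := quadratic s f f1 f2 g g1 g2 in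
  L2 (sq F) -> L2 (sq g) -> 0 < Q -> q * quartic F g <= Q ^+ 2.
Proof.
move=> sf sg F Q LF Lg Q0; have [P0|P0] := leP (quartic F g) 0.
  by apply: le_trans (sqr_ge0 Q); rewrite pmulr_rle0.
have := level_le sf sg LF Lg Q0 P0; rewrite level lee_fin -/Q -/F => H.
move: H; rewrite ler_pdivlMr ?mulr_gt0// => H; apply: le_trans H.
by rewrite le_eqVlt; apply/orP; left; apply/eqP; field.
Qed.

Lemma csobolev_truncation u r1 r2 i1 i2 n : csobolev u r1 r2 i1 i2 ->
  exists G1 G2, [/\ sobolev (truncation n (cabs u)) G1 G2,
    ip G1 G1 + ip G2 G2 <= ip r1 r1 + ip i1 i1 + (ip r2 r2 + ip i2 i2),
    ip (truncation n (cabs u)) (truncation n (cabs u)) <= ip (re u) (re u) + ip (im u) (im u),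
    L2 (sq (truncation n (cabs u))) &
    0 < ip (sq (truncation n (cabs u))) (sq (truncation n (cabs u))) ->
      0 < ip (truncation n (cabs u)) (truncation n (cabs u))].
Proof.
move=> su; have [[[mr _] _ _ _ _] [[mi _] _ _ _ _]] := su.
have mc : measurable_fun setT (cabs u) by exact: measurable_cabs.
have mt : measurable_fun setT (truncation n (cabs u)) by exact: measurable_minr.
have [] := sobolev_modulus (phi := fun y => Num.min y n.+1%:R) su mt.
- by rewrite min_l.
- by move=> x y; exact: truncation_nonexpansive.
move=> G1 [G2 [sG leG leF]]; have [Lt _ _ _ _] := sG.
have [] := L2_sq_truncation (cabs_ge0 u) mt Lt.
move=> Ls les; exists G1, G2; split => // p0.
by have := lt_le_trans p0 les; rewrite pmulr_rgt0// exprn_gt0.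
Qed.

(** Take as competitor a truncation of |u| alone, uncharged. Its energy Q is at most q, so
    [level_bound] gives q times its fourth-power integral at most Q^2 <= q^2: a bound by q for all
    n, which monotone convergence passes to |u|. *)
Lemma L2_sq_charged_component u r1 r2 i1 i2 : csobolev u r1 r2 i1 i2 ->
  ip r1 r1 + ip i1 i1 + (ip r2 r2 + ip i2 i2) + w * (ip (re u) (re u) + ip (im u) (im u)) <= q ->
  L2 (sq (cabs u)).
Proof.
move=> su leq; have [[[mr _] _ _ _ _] [[mi _] _ _ _ _]] := su.
have mc : measurable_fun setT (cabs u) by exact: measurable_cabs.
apply: (L2_sq_of_truncations (C := q) mc (cabs_ge0 u)) => n.
have [G1 [G2 [sG leG leF Ls pos]]] := csobolev_truncation n su; split => //.
set t := truncation n (cabs u) in sG leF Ls pos *.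
have [p0|p0] := leP (ip (sq t) (sq t)) 0; first exact: le_trans p0 (ltW q0).
have QE : quadratic 0 t G1 G2 (fun=> 0) (fun=> 0) (fun=> 0) = ip G1 G1 + ip G2 G2 + w * ip t t.
  by rewrite /quadratic !ip0l; ring.
have z0 : sq (fun=> 0 : R) = (fun=> 0) by apply/funext => x; rewrite /sq expr0n.
have tE : (fun x => t x + 0 * K x) = t by apply/funext => x; rewrite mul0r addr0.
have PE : quartic t (fun=> 0) = ip (sq t) (sq t).
  by rewrite /quartic z0 (ipC mu (sq t) (fun=> 0)) !ip0l; ring.
have Q0 : 0 < ip G1 G1 + ip G2 G2 + w * ip t t.
  by rewrite ltr_wpDl ?addr_ge0 ?ip_ge0// mulr_gt0// pos.
have Qq : ip G1 G1 + ip G2 G2 + w * ip t t <= q.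
  by apply: le_trans leq; apply: lerD leG _; rewrite ler_wpM2l// ltW.
have := level_bound (s := 0) sG sobolev0; rewrite /= tE QE PE z0.
move=> /(_ Ls (L20 mu) Q0) H.
rewrite -(ler_pM2l q0); apply: le_trans H _; rewrite -expr2.
by rewrite lerXn2r// nnegrE ltW.
Qed.

Lemma L2_sq_regular_component v r1 r2 i1 i2 : csobolev v r1 r2 i1 i2 ->
  ip r1 r1 + ip i1 i1 + (ip r2 r2 + ip i2 i2) + wt * (ip (re v) (re v) + ip (im v) (im v)) <= q ->
  L2 (sq (cabs v)).
Proof.
move=> su leq; have [[[mr _] _ _ _ _] [[mi _] _ _ _ _]] := su.
have mc : measurable_fun setT (cabs v) by exact: measurable_cabs.
apply: (L2_sq_of_truncations (C := q) mc (cabs_ge0 v)) => n.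
have [G1 [G2 [sG leG leF Ls pos]]] := csobolev_truncation n su; split => //.
set t := truncation n (cabs v) in sG leF Ls pos *.
have [p0|p0] := leP (ip (sq t) (sq t)) 0; first exact: le_trans p0 (ltW q0).
have QE : quadratic 0 (fun=> 0) (fun=> 0) (fun=> 0) t G1 G2 = ip G1 G1 + ip G2 G2 + wt * ip t t.
  by rewrite /quadratic (ipC mu rho (fun=> 0)) !ip0l; ring.
have z0 : sq (fun=> 0 : R) = (fun=> 0) by apply/funext => x; rewrite /sq expr0n.
have tE : (fun x => 0 + 0 * K x) = (fun=> 0) by apply/funext => x; rewrite mul0r addr0.
have PE : quartic (fun=> 0) t = ip (sq t) (sq t).
  by rewrite /quartic z0 !ip0l; ring.
have Q0 : 0 < ip G1 G1 + ip G2 G2 + wt * ip t t.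
  by rewrite ltr_wpDl ?addr_ge0 ?ip_ge0// mulr_gt0// pos.
have Qq : ip G1 G1 + ip G2 G2 + wt * ip t t <= q.
  by apply: le_trans leq; apply: lerD leG _; rewrite ler_wpM2l// ltW.
have := level_bound (s := 0) sobolev0 sG; rewrite /= tE QE PE z0.
move=> /(_ (L20 mu) Ls Q0) H.
rewrite -(ler_pM2l q0); apply: le_trans H _; rewrite -expr2.
by rewrite lerXn2r// nnegrE ltW.
Qed.

(** * Gain from a small charge *)

Hypotheses (LK2 : L2 (sq K)) (K0 : forall x, 0 <= K x) (rho0 : forall x, 0 <= rho x).

(** Writing (f + s K)^2 = f^2 + X with X >= 0, the quartic part grows by at least 2 <f^2, X> >= 4 s
    <f^2, f K>, while the coupling does not decrease as beta >= 0. The quadratic part loses 2 s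
    <rho, f> >= 0 and changes otherwise by c0 s^2. The last positivity assumption keeps it positive,
    as [level_bound] requires. *)
Lemma charged_gain (s : R) f f1 f2 g g1 g2 : sobolev f f1 f2 -> sobolev g g1 g2 ->
  L2 (sq f) -> L2 (sq g) -> (forall x, 0 <= f x) -> 0 <= s ->
  quadratic 0 f f1 f2 g g1 g2 <= q -> quartic f g = q ->
  0 < w * ip f f - 2 * s * ip rho f + c0 * s ^+ 2 ->
  q * (q + 4 * s * ip (sq f) (fun x => f x * K x)) <= (q + `|c0| * s ^+ 2) ^+ 2.
Proof.
move=> sf sg Lf Lg f0 s0 Qq Pq pos; have [Lf' _ _ _ _] := sf.
have LfK : L2 (fun x => f x * K x).
  exact: L2_mul_of_sq (proj1 Lf') (proj1 LK) Lf LK2.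
pose F x := f x + s * K x; pose X x := 2 * s * (f x * K x) + s ^+ 2 * sq K x.
have FE : sq F = (fun x => sq f x + X x) by apply/funext => x; rewrite /sq /F /X /sq; ring.
have LX : L2 X := L2D (L2Z (2 * s) LfK) (L2Z (s ^+ 2) LK2).
have LF : L2 (sq F) by rewrite FE; exact: L2D Lf LX.
have ipge0 (h h' : plane R -> R) : (forall x, 0 <= h x) -> (forall x, 0 <= h' x) -> 0 <= ip h h'.
  by move=> h0 h'0; apply: Rintegral_ge0 => x _; rewrite mulr_ge0.
have sq0 h x : 0 <= sq h x by exact: sqr_ge0.
have X0 x : 0 <= X x.
  apply: addr_ge0; last exact: mulr_ge0 (sqr_ge0 s) (sq0 K x).
  exact: mulr_ge0 (mulr_ge0 _ s0) (mulr_ge0 (f0 x) (K0 x)).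
have PF : q + 4 * s * ip (sq f) (fun x => f x * K x) <= quartic F g.
  have XE : ip (sq f) X = 2 * s * ip (sq f) (fun x => f x * K x) + s ^+ 2 * ip (sq f) (sq K).
    by rewrite (ipDr (L2Z _ LfK) (L2Z _ LK2) Lf) (ipZr _ LfK Lf) (ipZr _ LK2 Lf).
  rewrite /quartic FE (ip_sqrD Lf LX) (ipDl Lf LX Lg) XE -Pq /quartic.
  have := mulr_ge0 (sqr_ge0 s) (ipge0 _ _ (sq0 f) (sq0 K)).
  have := ip_ge0 mu X; have := mulr_ge0 beta0 (ipge0 _ _ X0 (sq0 g)).
  move: (ip X X) (ip X (sq g)) (ip (sq f) (sq K)) (ip (sq f) (fun x => f x * K x)) => a b c d.
  move: (ip (sq f) (sq f)) (ip (sq g) (sq g)) (ip (sq f) (sq g)) => a' b' d' B3 A2 B1.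
  rewrite -subr_ge0 (_ : _ - _ = 2 * (s ^+ 2 * c) + a + 2 * (beta * b)); last by ring.
  by rewrite !addr_ge0// mulr_ge0.
have r0 : 0 <= s * ip rho f by rewrite mulr_ge0// ipge0.
have QE : quadratic s f f1 f2 g g1 g2 = quadratic 0 f f1 f2 g g1 g2 - 2 * (s * ip rho f) + c0 * s ^+ 2.
  by rewrite /quadratic; ring.
have Q0 : 0 < quadratic s f f1 f2 g g1 g2.
  rewrite /quadratic; have := ip_ge0 mu f1; have := ip_ge0 mu f2; have := ip_ge0 mu g1.
  have := ip_ge0 mu g2; have := mulr_ge0 (ltW wt0) (ip_ge0 mu g).
  by move: pos; lra.
have Qle : quadratic s f f1 f2 g g1 g2 <= q + `|c0| * s ^+ 2.
  rewrite QE; have : c0 * s ^+ 2 <= `|c0| * s ^+ 2 by rewrite ler_wpM2r ?sqr_ge0 ?ler_norm.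
  by move: r0 Qq; lra.
have := level_bound sf sg LF Lg Q0.
move=> H; apply: le_trans (le_trans H _); first by rewrite ler_pM2l.
by rewrite lerXn2r// nnegrE; [exact: ltW|exact: le_trans (ltW Q0) Qle].
Qed.

End competitors.

(** The right side exceeds q^2 by a term linear in s, the left side only by terms of order s^2. *)
Lemma small_charge (R : realType) (q a b A c0 : R) : 0 < q -> 0 < a -> 0 <= b -> 0 < A ->
  exists s, [/\ 0 < s, 0 < a - 2 * s * b + c0 * s ^+ 2 &
    (q + `|c0| * s ^+ 2) ^+ 2 < q * (q + 4 * s * A)].
Proof.
move=> q0 a0 b0 A0; have c1 := ler_norm (- c0); rewrite normrN in c1.
have := normr_ge0 c0; move: `|c0| c1 => c c1 cp.
(* The bounds come from s^2 <= s and s^4 <= s^2. The added 1 keeps the denominators positive and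
   leaves the slack that makes both inequalities strict. *)
pose s := Num.min 1 (Num.min (a / (2 * b + c + 1)) (4 * q * A / (2 * q * c + c ^+ 2 + 1))).
have d1 : 0 < 2 * b + c + 1 by lra.
have d2 : 0 < 2 * q * c + c ^+ 2 + 1.
  by have := mulr_ge0 (ltW q0) cp; have := sqr_ge0 c; lra.
have s0 : 0 < s by rewrite !lt_min ltr01 !divr_gt0// !mulr_gt0.
have s1 : s <= 1 by rewrite !ge_min lexx.
have s2 : s * (2 * b + c + 1) <= a by rewrite -ler_pdivlMr// !ge_min lexx !orbT.
have s3 : s * (2 * q * c + c ^+ 2 + 1) <= 4 * q * A by rewrite -ler_pdivlMr// !ge_min lexx !orbT.
have ss : s ^+ 2 <= s by rewrite expr2 ler_piMl// ltW.
move: (s) s0 s1 s2 s3 ss => {}s s0 s1 s2 s3 ss; exists s; split => //.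
  have h1 : - c * s ^+ 2 <= c0 * s ^+ 2 by rewrite ler_wpM2r ?sqr_ge0// lerNl.
  have h2 : c * s ^+ 2 <= c * s by rewrite ler_wpM2l.
  by move: h1 h2 s2; lra.
have h4 : s ^+ 4 <= s ^+ 2.
  by rewrite (exprM s 2 2) expr2 ler_piMl ?sqr_ge0//; apply: le_trans ss s1.
have h5 : c ^+ 2 * s ^+ 4 <= c ^+ 2 * s ^+ 2 by rewrite ler_wpM2l ?sqr_ge0.
have h6 : s * (s * (2 * q * c + c ^+ 2 + 1)) <= s * (4 * q * A) by rewrite ler_wpM2l// ltW.
have h7 : 0 < s ^+ 2 by rewrite exprn_gt0.
rewrite -subr_gt0.
rewrite (_ : _ - _ = s * (4 * q * A) - 2 * q * c * s ^+ 2 - c ^+ 2 * s ^+ 4); last by ring.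
rewrite (_ : s * (s * _) = 2 * q * c * s ^+ 2 + c ^+ 2 * s ^+ 2 + s ^+ 2) in h6; last by ring.
by move: h5 h6 h7; lra.
Qed.

Section regular.
Context {R : realType}.
Local Notation mu := (mu2 R).
Local Notation ip := (ip mu).
Local Notation L2 := (L2 mu).

Lemma regular_H1 (u : plane R -> R[i]) : H1_alpha u -> Defs.charge u = 0 -> H1 u.
Proof.
move=> [_ ne] c0; have := xgetPex 0 ne; rewrite -/(Defs.charge u) c0 => -[lam _].
by under eq_fun do rewrite mul0r subr0.
Qed.

Lemma qform_regular (alpha w lam : R) (u : plane R -> R[i]) : Defs.charge u = 0 ->
  qform alpha w lam u = grad_norm2 u + w * lnorm 2 u ^+ 2.
Proof.
move=> c0; have rE : regular_part lam u = u.
  by rewrite /regular_part c0; under eq_fun do rewrite mul0r subr0.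
have n0 : ComplexField.Normc.normc (0 : R[i]) = 0 by rewrite /= expr0n/= addr0 sqrtr0.
by rewrite /qform rE c0 n0; ring.
Qed.

Lemma ae_zero_cabs (u : plane R -> R[i]) : {ae mu, forall x, cabs u x = 0} -> ae_zero u.
Proof. by move=> H; apply: negligibleS H => x /= h z; apply: h; apply: ComplexField.Normc.eq0_normc z. Qed.

End regular.

(* lambda is the parameter of the decomposition u = phi_lambda + q G_lambda
   through which the quadratic form is evaluated; every admissible choice is
   covered. *)
Theorem theorem1p8 (R : realType) (alpha omega omegat : R)
    (homega : omega_crit alpha < omega) (homegat : 0 < omegat)
    (lambda : R) (hlambda : omega_crit alpha < lambda <= omega)
    (beta : R) (hbeta : 0 <= beta) :
  ~ exists u v : plane R -> R[i],
      [/\ minimizer alpha omega omegat beta lambda u v,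
          vector_pair u v & regular_pair u v].
Proof.
have oc0 : 0 < omega_crit alpha by rewrite mulr_gt0// expR_gt0.
have w0 := lt_trans oc0 homega.
have lam0 : 0 < lambda by have /andP[h _] := hlambda; exact: lt_trans oc0 h.
move=> [u [v [[[Hau H1v _ nz] lev] [nu _] cu]]]; rewrite /regular_pair in cu.
have H1u := regular_H1 Hau cu; simpl in H1v, nz.
have [r1 [r2 [i1 [i2 su]]]] := (H1P u).1 H1u.
have [p1 [p2 [j1 [j2 sv]]]] := (H1P v).1 H1v.
have [K [rho [[LK Lrho] iK4 [K0 rho0] Kae HK]]] := parametrix w0.
have [c0 Hc0] := qform_charged LK Lrho HK alpha lam0.
have [[Lr _ _ _ _] [Li _ _ _ _]] := su; have [[Lr' _ _ _ _] [Li' _ _ _ _]] := sv.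
have N2 z : L2 (mu2 R) (re z) -> L2 (mu2 R) (im z) ->
    lnorm 2 z ^+ 2 = ip (mu2 R) (re z) (re z) + ip (mu2 R) (im z) (im z).
  by move=> Lz Lz'; apply: lnorm2_sqr; apply/lebesgue_space2P.
have Nf : ip (mu2 R) (re u) (re u) + ip (mu2 R) (im u) (im u) = ip (mu2 R) (cabs u) (cabs u).
  by rewrite -N2// (lnorm_exp u 1) ipE; apply: eq_Rintegral => x _; rewrite expr2.
pose q := (ip (mu2 R) r1 r1 + ip (mu2 R) i1 i1 + (ip (mu2 R) r2 r2 + ip (mu2 R) i2 i2)
  + omega * (ip (mu2 R) (re u) (re u) + ip (mu2 R) (im u) (im u)))
  + (ip (mu2 R) p1 p1 + ip (mu2 R) j1 j1 + (ip (mu2 R) p2 p2 + ip (mu2 R) j2 j2)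
  + omegat * (ip (mu2 R) (re v) (re v) + ip (mu2 R) (im v) (im v))).
(* Formal for now: the quartic integrals could be default values until [Lf4] and [Lg4] show that
   they are finite. *)
have Pq : quartic beta (cabs u) (cabs v) = q.
  have : q - quartic beta (cabs u) (cabs v) = 0.
    rewrite -nz /nehari_functional (qform_regular _ _ _ cu) (grad_norm2E su) (grad_norm2E sv).
    by rewrite (N2 u)// (N2 v)// !lnorm4E couplingE /quartic /q; ring.
  by move=> /eqP; rewrite subr_eq0 => /eqP.
have level : nehari_level alpha omega omegat beta lambda = (q / 4)%:E.
  rewrite -lev; congr EFin.
  have -> : q / 4 = q / 2 - quartic beta (cabs u) (cabs v) / 4 by rewrite Pq; field.
  rewrite /action (qform_regular _ _ _ cu) (grad_norm2E su) (grad_norm2E sv).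
  by rewrite (N2 u)// (N2 v)// !lnorm4E couplingE /quartic /q; field.
have mcu : measurable_fun setT (cabs u) by apply: measurable_cabs; split; [case: Lr|case: Li].
have mcv : measurable_fun setT (cabs v) by apply: measurable_cabs; split; [case: Lr'|case: Li'].
(* From here on (u, v) is replaced by its moduli, with the same quartic part and no larger
   energy. *)
have [G1 [G2 [sf lef ff]]] := sobolev_modulus (phi := id) su mcu (erefl _) (fun x y => lexx _).
have [D1 [D2 [sg leg gg]]] := sobolev_modulus (phi := id) sv mcv (erefl _) (fun x y => lexx _).
rewrite /= in sf ff sg gg.
have [Lf _ _ _ _] := sf; have [Lg _ _ _ _] := sg.
have f0 : 0 < ip (mu2 R) (cabs u) (cabs u).
  rewrite lt_def ip_ge0 andbT; apply/eqP => z; apply/nu/ae_zero_cabs.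
  have := Rintegral_eq0_ae (L2_integrableM Lf Lf) (fun x => mulr_ge0 (cabs_ge0 u x) (cabs_ge0 u x)) z.
  by apply: filterS => x /eqP; rewrite mulf_eq0 orbb => /eqP.
have qu : ip (mu2 R) r1 r1 + ip (mu2 R) i1 i1 + (ip (mu2 R) r2 r2 + ip (mu2 R) i2 i2)
  + omega * (ip (mu2 R) (re u) (re u) + ip (mu2 R) (im u) (im u)) <= q.
  by rewrite lerDl !addr_ge0 ?ip_ge0// mulr_ge0 ?(ltW homegat)// addr_ge0 ?ip_ge0.
have qv : ip (mu2 R) p1 p1 + ip (mu2 R) j1 j1 + (ip (mu2 R) p2 p2 + ip (mu2 R) j2 j2)
  + omegat * (ip (mu2 R) (re v) (re v) + ip (mu2 R) (im v) (im v)) <= q.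
  by rewrite lerDr !addr_ge0 ?ip_ge0// mulr_ge0 ?(ltW w0)// addr_ge0 ?ip_ge0.
have q0 : 0 < q.
  apply: lt_le_trans qu; rewrite Nf ltr_wpDl ?mulr_gt0//.
  by rewrite !addr_ge0 ?ip_ge0.
have Lf4 := L2_sq_charged_component LK Lrho HK Hc0 q0 w0 level su qu.
have Lg4 := L2_sq_regular_component LK Lrho HK Hc0 q0 homegat level sv qv.
have LK4 : L2 (mu2 R) (sq K).
  split; first by apply: measurable_funX; case: LK.
  by apply: eq_integrable iK4 => // x _; rewrite /= /sq -exprM.
have LfK : L2 (mu2 R) (fun x => cabs u x * K x).
  exact: L2_mul_of_sq mcu (proj1 LK) Lf4 LK4.
(* K is positive almost everywhere, so a zero integral of |u|^3 K would force u to vanish. *)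
have A0 : 0 < ip (mu2 R) (sq (cabs u)) (fun x => cabs u x * K x).
  have pos x : 0 <= sq (cabs u) x * (cabs u x * K x).
    by rewrite mulr_ge0 ?sqr_ge0// mulr_ge0 ?cabs_ge0.
  rewrite lt_def Rintegral_ge0 ?andbT//; apply/eqP => z; apply/nu/ae_zero_cabs.
  have := Rintegral_eq0_ae (L2_integrableM Lf4 LfK) pos z.
  move: Kae; apply: filterS2 => x; rewrite /sq; move: (cabs u x) (K x) => a k k0.
  rewrite mulrA -exprSr => /eqP; rewrite mulf_eq0 (gt_eqF k0) orbF expf_eq0/=.
  by move=> /eqP.
have r0 : 0 <= ip (mu2 R) rho (cabs u).
  by apply: Rintegral_ge0 => x _; rewrite mulr_ge0 ?cabs_ge0.
have [s [s0 pos lt]] := small_charge c0 q0 (mulr_gt0 w0 f0) r0 A0.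
have Qq : quadratic omega omegat rho c0 0 (cabs u) G1 G2 (cabs v) D1 D2 <= q.
  rewrite /quadratic mulr0 mul0r subr0 expr0n mulr0 addr0 -Nf /q -[leLHS]addrA.
  by apply: lerD; [exact: lerD lef (lexx _)|exact: lerD leg (ler_wpM2l (ltW homegat) gg)].
have := charged_gain LK Lrho HK Hc0 q0 homegat hbeta level LK4 K0 rho0 sf sg Lf4 Lg4
  (cabs_ge0 u) (ltW s0) Qq Pq pos.
by rewrite leNgt lt.
Qed.
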